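(* Let $f\in\mathcal{S}$ be given by $f(z)=z+\sum_{n=2}^{\infty}a_nz^n$ for $|z|<1$. (i) Then $|a_4|-|a_3|\le c_6$, where $c_6=1.75185\ldots$ is the constant defined in the context. (ii) If $f$ is an odd function, then $|a_5|-|a_3|\le \dfrac{2}{\sqrt{7}}=0.7559\ldots$.
   Context: $\mathbb{D}=\{z\in\mathbb{C}:|z|<1\}$ is the open unit disk. $\mathcal{S}$ is the class of functions $f$ that are analytic and univalent (injective) in $\mathbb{D}$ and have the form $f(z)=z+a_2z^2+a_3z^3+\cdots$ (i.e. $f(0)=0$, $f'(0)=1$). The constant $c_6$ is $$c_6=\max_{(x,y)\in D_1}\left(\frac{2}{\sqrt{5}}\sqrt{1-x^{2}-3y^{2}}+4xy+x^{3}\right)=1.75185\ldots,$$ where $$D_1=\left\{(x,y)\in\mathbb{R}^2:0\le x\le 1,\ 0\le y\le \frac{1}{\sqrt{3}}\sqrt{1-x^{2}}\right\},$$ and dots after a decimal indicate a truncated decimal expansion. *)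

(* Defs.v *)
From Stdlib Require Import Reals Lra Psatz.
From Coquelicot Require Import Coquelicot.
Open Scope R_scope.

Definition unit_disk (z : C) : Prop := Cmod z < 1.

(* [f] is total on [C]; only its values on the unit disk matter.  [ex_derive]
   and [is_derive] are over the field [C], i.e. complex differentiability. *)
Definition analytic_in_disk (f : C -> C) : Prop :=
  forall z : C, unit_disk z -> @ex_derive C_AbsRing C_NormedModule f z.

Definition univalent_in_disk (f : C -> C) : Prop :=
  forall z w : C, unit_disk z -> unit_disk w -> f z = f w -> z = w.

Definition class_S (f : C -> C) : Prop :=
  analytic_in_disk f /\ univalent_in_disk f /\
  f (RtoC 0) = RtoC 0 /\
  @is_derive C_AbsRing C_NormedModule f (RtoC 0) (RtoC 1).

Definition taylor_coefficients (f : C -> C) (a : nat -> C) : Prop :=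
  forall z : C, unit_disk z -> @is_pseries C_AbsRing C_NormedModule a z (f z).

Definition odd_in_disk (f : C -> C) : Prop :=
  forall z : C, unit_disk z -> f (Copp z) = Copp (f z).

Definition D1 (x y : R) : Prop :=
  0 <= x <= 1 /\ 0 <= y <= 1 / sqrt 3 * sqrt (1 - x ^ 2).

Definition c6_objective (x y : R) : R :=
  2 / sqrt 5 * sqrt (1 - x ^ 2 - 3 * y ^ 2) + 4 * x * y + x ^ 3.

(* The least upper bound; [c6_is_max] shows that it is finite and attained. *)
Definition c6 : R :=
  real (Lub_Rbar (fun v => exists x y, D1 x y /\ v = c6_objective x y)).

(* Maximum over [y] for fixed [x], by the Cauchy-Schwarz inequality. *)
Definition c6_profile (x : R) : R :=
  sqrt (1 - x ^ 2) * sqrt (4 / 5 + 16 / 3 * x ^ 2) + x ^ 3.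

Lemma sqr_two_div_sqrt5 : (2 / sqrt 5) ^ 2 = 4 / 5.
Proof.
assert (h : sqrt 5 * sqrt 5 = 5) by (apply sqrt_sqrt; lra).
assert (h0 : 0 < sqrt 5) by (apply sqrt_lt_R0; lra).
replace ((2 / sqrt 5) ^ 2) with (4 / (sqrt 5 * sqrt 5)) by (field; lra).
now rewrite h.
Qed.

Lemma D1_radicand (x y : R) : D1 x y -> 0 <= 1 - x ^ 2 - 3 * y ^ 2.
Proof.
intros [[hx0 hx1] [hy0 hy1]].
assert (hs : 0 <= 1 - x ^ 2) by nra.
assert (h3 : sqrt 3 * sqrt 3 = 3) by (apply sqrt_sqrt; lra).
assert (p3 : 0 < sqrt 3) by (apply sqrt_lt_R0; lra).
assert (hss := sqrt_sqrt _ hs).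
assert (ps := sqrt_pos (1 - x ^ 2)).
set (s := sqrt (1 - x ^ 2)) in *.
assert (h : sqrt 3 * y <= s).
{ replace s with (sqrt 3 * (1 / sqrt 3 * s)) by (field; lra).
  apply Rmult_le_compat_l; lra. }
assert (h' : (sqrt 3 * y) * (sqrt 3 * y) <= s * s).
{ apply Rmult_le_compat; nra. }
nra.
Qed.

Lemma c6_objective_le_profile (x y : R) :
  D1 x y -> c6_objective x y <= c6_profile x.
Proof.
intros hD.
assert (hr := D1_radicand x y hD).
destruct hD as [[hx0 hx1] [hy0 _]].
unfold c6_objective, c6_profile.
apply Rplus_le_compat_r.
rewrite <- sqrt_mult; [|nra|nra].
assert (hA := sqr_two_div_sqrt5).
set (A := 2 / sqrt 5) in *.
assert (hP := sqrt_sqrt _ hr).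
set (P := sqrt (1 - x ^ 2 - 3 * y ^ 2)) in *.
apply Rsqr_incr_0_var; [|apply sqrt_pos].
rewrite Rsqr_sqrt; [|nra].
unfold Rsqr.
rewrite <- hA.
replace (1 - x ^ 2) with (P * P + 3 * y ^ 2) by lra.
assert (h := pow2_ge_0 (3 * A * y - 4 * x * P)).
nra.
Qed.

Lemma c6_profile_attained (x : R) :
  0 <= x <= 1 -> exists y, D1 x y /\ c6_objective x y = c6_profile x.
Proof.
intros hx.
assert (hs : 0 <= 1 - x ^ 2) by nra.
assert (hss := sqrt_sqrt _ hs).
assert (ps := sqrt_pos (1 - x ^ 2)).
assert (hN0 : 0 < 4 / 5 + 16 / 3 * x ^ 2) by nra.
assert (hNN := sqrt_sqrt _ (Rlt_le _ _ hN0)).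
assert (pN := sqrt_lt_R0 _ hN0).
assert (h3 : sqrt 3 * sqrt 3 = 3) by (apply sqrt_sqrt; lra).
assert (p3 : 0 < sqrt 3) by (apply sqrt_lt_R0; lra).
assert (hA := sqr_two_div_sqrt5).
assert (pA : 0 < 2 / sqrt 5).
{ apply Rdiv_lt_0_compat; [lra|apply sqrt_lt_R0; lra]. }
unfold c6_profile, c6_objective, D1.
set (A := 2 / sqrt 5) in *.
set (s := sqrt (1 - x ^ 2)) in *.
set (N := sqrt (4 / 5 + 16 / 3 * x ^ 2)) in *.
exists (s * (4 / 3 * x / N)).
assert (hrad : 1 - x ^ 2 - 3 * (s * (4 / 3 * x / N)) ^ 2
               = (s * A / N) * (s * A / N)).
{ rewrite <- hss.
  replace (s * A / N * (s * A / N)) with (s * s * A ^ 2 / (N * N))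
    by (field; lra).
  replace (3 * (s * (4 / 3 * x / N)) ^ 2)
    with (s * s * (16 / 3 * x ^ 2) / (N * N)) by (field; lra).
  rewrite hA.
  replace (16 / 3 * x ^ 2) with (N * N - 4 / 5) by lra.
  field; lra. }
assert (pP : 0 <= s * A / N).
{ apply Rdiv_le_0_compat; [nra|lra]. }
split.
- split; [exact hx|split].
  + apply Rmult_le_pos; [lra|]. apply Rdiv_le_0_compat; lra.
  + rewrite (Rmult_comm (1 / sqrt 3)).
    apply Rmult_le_compat_l; [lra|].
    apply Rmult_le_reg_r with N; [lra|].
    apply Rmult_le_reg_r with (sqrt 3); [lra|].
    replace (4 / 3 * x / N * N * sqrt 3) with (4 / 3 * x * sqrt 3)
      by (field; lra).
    replace (1 / sqrt 3 * N * sqrt 3) with N by (field; lra).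
    apply Rsqr_incr_0_var; [|lra].
    unfold Rsqr. rewrite hNN. nra.
- rewrite hrad, sqrt_square; [|exact pP].
  f_equal.
  replace (A * (s * A / N) + 4 * x * (s * (4 / 3 * x / N)))
    with (s * (A ^ 2 + 16 / 3 * x ^ 2) / N) by (field; lra).
  rewrite hA, <- hNN. field; lra.
Qed.

Lemma c6_is_max :
  (exists x y, D1 x y /\ c6_objective x y = c6) /\
  (forall x y, D1 x y -> c6_objective x y <= c6).
Proof.
destruct (continuity_ab_maj c6_profile 0 1) as [m [hm hm01]]; [lra| |].
{ intros x hx. unfold c6_profile.
  assert (hs : 0 <= 1 - x ^ 2) by nra.
  assert (hN : 0 <= 4 / 5 + 16 / 3 * x ^ 2) by nra.
  apply continuity_pt_plus; [apply continuity_pt_mult|].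
  - apply (continuity_pt_comp (fun x => 1 - x ^ 2) sqrt).
    + apply derivable_continuous_pt; reg.
    + apply continuity_pt_sqrt; exact hs.
  - apply (continuity_pt_comp (fun x => 4 / 5 + 16 / 3 * x ^ 2) sqrt).
    + apply derivable_continuous_pt; reg.
    + apply continuity_pt_sqrt; exact hN.
  - apply derivable_continuous_pt; reg. }
destruct (c6_profile_attained m hm01) as [y [hD hy]].
assert (hc : c6 = c6_profile m).
{ unfold c6.
  rewrite (is_lub_Rbar_unique _ (Finite (c6_profile m))); [reflexivity|].
  split.
  - intros v [x [z [hxz ->]]]. simpl.
    apply Rle_trans with (c6_profile x).
    + now apply c6_objective_le_profile.
    + apply hm. now destruct hxz.
  - intros b hb. apply hb. exists m, y. now split. }
rewrite hc. split.
- exists m, y. now split.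
- intros x z hxz. apply Rle_trans with (c6_profile x).
  + now apply c6_objective_le_profile.
  + apply hm. now destruct hxz.
Qed.

(* Main.v *)
Require Import Defs.
From Stdlib Require Import Reals Lra Psatz Arith.
From Coquelicot Require Import Coquelicot.
Open Scope R_scope.

(** Write [f z = z * p z].  As [p] has no zeros in the disk, there is a holomorphic [h] with
    [h ^ 2 * p = 1] and [h 0 = 1], and [F z = h (z ^ 2) / z = 1 / sqrt (f (z ^ 2))] is injective on the
    punctured disk.  If [h u = 1 + c1 u + c2 u^2 + ...], the area theorem for [F] gives
    [|c1|^2 + 3 |c2|^2 + 5 |c3|^2 + 7 |c4|^2 <= 1], where [- c_k] is the Grunsky coefficient of index
    [(1, 2 k - 1)] of the odd function [sqrt (f (z ^ 2))].  Both estimates follow: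
    [|a4| - |a3| <= |a4 + c1 a3| = |- 2 c3 + 4 c1 c2 - c1^3|] because [|c1| <= 1], and for odd [f] one
    has [c1 = c3 = 0], [a3 = - 2 c2] and [a5 = 3 c2^2 - 2 c4].

    The area theorem is proved without Green's formula or the Jordan curve theorem.  Put
    [G z = F (exp z)] on the rectangle [ln e <= Re z <= ln t], [0 < Im z < 2 pi].  The image of [G] lies
    in an ellipse of area [pi (1 / e^2 + O(e^2))], so injectivity bounds the integral of [|G'|^2] from
    above.  Parseval's identity on vertical segments computes that integral from below, and [e] tends
    to [0].  The bound of the area of an injective image comes from smearing a radial bump of radius
    proportional to [|G' z|] around each [G z]: by Newton's iteration the bumps covering a given point
    [w = G z0] come from points [z] near [z0] only, and injectivity makes [z0] unique. *)

(** * Holomorphic functions with uniform quadratic error *)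

(** An ellipse is needed because a disk is too large. On the circle [|z| = e] the function
    [1 / z + k z] reaches modulus [1 / e + k e], and the disk of that radius has area
    [pi / e^2 + 2 pi k + pi k^2 e^2], whose excess [2 pi k] survives the limit. The ellipse with
    semi-axes [1 / e + k e] and [1 / e - k e] has area [pi (1 / e^2 - k^2 e^2)]. To align its axes
    with the coordinates, a rotation of the variable first makes [c1] a real number [k >= 0]. The
    terms of higher order in [F] are of size [e^3]; enlarging the semi-axes by a multiple of [e^3]
    changes the area by [O(e^2)], which is harmless. The divergent [pi / e^2] is matched exactly by
    the mode [1 / z] of [F] in Parseval's identity. That mode also leaves [1 / rho] on the right
    side, where [rho] is the square of the outer radius; [rho] tends to 1 at the very end.
    Differentiability is carried by inequalities between values at two points, with explicit
    constants. Such inequalities pass directly to sums, limits and Riemann sums. *)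

Lemma Cmod_minus_le (z w : C) : Cmod (z - w) <= Cmod z + Cmod w.
Proof.
unfold Cminus. eapply Rle_trans; [apply Cmod_triangle|]. rewrite Cmod_opp. lra.
Qed.

Lemma Cmod_minus_sym (z w : C) : Cmod (z - w) = Cmod (w - z).
Proof. rewrite <- Cmod_opp. f_equal. ring. Qed.

Lemma Cmod_minus_ge (z w : C) : Cmod z - Cmod w <= Cmod (z - w).
Proof.
generalize (Cmod_triangle (z - w) w).
replace (z - w + w)%C with z by ring. lra.
Qed.

Lemma im_le_Cmod (z : C) : Rabs (Im z) <= Cmod z.
Proof.
destruct z as [x y]. generalize (Rmax_Cmod (x, y)). simpl.
generalize (Rmax_r (Rabs x) (Rabs y)). lra.
Qed.

Lemma Cmod_le_Re_Im (z : C) : Cmod z <= Rabs (Re z) + Rabs (Im z).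
Proof.
destruct z as [x y]. simpl.
replace ((x, y) : C) with (RtoC x + Ci * RtoC y)%C.
- eapply Rle_trans; [apply Cmod_triangle|].
  rewrite Cmod_mult, Cmod_Ci, !Cmod_R. lra.
- apply injective_projections; simpl; ring.
Qed.

(* [f] has derivative [f'] with a quadratic error bound uniform on [S].  On compact sets this is what continuity of [f'] provides, and it is stable under algebraic operations with no convexity or openness assumption on [S]. *)
Definition C11 (S : C -> Prop) (f f' : C -> C) : Prop :=
  exists M : R, 0 <= M /\
    (forall z, S z -> Cmod (f z) <= M /\ Cmod (f' z) <= M) /\
    (forall z w, S z -> S w ->
       Cmod (f z - f w) <= M * Cmod (z - w) /\
       Cmod (f z - f w - f' w * (z - w)) <= M * Cmod (z - w) ^ 2).

Lemma C11_ext (S : C -> Prop) (f f' g g' : C -> C) :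
  (forall z, S z -> f z = g z /\ f' z = g' z) -> C11 S f f' -> C11 S g g'.
Proof.
intros he [M [hM [h1 h2]]]. exists M. split; [exact hM|split].
- intros z hz. destruct (he z hz) as [<- <-]. auto.
- intros z w hz hw. destruct (he z hz) as [<- _]. destruct (he w hw) as [<- <-]. auto.
Qed.

Lemma C11_sub (S T : C -> Prop) (f f' : C -> C) :
  (forall z, S z -> T z) -> C11 T f f' -> C11 S f f'.
Proof.
intros he [M [hM [h1 h2]]]. exists M. split; [exact hM|split]; auto.
Qed.

Lemma C11_const (S : C -> Prop) (c : C) : C11 S (fun _ => c) (fun _ => RtoC 0).
Proof.
exists (Cmod c). generalize (Cmod_ge_0 c). intros h. split; [exact h|split].
- intros z _. rewrite Cmod_0. lra.
- intros z w _ _.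
  replace (c - c)%C with (RtoC 0) by ring.
  replace (0 - 0 * (z - w))%C with (RtoC 0) by ring.
  rewrite Cmod_0. generalize (Cmod_ge_0 (z - w)). intros. split; nra.
Qed.

Lemma C11_id (S : C -> Prop) (B : R) :
  (forall z, S z -> Cmod z <= B) -> C11 S (fun z => z) (fun _ => RtoC 1).
Proof.
intros hB. exists (1 + Rabs B). generalize (Rabs_pos B). intros h.
split; [lra|split].
- intros z hz. rewrite Cmod_1. generalize (hB z hz) (Rle_abs B). lra.
- intros z w _ _.
  replace (z - w - 1 * (z - w))%C with (RtoC 0) by ring.
  rewrite Cmod_0. generalize (Cmod_ge_0 (z - w)). intros. split; nra.
Qed.

Lemma C11_plus (S : C -> Prop) (f f' g g' : C -> C) :
  C11 S f f' -> C11 S g g' ->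
  C11 S (fun z => f z + g z)%C (fun z => f' z + g' z)%C.
Proof.
intros [M [hM [h1 h2]]] [N [hN [k1 k2]]]. exists (M + N).
split; [lra|split].
- intros z hz. destruct (h1 z hz), (k1 z hz).
  split; (eapply Rle_trans; [apply Cmod_triangle|lra]).
- intros z w hz hw. destruct (h2 z w hz hw), (k2 z w hz hw). split.
  + replace (f z + g z - (f w + g w))%C with ((f z - f w) + (g z - g w))%C by ring.
    eapply Rle_trans; [apply Cmod_triangle|lra].
  + replace (f z + g z - (f w + g w) - (f' w + g' w) * (z - w))%C
      with ((f z - f w - f' w * (z - w)) + (g z - g w - g' w * (z - w)))%C by ring.
    eapply Rle_trans; [apply Cmod_triangle|lra].
Qed.

Lemma C11_mult (S : C -> Prop) (f f' g g' : C -> C) :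
  C11 S f f' -> C11 S g g' ->
  C11 S (fun z => f z * g z)%C (fun z => f' z * g z + f z * g' z)%C.
Proof.
intros [M [hM [h1 h2]]] [N [hN [k1 k2]]]. exists (3 * (M * N)).
assert (hMN := Rmult_le_pos _ _ hM hN).
assert (bd : forall (a b : C) x y, Cmod a <= x -> Cmod b <= y -> Cmod (a * b) <= x * y).
{ intros. rewrite Cmod_mult. apply Rmult_le_compat; auto using Cmod_ge_0. }
split; [nra|split].
- intros z hz. destruct (h1 z hz), (k1 z hz).
  split.
  + generalize (bd (f z) (g z) M N). intros. lra.
  + eapply Rle_trans; [apply Cmod_triangle|].
    generalize (bd (f' z) (g z) M N) (bd (f z) (g' z) M N). lra.
- intros z w hz hw.
  destruct (h1 w hw), (k1 w hw), (h1 z hz), (k1 z hz).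
  destruct (h2 z w hz hw), (k2 z w hz hw).
  assert (p := Cmod_ge_0 (z - w)). set (d := Cmod (z - w)) in *.
  split.
  + replace (f z * g z - f w * g w)%C
      with ((f z - f w) * g z + f w * (g z - g w))%C by ring.
    eapply Rle_trans; [apply Cmod_triangle|].
    generalize (bd (f z - f w)%C (g z) (M * d) N) (bd (f w) (g z - g w)%C M (N * d)).
    intros. assert (0 <= M * N * d) by nra. lra.
  + replace (f z * g z - f w * g w - (f' w * g w + f w * g' w) * (z - w))%C
      with (((f z - f w - f' w * (z - w)) * g w + f w * (g z - g w - g' w * (z - w)))
            + (f z - f w) * (g z - g w))%C by ring.
    eapply Rle_trans; [apply Cmod_triangle|].
    eapply Rle_trans; [apply Rplus_le_compat_r; apply Cmod_triangle|].
    generalize (bd (f z - f w - f' w * (z - w))%C (g w) (M * d ^ 2) N)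
      (bd (f w) (g z - g w - g' w * (z - w))%C M (N * d ^ 2))
      (bd (f z - f w)%C (g z - g w)%C (M * d) (N * d)).
    intros.
    replace (3 * (M * N) * d ^ 2) with (M * d ^ 2 * N + M * (N * d ^ 2) + M * d * (N * d)) by ring.
    apply Rplus_le_compat; [apply Rplus_le_compat|]; auto.
Qed.

Lemma C11_comp (S T : C -> Prop) (f f' g g' : C -> C) :
  (forall z, S z -> T (f z)) -> C11 S f f' -> C11 T g g' ->
  C11 S (fun z => g (f z)) (fun z => g' (f z) * f' z)%C.
Proof.
intros hST [M [hM [h1 h2]]] [N [hN [k1 k2]]]. exists (N * (1 + M + M ^ 2)).
assert (hMN := Rmult_le_pos _ _ hM hN).
split; [nra|split].
- intros z hz. destruct (h1 z hz), (k1 (f z)); auto. split.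
  + nra.
  + rewrite Cmod_mult.
    apply Rle_trans with (N * M); [apply Rmult_le_compat; auto using Cmod_ge_0|nra].
- intros z w hz hw. destruct (h2 z w hz hw), (k2 (f z) (f w)); auto.
  destruct (k1 (f w)); auto.
  assert (p := Cmod_ge_0 (z - w)). set (d := Cmod (z - w)) in *.
  assert (p' := Cmod_ge_0 (f z - f w)).
  split.
  + apply Rle_trans with (N * (M * d)); [|assert (0 <= N * d) by nra; nra].
    eapply Rle_trans; [eassumption|]. apply Rmult_le_compat_l; auto.
  + replace (g (f z) - g (f w) - g' (f w) * f' w * (z - w))%C
      with ((g (f z) - g (f w) - g' (f w) * (f z - f w))
            + g' (f w) * (f z - f w - f' w * (z - w)))%C by ring.
    eapply Rle_trans; [apply Cmod_triangle|].
    apply Rle_trans with (N * (M * d) ^ 2 + N * (M * d ^ 2)).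
    * apply Rplus_le_compat.
      -- eapply Rle_trans; [eassumption|]. apply Rmult_le_compat_l; auto.
         apply pow_incr. auto.
      -- rewrite Cmod_mult. apply Rmult_le_compat; auto using Cmod_ge_0.
    * assert (0 <= N * d ^ 2) by (apply Rmult_le_pos; [lra|apply pow2_ge_0]). nra.
Qed.

Lemma C11_scal (S : C -> Prop) (c : C) (f f' : C -> C) :
  C11 S f f' -> C11 S (fun z => c * f z)%C (fun z => c * f' z)%C.
Proof.
intros h. eapply C11_ext; [|apply C11_mult; [apply (C11_const S c)|exact h]].
intros z _. simpl. split; ring.
Qed.

Lemma C11_minus (S : C -> Prop) (f f' g g' : C -> C) :
  C11 S f f' -> C11 S g g' ->
  C11 S (fun z => f z - g z)%C (fun z => f' z - g' z)%C.
Proof.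
intros h k. eapply C11_ext; [|apply C11_plus; [exact h|apply (C11_scal S (-(1)) _ _ k)]].
intros z _. simpl. split; ring.
Qed.

Lemma Cmod_ge_neq_0 (m : R) (z : C) : 0 < m -> m <= Cmod z -> z <> RtoC 0.
Proof. intros hm h e. rewrite e, Cmod_0 in h. lra. Qed.

(** The function [1 / z] has the exact first order remainder [(z - w)^2 / (z w^2)], so a lower bound
    [m] on the modulus controls all constants; the rest is composition. *)
Lemma C11_inv (S : C -> Prop) (m : R) (f f' : C -> C) :
  0 < m -> (forall z, S z -> m <= Cmod (f z)) -> C11 S f f' ->
  C11 S (fun z => / f z)%C (fun z => - f' z / (f z * f z))%C.
Proof.
intros hm hf h.
assert (hi : C11 (fun z => m <= Cmod z) (fun z => / z)%C (fun z => - (1) / (z * z))%C).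
{ assert (hn : forall z, m <= Cmod z -> z <> RtoC 0) by (intros; now apply Cmod_ge_neq_0 with m).
  assert (hp := Rinv_0_lt_compat m hm).
  assert (hb : forall z, m <= Cmod z -> Cmod (/ z) <= / m).
  { intros z hz. rewrite Cmod_inv by auto. apply Rinv_le_contravar; auto. }
  assert (bd : forall (a b : C) x y, Cmod a <= x -> Cmod b <= y -> Cmod (a * b) <= x * y).
  { intros. rewrite Cmod_mult. apply Rmult_le_compat; auto using Cmod_ge_0. }
  set (k := / m) in *.
  exists (k + k ^ 2 + k ^ 3).
  assert (0 < k ^ 2) by (apply pow_lt; auto). assert (0 < k ^ 3) by (apply pow_lt; auto).
  split; [lra|split].
  - intros z hz. split; [generalize (hb z hz); lra|].
    replace (- (1) / (z * z))%C with (- (/ z * / z))%C by (field; auto).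
    rewrite Cmod_opp. generalize (bd _ _ _ _ (hb z hz) (hb z hz)). nra.
  - intros z w hz hw. assert (p := Cmod_ge_0 (z - w)).
    split.
    + replace (/ z - / w)%C with (- (/ z * / w * (z - w)))%C by (field; auto).
      rewrite Cmod_opp, Cmod_mult. apply Rmult_le_compat_r; auto.
      generalize (bd _ _ _ _ (hb z hz) (hb w hw)). nra.
    + replace (/ z - / w - - (1) / (w * w) * (z - w))%C
        with ((/ z * / w * / w) * ((z - w) * (z - w)))%C by (field; auto).
      rewrite Cmod_mult, (Cmod_mult (z - w)).
      replace (Cmod (z - w) ^ 2) with (Cmod (z - w) * Cmod (z - w)) by ring.
      apply Rmult_le_compat_r; [nra|].
      generalize (bd _ _ _ _ (bd _ _ _ _ (hb z hz) (hb w hw)) (hb w hw)). nra. }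
eapply C11_ext; [|apply (C11_comp S _ f f' _ _ hf h hi)].
intros z hz. simpl. split; [reflexivity|].
field. apply Cmod_ge_neq_0 with m; auto.
Qed.

(** Adding the expansions from [w] to [z] and from [z] to [w] cancels the values of [f] and leaves
    [(f' z - f' w) (z - w)], bounded by twice the quadratic error. *)
Lemma C11_deriv_lip (S : C -> Prop) (f f' : C -> C) :
  C11 S f f' ->
  exists M, 0 <= M /\ forall z w, S z -> S w -> Cmod (f' z - f' w) <= M * Cmod (z - w).
Proof.
intros [M [hM [_ h]]]. exists (2 * M). split; [lra|]. intros z w hz hw.
destruct (h z w hz hw) as [_ a]. destruct (h w z hw hz) as [_ b].
assert (p := Cmod_ge_0 (z - w)).
destruct (Req_dec (Cmod (z - w)) 0) as [e|e].
- assert (e' := Cmod_eq_0 _ e).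
  replace z with w by (replace z with (z - w + w)%C by ring; rewrite e'; ring).
  replace (f' w - f' w)%C with (RtoC 0) by ring.
  replace (w - w)%C with (RtoC 0) by ring. rewrite Cmod_0. lra.
- apply Rmult_le_reg_r with (Cmod (z - w)); [lra|].
  rewrite <- Cmod_mult.
  replace ((f' z - f' w) * (z - w))%C
    with ((f z - f w - f' w * (z - w)) + (f w - f z - f' z * (w - z)))%C by ring.
  eapply Rle_trans; [apply Cmod_triangle|].
  rewrite (Cmod_minus_sym w z) in b. nra.
Qed.

(** * The complex exponential *)

Definition cexp (z : C) : C := (exp (Re z) * cos (Im z), exp (Re z) * sin (Im z)).

Lemma cexp_plus (z w : C) : cexp (z + w) = (cexp z * cexp w)%C.
Proof.
destruct z as [x y], w as [u v]. unfold cexp. simpl.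
rewrite exp_plus, cos_plus, sin_plus.
apply injective_projections; simpl; ring.
Qed.

Lemma cexp_0 : cexp 0 = RtoC 1.
Proof.
unfold cexp. simpl. rewrite exp_0, cos_0, sin_0.
apply injective_projections; simpl; ring.
Qed.

Lemma Cmod_cexp (z : C) : Cmod (cexp z) = exp (Re z).
Proof.
unfold cexp, Cmod. simpl.
replace (exp (Re z) * cos (Im z) * (exp (Re z) * cos (Im z) * 1) +
   exp (Re z) * sin (Im z) * (exp (Re z) * sin (Im z) * 1))
  with (exp (Re z) * exp (Re z) * (Rsqr (sin (Im z)) + Rsqr (cos (Im z))))
  by (unfold Rsqr; ring).
rewrite sin2_cos2, Rmult_1_r. apply sqrt_square. left. apply exp_pos.
Qed.

Lemma cexp_neq_0 (z : C) : cexp z <> RtoC 0.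
Proof. apply Cmod_gt_0. rewrite Cmod_cexp. apply exp_pos. Qed.

Lemma cexp_opp (z : C) : cexp (- z) = (/ cexp z)%C.
Proof.
assert (h := cexp_neq_0 z).
replace (cexp (- z)) with (cexp (- z) * cexp z / cexp z)%C by (field; auto).
rewrite <- cexp_plus. replace (- z + z)%C with (RtoC 0) by ring.
rewrite cexp_0. field. auto.
Qed.

Lemma exp_le_compat (x y : R) : x <= y -> exp x <= exp y.
Proof. intros [h| ->]; [left; now apply exp_increasing|lra]. Qed.

Lemma exp_minus_1_bound (x : R) : Rabs (exp x - 1) <= Rabs x * exp (Rabs x).
Proof.
destruct (MVT_abs exp exp 0 x) as [c [e hc]].
{ intros. apply derivable_pt_lim_exp. }
rewrite exp_0 in e. rewrite e, Rminus_0_r, Rmult_comm.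
apply Rmult_le_compat_l; [apply Rabs_pos|].
rewrite Rabs_pos_eq by (left; apply exp_pos).
apply exp_le_compat. revert hc. unfold Rmin, Rmax, Rabs.
destruct (Rle_dec 0 x), (Rcase_abs x); lra.
Qed.

Lemma exp_taylor1_bound (x : R) : Rabs (exp x - 1 - x) <= x ^ 2 * exp (Rabs x).
Proof.
destruct (MVT_abs (fun t => exp t - t) (fun t => exp t - 1) 0 x) as [c [e hc]].
{ intros t _. apply derivable_pt_lim_minus; [apply derivable_pt_lim_exp|apply derivable_pt_lim_id]. }
simpl in e. rewrite exp_0 in e.
replace (exp x - 1 - x) with (exp x - x - (1 - 0)) by ring.
rewrite e, Rminus_0_r.
assert (hcx : Rabs c <= Rabs x).
{ revert hc. unfold Rmin, Rmax, Rabs.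
  destruct (Rle_dec 0 x), (Rcase_abs x), (Rcase_abs c); lra. }
rewrite <- (pow2_abs x).
assert (h := exp_minus_1_bound c).
assert (h' := exp_le_compat _ _ hcx).
assert (p := exp_pos (Rabs c)). assert (q := Rabs_pos c).
assert (Rabs c * exp (Rabs c) <= Rabs x * exp (Rabs x)) by (apply Rmult_le_compat; lra).
assert (0 <= Rabs x) by apply Rabs_pos.
replace (Rabs x ^ 2 * exp (Rabs x)) with (Rabs x * exp (Rabs x) * Rabs x) by ring.
apply Rmult_le_compat_r; lra.
Qed.

Lemma sin_abs_le (y : R) : Rabs (sin y) <= Rabs y.
Proof.
destruct (MVT_abs sin cos 0 y) as [c [e _]].
{ intros. apply derivable_pt_lim_sin. }
rewrite sin_0, !Rminus_0_r in e. rewrite e.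
assert (Rabs (cos c) <= 1) by (apply Rabs_le; generalize (COS_bound c); lra).
generalize (Rabs_pos y). nra.
Qed.

Lemma cos_minus_1_bound (y : R) : Rabs (cos y - 1) <= y ^ 2.
Proof.
destruct (MVT_abs cos (fun t => - sin t) 0 y) as [c [e hc]].
{ intros. apply derivable_pt_lim_cos. }
rewrite cos_0, Rminus_0_r, Rabs_Ropp in e. rewrite e, <- (pow2_abs y).
assert (Rabs (sin c) <= Rabs y).
{ eapply Rle_trans; [apply sin_abs_le|]. revert hc. unfold Rmin, Rmax, Rabs.
  destruct (Rle_dec 0 y), (Rcase_abs y), (Rcase_abs c); lra. }
generalize (Rabs_pos y). nra.
Qed.

Lemma sin_taylor1_bound (y : R) : Rabs (sin y - y) <= y ^ 2.
Proof.
destruct (MVT_abs (fun t => sin t - t) (fun t => cos t - 1) 0 y) as [c [e hc]].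
{ intros t _. apply derivable_pt_lim_minus; [apply derivable_pt_lim_sin|apply derivable_pt_lim_id]. }
simpl in e. rewrite sin_0 in e.
replace (sin y - y) with (sin y - y - (0 - 0)) by ring. rewrite e, Rminus_0_r.
rewrite <- (pow2_abs y).
assert (hcy : Rabs c <= Rabs y).
{ revert hc. unfold Rmin, Rmax, Rabs.
  destruct (Rle_dec 0 y), (Rcase_abs y), (Rcase_abs c); lra. }
destruct (MVT_abs cos (fun t => - sin t) 0 c) as [c' [e' hc']].
{ intros. apply derivable_pt_lim_cos. }
rewrite cos_0, Rminus_0_r, Rabs_Ropp in e'.
assert (Rabs (sin c') <= 1) by (apply Rabs_le; generalize (SIN_bound c'); lra).
generalize (Rabs_pos y) (Rabs_pos c). rewrite e'. intros.
assert (Rabs (sin c') * Rabs c <= Rabs y) by nra. nra.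
Qed.

Lemma cexp_taylor1 (z : C) :
  Cmod (cexp z - 1 - z) <= 4 * exp (Cmod z) * Cmod z ^ 2.
Proof.
eapply Rle_trans; [apply Cmod_le_Re_Im|].
assert (hx := re_le_Cmod z). rewrite Cmod2_alt.
assert (he := exp_le_compat _ _ hx).
destruct z as [x y]. unfold cexp. simpl Re. simpl Im. simpl in hx, he.
set (B := exp (Cmod (x, y))) in *.
assert (e1 := exp_taylor1_bound x). assert (e2 := exp_minus_1_bound x).
assert (e3 := cos_minus_1_bound y). assert (e4 := sin_taylor1_bound y).
assert (p := exp_pos (Rabs x)). assert (p' := exp_pos x).
assert (e5 := exp_le_compat _ _ (Rle_abs x)).
assert (hy := Rabs_pos y). assert (hx' := Rabs_pos x).
replace (exp x * cos y + - (1) + - x) with ((exp x - 1 - x) + exp x * (cos y - 1)) by ring.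
replace (exp x * sin y + - 0 + - y) with (exp x * (sin y - y) + (exp x - 1) * y) by ring.
assert (Rabs (exp x - 1 - x + exp x * (cos y - 1)) <= B * x ^ 2 + B * y ^ 2).
{ eapply Rle_trans; [apply Rabs_triang|]. rewrite Rabs_mult, (Rabs_pos_eq (exp x)) by lra.
  apply Rplus_le_compat; [nra|]. apply Rmult_le_compat; try lra. apply Rabs_pos. }
assert (Rabs (exp x * (sin y - y) + (exp x - 1) * y) <= B * y ^ 2 + B * (Rabs x * Rabs y)).
{ eapply Rle_trans; [apply Rabs_triang|]. rewrite !Rabs_mult, (Rabs_pos_eq (exp x)) by lra.
  apply Rplus_le_compat; [apply Rmult_le_compat; try lra; apply Rabs_pos|].
  replace (B * (Rabs x * Rabs y)) with (Rabs x * B * Rabs y) by ring.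
  apply Rmult_le_compat_r; [lra|]. nra. }
assert (Rabs x * Rabs y <= x ^ 2 + y ^ 2).
{ rewrite <- (pow2_abs x), <- (pow2_abs y). nra. }
assert (0 < B) by lra. assert (0 <= x ^ 2) by apply pow2_ge_0. assert (0 <= y ^ 2) by apply pow2_ge_0.
nra.
Qed.

(** The functional equation moves the expansion at [w] to the origin, where [cexp_taylor1] applies
    to [z - w], of modulus at most [2 b]. *)
Lemma C11_cexp (S : C -> Prop) (B : R) :
  (forall z, S z -> Cmod z <= B) -> C11 S cexp cexp.
Proof.
intros hB.
set (b := Rabs B). assert (hb : 0 <= b) by apply Rabs_pos.
assert (hb' : forall z, S z -> Cmod z <= b).
{ intros z hz. generalize (hB z hz) (Rle_abs B). unfold b. lra. }
set (k := 4 * exp (2 * b)). assert (hk : 0 < k) by (generalize (exp_pos (2 * b)); unfold k; lra).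
assert (he : 0 < exp b) by apply exp_pos.
assert (hre : forall z, S z -> Cmod (cexp z) <= exp b).
{ intros z hz. rewrite Cmod_cexp. apply exp_le_compat.
  generalize (hb' z hz) (re_le_Cmod z) (Rle_abs (Re z)). lra. }
assert (h2 : forall z w, S z -> S w ->
  Cmod (cexp z - cexp w - cexp w * (z - w)) <= exp b * k * Cmod (z - w) ^ 2).
{ intros z w hz hw.
  replace z with (w + (z - w))%C at 1 by ring. rewrite cexp_plus.
  replace (cexp w * cexp (z - w) - cexp w - cexp w * (z - w))%C
    with (cexp w * (cexp (z - w) - 1 - (z - w)))%C by ring.
  rewrite Cmod_mult, Rmult_assoc. apply Rmult_le_compat; auto using Cmod_ge_0.
  eapply Rle_trans; [apply cexp_taylor1|].
  apply Rmult_le_compat_r; [apply pow2_ge_0|]. unfold k.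
  apply Rmult_le_compat_l; [lra|]. apply exp_le_compat.
  generalize (Cmod_minus_le z w) (hb' z hz) (hb' w hw). lra. }
assert (hek : 0 < exp b * k) by (apply Rmult_lt_0_compat; auto).
exists (exp b * k * (2 * b) + exp b * k + exp b).
split; [nra|split].
- intros z hz. generalize (hre z hz). intros. split; nra.
- intros z w hz hw. generalize (h2 z w hz hw). intros h.
  assert (p := Cmod_ge_0 (z - w)).
  assert (q : Cmod (z - w) <= 2 * b) by (generalize (Cmod_minus_le z w) (hb' z hz) (hb' w hw); lra).
  split.
  + replace (cexp z - cexp w)%C
      with ((cexp z - cexp w - cexp w * (z - w)) + cexp w * (z - w))%C by ring.
    eapply Rle_trans; [apply Cmod_triangle|]. rewrite (Cmod_mult (cexp w)).
    assert (Cmod (cexp w) * Cmod (z - w) <= exp b * Cmod (z - w))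
      by (apply Rmult_le_compat_r; auto).
    assert (exp b * k * Cmod (z - w) ^ 2 <= exp b * k * (2 * b) * Cmod (z - w)).
    { replace (exp b * k * Cmod (z - w) ^ 2) with (exp b * k * Cmod (z - w) * Cmod (z - w)) by ring.
      apply Rmult_le_compat_r; auto. nra. }
    nra.
  + eapply Rle_trans; [exact h|]. apply Rmult_le_compat_r; [apply pow2_ge_0|].
    assert (0 <= exp b * k * (2 * b)) by nra. lra.
Qed.

(** * Lipschitz functions on rectangles and Riemann sums *)

Definition Lip (L a b : R) (f : R -> R) : Prop :=
  forall x y, a <= x <= b -> a <= y <= b -> Rabs (f x - f y) <= L * Rabs (x - y).

(** Precomposition with this retraction extends a Lipschitz function from [[a, b]] to the line,
    which supplies the two-sided continuity at the end points that integrability asks for. *)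
Definition clamp (a b x : R) : R := Rmax a (Rmin b x).

Lemma clamp_in (a b x : R) : a <= b -> a <= clamp a b x <= b.
Proof. unfold clamp, Rmax, Rmin. intros. destruct (Rle_dec b x); destruct (Rle_dec a _); lra. Qed.

Lemma clamp_id (a b x : R) : a <= x <= b -> clamp a b x = x.
Proof. unfold clamp, Rmax, Rmin. intros. destruct (Rle_dec b x); destruct (Rle_dec a _); lra. Qed.

Lemma clamp_lip (a b x y : R) : a <= b -> Rabs (clamp a b x - clamp a b y) <= Rabs (x - y).
Proof.
intros hab. unfold clamp.
unfold Rmin. destruct (Rle_dec b x), (Rle_dec b y);
unfold Rmax; repeat match goal with |- context [Rle_dec ?p ?q] => destruct (Rle_dec p q) end;
unfold Rabs; repeat match goal with |- context [Rcase_abs ?p] => destruct (Rcase_abs p) end; lra.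
Qed.

Lemma lip_continuous (L r : R) (f : R -> R) (x0 : R) : 0 < r ->
  (forall x, Rabs (x - x0) < r -> Rabs (f x - f x0) <= L * Rabs (x - x0)) -> continuous f x0.
Proof.
intros hr h. apply continuity_pt_filterlim.
intros eps heps.
assert (hL : 0 < Rabs L + 1) by (generalize (Rabs_pos L); lra).
exists (Rmin r (eps / (Rabs L + 1))).
split; [apply Rmin_pos; auto; now apply Rdiv_lt_0_compat|].
intros x [_ hx]. simpl in *. unfold Rdist in *.
assert (h1 := Rlt_le_trans _ _ _ hx (Rmin_l _ _)).
assert (h2 := Rlt_le_trans _ _ _ hx (Rmin_r _ _)).
eapply Rle_lt_trans; [now apply h|].
apply Rle_lt_trans with ((Rabs L + 1) * Rabs (x - x0)).
- apply Rmult_le_compat_r; [apply Rabs_pos|]. generalize (Rle_abs L). lra.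
- apply Rmult_lt_reg_r with (/ (Rabs L + 1)); [now apply Rinv_0_lt_compat|].
  replace ((Rabs L + 1) * Rabs (x - x0) * / (Rabs L + 1)) with (Rabs (x - x0)) by (field; lra).
  exact h2.
Qed.

Lemma lip_ex_RInt (L a b : R) (f : R -> R) : a <= b -> 0 <= L -> Lip L a b f -> ex_RInt f a b.
Proof.
intros hab hL h.
apply ex_RInt_ext with (fun x => f (clamp a b x)).
- intros x hx. rewrite Rmin_left, Rmax_right in hx by lra. rewrite clamp_id; lra.
- apply (ex_RInt_continuous (V := R_CompleteNormedModule)). intros z _. apply (lip_continuous L 1); [lra|]. intros x _.
  eapply Rle_trans; [apply h; now apply clamp_in|].
  apply Rmult_le_compat_l; [lra|]. now apply clamp_lip.
Qed.

Lemma RInt_const_R (a b c : R) : RInt (fun _ => c) a b = (b - a) * c.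
Proof. rewrite RInt_const. reflexivity. Qed.

Lemma RInt_abs_diff (f g : R -> R) (a b e : R) : a <= b ->
  ex_RInt f a b -> ex_RInt g a b ->
  (forall x, a <= x <= b -> Rabs (f x - g x) <= e) ->
  Rabs (RInt f a b - RInt g a b) <= (b - a) * e.
Proof.
intros hab hf hg h.
assert (c : ex_RInt (fun _ : R => e) a b) by apply ex_RInt_const.
assert (RInt f a b <= RInt g a b + (b - a) * e).
{ rewrite <- RInt_const_R, <- (RInt_plus (V := R_CompleteNormedModule) g); auto.
  apply RInt_le; auto. { now apply ex_RInt_plus. }
  intros x hx. unfold plus; simpl. generalize (h x ltac:(lra)) (Rle_abs (f x - g x)). lra. }
assert (RInt g a b <= RInt f a b + (b - a) * e).
{ rewrite <- RInt_const_R, <- (RInt_plus (V := R_CompleteNormedModule) f); auto.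
  apply RInt_le; auto. { now apply ex_RInt_plus. }
  intros x hx. unfold plus; simpl. generalize (h x ltac:(lra)) (Rle_abs (- (f x - g x))).
  rewrite Rabs_Ropp. lra. }
apply Rabs_le. lra.
Qed.

Lemma sum_f_R0_abs_diff (f g : nat -> R) (e : R) (n : nat) :
  (forall k, (k <= n)%nat -> Rabs (f k - g k) <= e) ->
  Rabs (sum_f_R0 f n - sum_f_R0 g n) <= INR (S n) * e.
Proof.
induction n as [|n IH]; intros h.
- simpl. generalize (h 0%nat ltac:(lia)). lra.
- rewrite S_INR. simpl sum_f_R0.
  replace (sum_f_R0 f n + f (S n) - (sum_f_R0 g n + g (S n)))
    with ((sum_f_R0 f n - sum_f_R0 g n) + (f (S n) - g (S n))) by ring.
  eapply Rle_trans; [apply Rabs_triang|].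
  generalize (IH ltac:(auto)) (h (S n) ltac:(lia)). lra.
Qed.

Lemma ex_RInt_sub (f : R -> R) (a b c d : R) : a <= c -> c <= d -> d <= b ->
  ex_RInt f a b -> ex_RInt f c d.
Proof.
intros hac hcd hdb h.
apply (ex_RInt_Chasles_2 (V := R_CompleteNormedModule) f a); [lra|].
apply (ex_RInt_Chasles_1 (V := R_CompleteNormedModule) f a _ b); [lra|exact h].
Qed.

Lemma RInt_pieces (f : R -> R) (a s : R) (n : nat) : 0 <= s ->
  ex_RInt f a (a + INR (S n) * s) ->
  RInt f a (a + INR (S n) * s)
  = sum_f_R0 (fun i => RInt f (a + INR i * s) (a + INR (S i) * s)) n.
Proof.
intros hs. induction n as [|n IH]; intros h.
- simpl. now rewrite Rmult_0_l, Rplus_0_r.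
- assert (p := pos_INR (S n)).
  assert (hle : a <= a + INR (S n) * s <= a + INR (S (S n)) * s).
  { rewrite (S_INR (S n)). nra. }
  assert (h1 : ex_RInt f a (a + INR (S n) * s)) by (apply (ex_RInt_Chasles_1 f a _ _ hle h)).
  assert (h2 : ex_RInt f (a + INR (S n) * s) (a + INR (S (S n)) * s))
    by (apply (ex_RInt_Chasles_2 f a _ _ hle h)).
  rewrite <- (RInt_Chasles f a _ _ h1 h2), (IH h1). reflexivity.
Qed.

(** Each of the [S n] cells of length [s] contributes an error of at most [L s^2]. *)
Lemma riemann_sum_1d (L a b : R) (f : R -> R) (n : nat) :
  a <= b -> 0 <= L -> Lip L a b f ->
  let s := (b - a) / INR (S n) in
  Rabs (s * sum_f_R0 (fun i => f (a + INR i * s)) n - RInt f a b) <= L * (b - a) * s.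
Proof.
intros hab hL h s.
assert (hn : 0 < INR (S n)) by (apply lt_0_INR; lia).
assert (hs : 0 <= s) by (apply Rdiv_le_0_compat; lra).
assert (hb : b = a + INR (S n) * s) by (unfold s; field; lra).
assert (he : ex_RInt f a b) by (apply (lip_ex_RInt L); auto).
rewrite hb at 1. rewrite RInt_pieces; [|auto|now rewrite <- hb].
rewrite scal_sum.
eapply Rle_trans; [apply sum_f_R0_abs_diff with (e := L * s * s)|].
- intros k hk.
  assert (hk0 := pos_INR k).
  assert (hkn : INR (S k) <= INR (S n)) by (apply le_INR; lia).
  assert (hk1 : INR (S k) = INR k + 1) by apply S_INR.
  assert (r1 : a <= a + INR k * s <= a + INR (S k) * s) by nra.
  assert (r2 : a + INR (S k) * s <= b) by (rewrite hb at 1; nra).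
  assert (r3 : a + INR (S k) * s - (a + INR k * s) = s) by (rewrite hk1; ring).
  rewrite Rmult_comm.
  rewrite <- r3 at 1. rewrite <- RInt_const_R.
  eapply Rle_trans; [apply RInt_abs_diff with (e := L * s)|].
  + lra.
  + apply ex_RInt_const.
  + apply (ex_RInt_sub f a b); auto; lra.
  + intros x hx. eapply Rle_trans; [apply h; lra|].
    apply Rmult_le_compat_l; [lra|]. apply Rabs_le. lra.
  + rewrite r3. lra.
- right. unfold s. field. lra.
Qed.

Definition in_rect (a b c d : R) (z : C) : Prop := a <= Re z <= b /\ c <= Im z <= d.

Definition LipC (L a b c d : R) (f : C -> R) : Prop :=
  forall z w, in_rect a b c d z -> in_rect a b c d w -> Rabs (f z - f w) <= L * Cmod (z - w).

Definition DInt (f : C -> R) (a b c d : R) : R :=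
  RInt (fun u => RInt (fun v => f (u, v)) c d) a b.

Lemma Cmod_horizontal (u u' v : R) : Cmod ((u, v) - (u', v)) = Rabs (u - u').
Proof.
rewrite <- Cmod_R. f_equal. apply injective_projections; simpl; ring.
Qed.

Lemma Cmod_vertical (u v v' : R) : Cmod ((u, v) - (u, v')) = Rabs (v - v').
Proof.
replace ((u, v) - (u, v'))%C with (Ci * RtoC (v - v'))%C
  by (apply injective_projections; simpl; ring).
rewrite Cmod_mult, Cmod_Ci, Cmod_R. ring.
Qed.

Section Rectangle.

Variables (a b c d : R).
Hypotheses (hab : a <= b) (hcd : c <= d).

Lemma LipC_slice (L : R) (f : C -> R) (u : R) :
  LipC L a b c d f -> a <= u <= b -> Lip L c d (fun v => f (u, v)).
Proof.
intros h hu x y hx hy. eapply Rle_trans; [apply h; split; simpl; lra|].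
rewrite Cmod_vertical. lra.
Qed.

Lemma LipC_inner (L : R) (f : C -> R) :
  0 <= L -> LipC L a b c d f -> Lip ((d - c) * L) a b (fun u => RInt (fun v => f (u, v)) c d).
Proof.
intros hL h x y hx hy.
rewrite Rmult_assoc.
apply RInt_abs_diff; auto; try (apply (lip_ex_RInt L); auto; now apply LipC_slice).
intros v hv. eapply Rle_trans; [apply h; split; simpl; lra|].
rewrite Cmod_horizontal. lra.
Qed.

Lemma LipC_inner_ex (L : R) (f : C -> R) (u : R) :
  0 <= L -> LipC L a b c d f -> a <= u <= b -> ex_RInt (fun v => f (u, v)) c d.
Proof. intros. apply (lip_ex_RInt L); auto. now apply LipC_slice. Qed.

Lemma LipC_outer_ex (L : R) (f : C -> R) :
  0 <= L -> LipC L a b c d f -> ex_RInt (fun u => RInt (fun v => f (u, v)) c d) a b.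
Proof.
intros. apply (lip_ex_RInt ((d - c) * L)); auto.
- apply Rmult_le_pos; lra.
- now apply LipC_inner.
Qed.

Lemma LipC_plus (L M : R) (f g : C -> R) :
  LipC L a b c d f -> LipC M a b c d g -> LipC (L + M) a b c d (fun z => f z + g z).
Proof.
intros h k z w hz hw.
replace (f z + g z - (f w + g w)) with ((f z - f w) + (g z - g w)) by ring.
eapply Rle_trans; [apply Rabs_triang|].
generalize (h z w hz hw) (k z w hz hw). lra.
Qed.

Lemma LipC_sum (f : nat -> C -> R) (n : nat) :
  (forall k, exists L, 0 <= L /\ LipC L a b c d (f k)) ->
  exists L, 0 <= L /\ LipC L a b c d (fun z => sum_f_R0 (fun k => f k z) n).
Proof.
intros h. induction n as [|n [L [hL IH]]]; [apply h|].
destruct (h (S n)) as [M [hM hS]]. exists (L + M). split; [lra|].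
simpl. now apply LipC_plus.
Qed.

Lemma DInt_plus (L M : R) (f g : C -> R) : 0 <= L -> 0 <= M ->
  LipC L a b c d f -> LipC M a b c d g ->
  DInt (fun z => f z + g z) a b c d = DInt f a b c d + DInt g a b c d.
Proof.
intros hL hM hf hg. unfold DInt.
transitivity (RInt (fun u => plus (RInt (fun v => f (u, v)) c d) (RInt (fun v => g (u, v)) c d)) a b).
- apply RInt_ext. intros u hu. rewrite Rmin_left, Rmax_right in hu by lra.
  apply (RInt_plus (fun v => f (u, v)) (fun v => g (u, v)));
    [apply (LipC_inner_ex L)|apply (LipC_inner_ex M)]; auto; lra.
- apply (RInt_plus (V := R_CompleteNormedModule)); [apply (LipC_outer_ex L)|apply (LipC_outer_ex M)]; auto.
Qed.

Lemma DInt_sum (f : nat -> C -> R) (n : nat) :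
  (forall k, exists L, 0 <= L /\ LipC L a b c d (f k)) ->
  DInt (fun z => sum_f_R0 (fun k => f k z) n) a b c d
  = sum_f_R0 (fun k => DInt (f k) a b c d) n.
Proof.
intros h. induction n as [|n IH]; [reflexivity|]. simpl. rewrite <- IH.
destruct (LipC_sum f n h) as [L [hL h1]]. destruct (h (S n)) as [M [hM h2]].
apply (DInt_plus L M); auto.
Qed.

Lemma riemann_sum_2d (L : R) (f : C -> R) (n : nat) : 0 <= L -> LipC L a b c d f ->
  let s := (b - a) / INR (S n) in let t := (d - c) / INR (S n) in
  Rabs (s * t * sum_f_R0 (fun i => sum_f_R0 (fun j => f (a + INR i * s, c + INR j * t)) n) n
        - DInt f a b c d) <= L * (b - a) * (d - c) * (s + t).
Proof.
intros hL h s t.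
assert (hn : 0 < INR (S n)) by (apply lt_0_INR; lia).
assert (hs : 0 <= s) by (apply Rdiv_le_0_compat; lra).
assert (ht : 0 <= t) by (apply Rdiv_le_0_compat; lra).
assert (hi := LipC_inner L f hL h).
assert (hL' : 0 <= (d - c) * L) by (apply Rmult_le_pos; lra).
assert (r := riemann_sum_1d _ a b _ n hab hL' hi). cbv zeta in r. fold s in r.
set (F := fun u => RInt (fun v => f (u, v)) c d) in *.
unfold DInt. fold F.
set (S2 := sum_f_R0 (fun i => sum_f_R0 (fun j => f (a + INR i * s, c + INR j * t)) n) n).
set (S1 := sum_f_R0 (fun i => F (a + INR i * s)) n) in *.
assert (e : Rabs (t * S2 - S1) <= INR (S n) * (L * (d - c) * t)).
{ unfold S1, S2. rewrite scal_sum. apply sum_f_R0_abs_diff. intros k hk.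
  rewrite Rmult_comm. apply (riemann_sum_1d L c d (fun v => f (a + INR k * s, v)) n); auto. apply LipC_slice; auto.
  assert (hkn : INR k <= INR (S n)) by (apply le_INR; lia).
  assert (hk0 := pos_INR k).
  assert (INR k * s <= INR (S n) * s) by (apply Rmult_le_compat_r; auto).
  assert (INR (S n) * s = b - a) by (unfold s; field; lra).
  assert (0 <= INR k * s) by (apply Rmult_le_pos; auto). lra. }
replace (s * t * S2 - RInt F a b) with (s * (t * S2 - S1) + (s * S1 - RInt F a b)) by ring.
eapply Rle_trans; [apply Rabs_triang|]. rewrite Rabs_mult, (Rabs_pos_eq s) by auto.
replace (L * (b - a) * (d - c) * (s + t))
  with (s * (INR (S n) * (L * (d - c) * t)) + (d - c) * L * (b - a) * s).
- apply Rplus_le_compat; auto. now apply Rmult_le_compat_l.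
- unfold s at 1. field. lra.
Qed.

End Rectangle.

(* A radial bump, so that its integral is unchanged when the plane is rotated by the argument of a derivative. *)
Definition bump (p : C) (l : R) (w : C) : R := Rmax 0 (1 - Cmod (w - p) / l).

Lemma bump_ge_0 p l w : 0 <= bump p l w.
Proof. apply Rmax_l. Qed.

Lemma bump_out p l w : 0 < l -> l <= Cmod (w - p) -> bump p l w = 0.
Proof.
intros hl h. apply Rmax_left.
assert (1 <= Cmod (w - p) / l); [|lra].
apply Rmult_le_reg_r with l; auto. unfold Rdiv. rewrite Rmult_assoc, Rinv_l; lra.
Qed.

Lemma bump_lip p l z w : 0 < l -> Rabs (bump p l z - bump p l w) <= / l * Cmod (z - w).
Proof.
intros hl. unfold bump.
assert (h1 := Cmod_minus_ge (z - p) (w - p)). assert (h2 := Cmod_minus_ge (w - p) (z - p)).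
replace (z - p - (w - p))%C with (z - w)%C in h1 by ring.
replace (w - p - (z - p))%C with (w - z)%C in h2 by ring.
rewrite (Cmod_minus_sym w z) in h2.
assert (hi := Rinv_0_lt_compat l hl).
set (x := Cmod (z - p)) in *. set (y := Cmod (w - p)) in *. set (e := Cmod (z - w)) in *.
assert (x / l - y / l <= / l * e) by (unfold Rdiv; nra).
assert (y / l - x / l <= / l * e) by (unfold Rdiv; nra).
assert (0 <= / l * e) by (apply Rmult_le_pos; [lra|apply Cmod_ge_0]).
apply Rabs_le. unfold Rmax. destruct (Rle_dec 0 _), (Rle_dec 0 _); lra.
Qed.

Lemma bump_LipC p l a b c d : 0 < l -> LipC (/ l) a b c d (bump p l).
Proof. intros hl z w _ _. now apply bump_lip. Qed.

Definition bump_slice (x : R) : R := RInt (fun y => bump 0 1 (x, y)) (-1) 1.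

(** The volume of a cone of height 1 over the unit disk. It occurs on both sides of the area
    estimate and cancels, so the proof establishes its positivity rather than its value. *)
Definition bump_mass : R := RInt bump_slice (-1) 1.

Lemma ex_RInt_lip (L : R) (f : R -> R) (a b : R) :
  (forall x y, Rabs (f x - f y) <= L * Rabs (x - y)) -> ex_RInt f a b.
Proof.
intros h. apply (ex_RInt_continuous (V := R_CompleteNormedModule)). intros z _. apply (lip_continuous L 1); [lra|auto].
Qed.

Lemma RInt_support_le (L : R) (g : R -> R) (a b : R) : a <= b ->
  (forall x y, Rabs (g x - g y) <= L * Rabs (x - y)) ->
  (forall x, 0 <= g x) -> (forall x, 1 <= Rabs x -> g x = 0) ->
  RInt g a b <= RInt g (-1) 1 /\ (a <= -1 -> 1 <= b -> RInt g a b = RInt g (-1) 1).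
Proof.
intros hab hL h0 h1.
assert (hex : forall x y, ex_RInt g x y) by (intros; now apply (ex_RInt_lip L)).
assert (hz : forall x y, x <= y -> (y <= -1 \/ 1 <= x) -> RInt g x y = 0).
{ intros x y hxy hc. rewrite (RInt_ext g (fun _ => 0)).
  - rewrite RInt_const_R. apply Rmult_0_r.
  - intros t ht. rewrite Rmin_left, Rmax_right in ht by lra. apply h1.
    unfold Rabs. destruct (Rcase_abs t); lra. }
assert (hp : forall x y, x <= y -> 0 <= RInt g x y).
{ intros x y hxy. apply RInt_ge_0; auto. }
assert (hc : forall x y z, RInt g x z = RInt g x y + RInt g y z).
{ intros. symmetry. apply (RInt_Chasles g x y z); auto. }
split.
- destruct (Rle_dec b (-1)) as [h2|h2]; [rewrite (hz a b) by lra; apply hp; lra|].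
  destruct (Rle_dec 1 a) as [h3|h3]; [rewrite (hz a b) by lra; apply hp; lra|].
  (* [u] and [v] are the end points of the intersection of [[a, b]] with [[-1, 1]]. *)
  assert (hu : exists u, a <= u /\ -1 <= u <= 1 /\ u <= b /\ RInt g a u = 0).
  { destruct (Rle_dec a (-1)).
    - exists (-1). repeat split; try lra. apply hz; lra.
    - exists a. repeat split; try lra. now rewrite RInt_point. }
  destruct hu as [u [u1 [u2 [u3 hu]]]].
  assert (hv : exists v, v <= b /\ u <= v <= 1 /\ RInt g v b = 0).
  { destruct (Rle_dec b 1).
    - exists b. repeat split; try lra. now rewrite RInt_point.
    - exists 1. repeat split; try lra. apply hz; lra. }
  destruct hv as [v [v1 [v2 hv]]].
  rewrite (hc a u b), (hc u v b), (hc (-1) u 1), (hc u v 1).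
  generalize (hp (-1) u ltac:(lra)) (hp v 1 ltac:(lra)). lra.
- intros ha hb. rewrite (hc a (-1) b), (hc (-1) 1 b), (hz a (-1)), (hz 1 b); lra.
Qed.

(** * Radial bumps and the area of an ellipse *)

Lemma RInt_rescale (g : R -> R) (a b q l : R) : 0 < l -> (forall x y, ex_RInt g x y) ->
  RInt (fun v => g ((v - q) / l)) a b = l * RInt g ((a - q) / l) ((b - q) / l).
Proof.
intros hl hex.
replace ((a - q) / l) with (/ l * a + - q / l) by (field; lra).
replace ((b - q) / l) with (/ l * b + - q / l) by (field; lra).
rewrite <- (RInt_comp_lin (V := R_CompleteNormedModule)) by auto.
rewrite <- (RInt_scal (V := R_CompleteNormedModule) _ a b l)
  by (apply (ex_RInt_comp_lin (V := R_NormedModule)); auto).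
apply RInt_ext. intros x _. unfold scal; simpl; unfold mult; simpl.
replace (/ l * x + - q / l) with ((x - q) / l) by (field; lra). field. lra.
Qed.

Lemma bump_rescale (p : C) (l u v : R) : 0 < l ->
  bump p l (u, v) = bump 0 1 ((u - Re p) / l, (v - Im p) / l).
Proof.
intros hl. unfold bump. f_equal. f_equal. rewrite Rdiv_1_r.
replace ((((u - Re p) / l)%R, ((v - Im p) / l)%R) - 0)%C with (((u, v) - p) / RtoC l)%C.
- rewrite Cmod_div by (apply Cmod_ge_neq_0 with l; auto; rewrite Cmod_R, Rabs_pos_eq; lra).
  rewrite Cmod_R, Rabs_pos_eq; lra.
- destruct p as [p1 p2]. apply injective_projections; simpl; field; lra.
Qed.

Lemma bump_unit_lip_h (x x' y : R) : Rabs (bump 0 1 (x, y) - bump 0 1 (x', y)) <= 1 * Rabs (x - x').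
Proof.
eapply Rle_trans; [apply bump_lip; lra|]. rewrite Cmod_horizontal. lra.
Qed.

Lemma bump_unit_lip_v (x y y' : R) : Rabs (bump 0 1 (x, y) - bump 0 1 (x, y')) <= 1 * Rabs (y - y').
Proof.
eapply Rle_trans; [apply bump_lip; lra|]. rewrite Cmod_vertical. lra.
Qed.

Lemma bump_unit_ex (x a b : R) : ex_RInt (fun y => bump 0 1 (x, y)) a b.
Proof. apply (ex_RInt_lip 1). intros. apply bump_unit_lip_v. Qed.

Lemma bump_unit_out (x y : R) : 1 <= Rabs x \/ 1 <= Rabs y -> bump 0 1 (x, y) = 0.
Proof.
intros h. apply bump_out; [lra|].
replace ((x, y) - 0)%C with (x, y) by (apply injective_projections; simpl; ring).
generalize (re_le_Cmod (x, y)) (im_le_Cmod (x, y)). simpl. lra.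
Qed.

Lemma bump_slice_lip (x x' : R) : Rabs (bump_slice x - bump_slice x') <= 2 * Rabs (x - x').
Proof.
unfold bump_slice.
eapply Rle_trans; [apply RInt_abs_diff with (e := Rabs (x - x')); try apply bump_unit_ex|]; [lra| |lra].
intros y _. generalize (bump_unit_lip_h x x' y). lra.
Qed.

Lemma bump_slice_ge_0 (x : R) : 0 <= bump_slice x.
Proof. apply RInt_ge_0; [lra|apply bump_unit_ex|]. intros. apply bump_ge_0. Qed.

Lemma bump_slice_out (x : R) : 1 <= Rabs x -> bump_slice x = 0.
Proof.
intros h. unfold bump_slice. rewrite (RInt_ext _ (fun _ => 0)).
- rewrite RInt_const_R. apply Rmult_0_r.
- intros y _. apply bump_unit_out. auto.
Qed.

Lemma bump_slice_ex (a b : R) : ex_RInt bump_slice a b.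
Proof. apply (ex_RInt_lip 2). apply bump_slice_lip. Qed.

Lemma bump_slice_rescale_ex (q l a b : R) : 0 < l ->
  ex_RInt (fun u => bump_slice ((u - q) / l)) a b.
Proof.
intros hl. apply (ex_RInt_lip (2 / l)). intros x y.
eapply Rle_trans; [apply bump_slice_lip|].
replace ((x - q) / l - (y - q) / l) with ((x - y) / l) by (field; lra).
rewrite Rabs_div, (Rabs_pos_eq l) by lra. right. field. lra.
Qed.

Lemma DInt_bump_inner (p : C) (l c d u : R) : 0 < l ->
  RInt (fun v => bump p l (u, v)) c d
  = l * RInt (fun y => bump 0 1 ((u - Re p) / l, y)) ((c - Im p) / l) ((d - Im p) / l).
Proof.
intros hl.
rewrite <- (RInt_rescale (fun y => bump 0 1 ((u - Re p) / l, y))) by (auto; intros; apply bump_unit_ex).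
apply RInt_ext. intros v _. now apply bump_rescale.
Qed.

Lemma div_le_compat (x y l : R) : 0 < l -> x <= y -> x / l <= y / l.
Proof. intros hl h. apply Rmult_le_compat_r; auto. left. now apply Rinv_0_lt_compat. Qed.

(** The rectangle may cut off part of the support. This is the form needed in the source, where the
    bump around a preimage may reach beyond the rectangle. *)
Lemma DInt_bump_le (p : C) (l a b c d : R) : 0 < l -> a <= b -> c <= d ->
  DInt (bump p l) a b c d <= l ^ 2 * bump_mass.
Proof.
intros hl hab hcd. unfold DInt.
apply Rle_trans with (RInt (fun u => l * bump_slice ((u - Re p) / l)) a b).
- apply RInt_le; auto.
  + apply (LipC_outer_ex a b c d hab hcd (/ l)).
    * left. now apply Rinv_0_lt_compat.
    * now apply bump_LipC.
  + apply (ex_RInt_scal (V := R_NormedModule) (fun u => bump_slice ((u - Re p) / l))).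
    now apply bump_slice_rescale_ex.
  + intros u hu. rewrite DInt_bump_inner by auto.
    apply Rmult_le_compat_l; [lra|]. unfold bump_slice.
    apply (RInt_support_le 1).
    * apply div_le_compat; lra.
    * intros. apply bump_unit_lip_v.
    * intros. apply bump_ge_0.
    * intros. apply bump_unit_out. auto.
- rewrite (RInt_scal (V := R_CompleteNormedModule) (fun u => bump_slice ((u - Re p) / l))).
  + unfold scal; simpl; unfold mult; simpl.
    rewrite (RInt_rescale bump_slice) by (auto; intros; apply bump_slice_ex).
    rewrite Rmult_1_r, Rmult_assoc. apply Rmult_le_compat_l; [lra|].
    apply Rmult_le_compat_l; [lra|].
    apply (RInt_support_le 2).
    * apply div_le_compat; lra.
    * apply bump_slice_lip.
    * apply bump_slice_ge_0.
    * apply bump_slice_out.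
  + now apply bump_slice_rescale_ex.
Qed.

(** The form needed in the target, where the support of every bump lies in the box around the
    ellipse. *)
Lemma DInt_bump_eq (p : C) (l a b c d : R) : 0 < l ->
  a <= Re p - l -> Re p + l <= b -> c <= Im p - l -> Im p + l <= d ->
  DInt (bump p l) a b c d = l ^ 2 * bump_mass.
Proof.
intros hl ha hb hc hd. unfold DInt.
assert (hm : forall x q, x <= q - l -> (x - q) / l <= -1).
{ intros x q h. replace (-1) with (- l / l) by (field; lra). apply div_le_compat; lra. }
assert (hM : forall x q, q + l <= x -> 1 <= (x - q) / l).
{ intros x q h. replace 1 with (l / l) by (field; lra). apply div_le_compat; lra. }
rewrite (RInt_ext _ (fun u => scal l (bump_slice ((u - Re p) / l)))).
- rewrite (RInt_scal (V := R_CompleteNormedModule) (fun u => bump_slice ((u - Re p) / l))).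
  + unfold scal; simpl; unfold mult; simpl.
    rewrite (RInt_rescale bump_slice) by (auto; intros; apply bump_slice_ex).
    rewrite Rmult_1_r, Rmult_assoc. f_equal. f_equal.
    apply (RInt_support_le 2); auto.
    * apply div_le_compat; lra.
    * apply bump_slice_lip.
    * apply bump_slice_ge_0.
    * apply bump_slice_out.
  + now apply bump_slice_rescale_ex.
- intros u _. rewrite DInt_bump_inner by auto. apply (f_equal (Rmult l)). unfold bump_slice.
  apply (RInt_support_le 1); auto.
  + apply div_le_compat; lra.
  + intros. apply bump_unit_lip_v.
  + intros. apply bump_ge_0.
  + intros. apply bump_unit_out. auto.
Qed.

Lemma RInt_restrict_ge (L m : R) (g : R -> R) :
  (forall x y, Rabs (g x - g y) <= L * Rabs (x - y)) -> (forall x, 0 <= g x) ->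
  (forall x, -1/4 <= x <= 1/4 -> m <= g x) -> m / 2 <= RInt g (-1) 1.
Proof.
intros hL h0 hm.
assert (hex : forall x y, ex_RInt g x y) by (intros; now apply (ex_RInt_lip L)).
assert (hc : forall x y z, RInt g x z = RInt g x y + RInt g y z).
{ intros. symmetry. apply (RInt_Chasles g x y z); auto. }
rewrite (hc (-1) (-1/4) 1), (hc (-1/4) (1/4) 1).
assert (hp : forall x y, x <= y -> 0 <= RInt g x y).
{ intros x y hxy. apply RInt_ge_0; auto. }
assert (m / 2 <= RInt g (-1/4) (1/4)).
{ replace (m / 2) with ((1/4 - -1/4) * m) by field. rewrite <- RInt_const_R.
  apply RInt_le; auto; [lra|apply ex_RInt_const|]. intros x hx. apply hm. lra. }
generalize (hp (-1) (-1/4) ltac:(lra)) (hp (1/4) 1 ltac:(lra)). lra.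
Qed.

Lemma bump_mass_pos : 0 < bump_mass.
Proof.
(* The bump is at least 1/2 on the square of side 1/2 around the origin, and each of the two
   integrations contributes a factor 1/2. *)
apply Rlt_le_trans with ((1 / 2 / 2) / 2); [lra|].
apply (RInt_restrict_ge 2).
- apply bump_slice_lip.
- apply bump_slice_ge_0.
- intros x hx. apply (RInt_restrict_ge 1).
  + intros. apply bump_unit_lip_v.
  + intros. apply bump_ge_0.
  + intros y hy. unfold bump.
    replace ((x, y) - 0)%C with (x, y) by (apply injective_projections; simpl; ring).
    assert (h := Cmod_le_Re_Im (x, y)). simpl in h.
    assert (Rabs x <= 1/4) by (apply Rabs_le; lra).
    assert (Rabs y <= 1/4) by (apply Rabs_le; lra).
    eapply Rle_trans; [|apply Rmax_r]. lra.
Qed.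

(** Holds on the whole line because [sqrt] is extended by 0 to negative arguments. *)
Lemma continuous_half_circle (x : R) : continuous (fun x => sqrt (1 - x ^ 2)) x.
Proof.
apply (continuous_comp (fun x => 1 - x ^ 2) sqrt); [|apply continuous_sqrt].
apply continuity_pt_filterlim. apply derivable_continuous_pt. reg.
Qed.

(** Substitution [x = sin t], with [cos t >= 0] on the range of [t], and the antiderivative
    [(t + sin t cos t) / 2] of [cos t ^ 2]. *)
Lemma RInt_half_disk : RInt (fun x => sqrt (1 - x ^ 2)) (-1) 1 = PI / 2.
Proof.
assert (hpi := PI_RGT_0).
assert (h1 : is_RInt (fun t => scal (cos t) (sqrt (1 - sin t ^ 2))) (- (PI / 2)) (PI / 2)
   (RInt (fun x => sqrt (1 - x ^ 2)) (sin (- (PI / 2))) (sin (PI / 2)))).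
{ apply (is_RInt_comp (V := R_CompleteNormedModule) (fun x => sqrt (1 - x ^ 2)) sin cos).
  - intros x _. apply continuous_half_circle.
  - intros x _. split.
    + apply is_derive_Reals. apply derivable_pt_lim_sin.
    + apply continuity_pt_filterlim. apply derivable_continuous_pt. apply derivable_cos. }
rewrite sin_neg, sin_PI2 in h1. replace (- (1)) with (-1) in h1 by ring.
assert (h2 : is_RInt (fun t => cos t * cos t) (- (PI / 2)) (PI / 2)
   (minus ((PI / 2 + sin (PI / 2) * cos (PI / 2)) / 2)
          ((- (PI / 2) + sin (- (PI / 2)) * cos (- (PI / 2))) / 2))).
{ apply (is_RInt_derive (V := R_CompleteNormedModule) (fun t => (t + sin t * cos t) / 2)).
  - intros x _. auto_derive; auto. generalize (sin2_cos2 x). unfold Rsqr. intros. nra.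
  - intros x _. apply continuity_pt_filterlim. apply derivable_continuous_pt. reg. }
transitivity (RInt (fun t => cos t * cos t) (- (PI / 2)) (PI / 2)).
- rewrite <- (is_RInt_unique _ _ _ _ h1).
  apply RInt_ext. intros t ht. rewrite Rmin_left, Rmax_right in ht by lra.
  assert (0 <= cos t) by (apply cos_ge_0; lra).
  unfold scal; simpl; unfold mult; simpl. f_equal.
  replace (1 - sin t * (sin t * 1)) with (cos t * cos t)
    by (generalize (sin2_cos2 t); unfold Rsqr; lra).
  now apply sqrt_square.
- rewrite (is_RInt_unique _ _ _ _ h2). rewrite cos_neg, cos_PI2.
  unfold minus, plus, opp; simpl. lra.
Qed.

Definition in_ellipse (A B : R) (w : C) : Prop := (Re w / A) ^ 2 + (Im w / B) ^ 2 <= 1.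

(** On the vertical line at [u] the integrand is at most [k] on the chord of half-length [B s] and
    at most 0 off it. Integrating chord lengths gives the area without integrating a discontinuous
    indicator function. *)
Lemma DInt_ellipse_le (L A B k : R) (N : C -> R) : 0 < A -> 0 < B -> 0 <= L -> 0 <= k ->
  LipC L (-A) A (-B) B N ->
  (forall w, N w <= k) -> (forall w, ~ in_ellipse A B w -> N w <= 0) ->
  DInt N (-A) A (-B) B <= k * (PI * A * B).
Proof.
intros hA hB hL hk hN h1 h0.
assert (hcont := continuous_half_circle).
assert (hex : forall x y, ex_RInt (fun x => sqrt (1 - x ^ 2)) x y)
  by (intros; apply (ex_RInt_continuous (V := R_CompleteNormedModule)); auto).
(* The form [(u - 0) / A] matches [RInt_rescale] with centre 0. *)
apply Rle_trans with (RInt (fun u => k * (2 * B) * sqrt (1 - ((u - 0) / A) ^ 2)) (-A) A).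
- apply RInt_le; [lra|apply (LipC_outer_ex (-A) A (-B) B) with L; auto; lra| |].
  + apply (ex_RInt_scal (V := R_NormedModule) (fun u => sqrt (1 - ((u - 0) / A) ^ 2)) (-A) A (k * (2 * B))).
    apply (ex_RInt_continuous (V := R_CompleteNormedModule)). intros u _.
    apply (continuous_comp (fun u => (u - 0) / A) (fun x => sqrt (1 - x ^ 2))); auto.
    apply continuity_pt_filterlim. apply derivable_continuous_pt. reg.
  + intros u hu.
    set (s := sqrt (1 - ((u - 0) / A) ^ 2)).
    assert (hs : 0 <= s) by apply sqrt_pos.
    assert (hq : ((u - 0) / A) ^ 2 <= 1).
    { replace 1 with (1 ^ 2) by ring. apply pow_maj_Rabs. unfold Rdiv. rewrite Rabs_mult.
      rewrite (Rabs_pos_eq (/ A)) by (left; now apply Rinv_0_lt_compat).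
      apply Rmult_le_reg_r with A; auto. rewrite Rmult_assoc, Rinv_l by lra.
      rewrite Rmult_1_r, Rmult_1_l. apply Rabs_le. lra. }
    assert (hs2 : s * s = 1 - ((u - 0) / A) ^ 2) by (apply sqrt_sqrt; lra).
    assert (hs1 : s <= 1) by (generalize (pow2_ge_0 ((u - 0) / A)); nra).
    assert (hBs : 0 <= B * s <= B) by nra.
    assert (he : ex_RInt (fun v => N (u, v)) (-B) B)
      by (apply (LipC_inner_ex (-A) A (-B) B) with L; auto; lra).
    assert (hsub : forall v1 v2, -B <= v1 -> v1 <= v2 -> v2 <= B -> ex_RInt (fun v => N (u, v)) v1 v2).
    { intros. apply (ex_RInt_sub _ (-B) B); auto. }
    assert (he1 := hsub (-B) (- (B * s)) ltac:(lra) ltac:(lra) ltac:(lra)).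
    assert (he2 := hsub (- (B * s)) B ltac:(lra) ltac:(lra) ltac:(lra)).
    assert (he3 := hsub (- (B * s)) (B * s) ltac:(lra) ltac:(lra) ltac:(lra)).
    assert (he4 := hsub (B * s) B ltac:(lra) ltac:(lra) ltac:(lra)).
    rewrite <- (RInt_Chasles (V := R_CompleteNormedModule) _ _ _ _ he1 he2).
    rewrite <- (RInt_Chasles (V := R_CompleteNormedModule) _ _ _ _ he3 he4).
    unfold plus; simpl.
    assert (hout : forall v, B * s < Rabs v -> N (u, v) <= 0).
    { intros v hv. apply h0. unfold in_ellipse. simpl Re; simpl Im.
      replace (u / A) with ((u - 0) / A) by (field; lra).
      assert (s * s < (v / B) ^ 2); [|lra].
      rewrite <- pow2_abs, Rabs_div, (Rabs_pos_eq B) by lra.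
      assert (s < Rabs v / B).
      { apply Rmult_lt_reg_r with B; auto. unfold Rdiv. rewrite Rmult_assoc, Rinv_l; lra. }
      nra. }
    assert (k1 : RInt (fun v => N (u, v)) (-B) (- (B * s)) <= 0).
    { rewrite <- (Rmult_0_r (- (B * s) - - B)), <- RInt_const_R.
      apply RInt_le; auto; [lra|apply ex_RInt_const|]. intros v hv. apply hout.
      rewrite <- Rabs_Ropp, Rabs_pos_eq; lra. }
    assert (k3 : RInt (fun v => N (u, v)) (B * s) B <= 0).
    { rewrite <- (Rmult_0_r (B - (B * s))), <- RInt_const_R.
      apply RInt_le; auto; [lra|apply ex_RInt_const|]. intros v hv. apply hout.
      rewrite Rabs_pos_eq; lra. }
    assert (k2 : RInt (fun v => N (u, v)) (- (B * s)) (B * s) <= (B * s - - (B * s)) * k).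
    { rewrite <- RInt_const_R. apply RInt_le; auto; [lra|apply ex_RInt_const]. }
    fold s. lra.
- rewrite (RInt_scal (V := R_CompleteNormedModule) (fun u => sqrt (1 - ((u - 0) / A) ^ 2))).
  + rewrite (RInt_rescale (fun x => sqrt (1 - x ^ 2))) by auto.
    replace ((- A - 0) / A) with (-1) by (field; lra).
    replace ((A - 0) / A) with 1 by (field; lra).
    rewrite RInt_half_disk. unfold scal; simpl; unfold mult; simpl. lra.
  + apply (ex_RInt_continuous (V := R_CompleteNormedModule)). intros u _.
    apply (continuous_comp (fun u => (u - 0) / A) (fun x => sqrt (1 - x ^ 2))); auto.
    apply continuity_pt_filterlim. apply derivable_continuous_pt. reg.
Qed.

(** * The area of an injective holomorphic image *)

Lemma le_of_geom (x y k q : R) : 0 <= q < 1 -> (forall n, x <= y + k * q ^ n) -> x <= y.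
Proof.
intros hq h.
apply (is_lim_seq_le (fun _ => x) (fun n => y + k * q ^ n) x y); auto.
- apply is_lim_seq_const.
- replace (Finite y) with (Rbar_plus y (Rbar_mult k 0)) by (simpl; f_equal; ring).
  apply is_lim_seq_plus'; [apply is_lim_seq_const|].
  apply (is_lim_seq_scal_l _ k 0). apply is_lim_seq_geom. rewrite Rabs_pos_eq; lra.
Qed.

(** Serves as the limit passage for meshes of order [1 / n] and for radii or parameters chosen of
    order [1 / n]. *)
Lemma le_of_harmonic (x y k : R) : (forall n, x <= y + k / INR (S n)) -> x <= y.
Proof.
intros h.
apply (is_lim_seq_le (fun _ => x) (fun n => y + k * / INR (S n)) x y); auto.
- apply is_lim_seq_const.
- replace (Finite y) with (Rbar_plus y (Rbar_mult k 0)) by (simpl; f_equal; ring).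
  apply is_lim_seq_plus'; [apply is_lim_seq_const|].
  apply (is_lim_seq_scal_l _ k 0).
  apply (is_lim_seq_incr_1 (fun n => / INR n)).
  replace (Finite 0) with (Rbar_inv p_infty) by reflexivity.
  apply is_lim_seq_inv; [apply is_lim_seq_INR|discriminate].
Qed.

Lemma geometric_cauchy_R (u : nat -> R) (q e : R) : 0 <= q < 1 -> 0 <= e ->
  (forall n, Rabs (u (S n) - u n) <= e * q ^ n) ->
  exists l, forall n, Rabs (l - u n) <= e / (1 - q) * q ^ n.
Proof.
intros hq he h.
set (k := e / (1 - q)). assert (hk : 0 <= k) by (apply Rdiv_le_0_compat; lra).
assert (ek : e = k * (1 - q)) by (unfold k; field; lra).
assert (hqn : forall n, 0 <= q ^ n) by (intros; apply pow_le; lra).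
(* The difference [q^n - q^(n + m)] is what induction on [m] propagates, since
   [e q^j = k (q^j - q^(j + 1))]. *)
assert (hd : forall n m, Rabs (u (n + m)%nat - u n) <= k * (q ^ n - q ^ (n + m))).
{ intros n m. induction m as [|m IH].
  - rewrite Nat.add_0_r, !Rminus_diag, Rabs_R0. lra.
  - rewrite Nat.add_succ_r.
    replace (u (S (n + m)) - u n) with ((u (S (n + m)) - u (n + m)%nat) + (u (n + m)%nat - u n)) by ring.
    eapply Rle_trans; [apply Rabs_triang|].
    generalize (h (n + m)%nat). rewrite ek. simpl. nra. }
assert (hd' : forall n m, Rabs (u (n + m)%nat - u n) <= k * q ^ n).
{ intros n m. eapply Rle_trans; [apply hd|]. generalize (hqn (n + m)%nat). nra. }
assert (hc : ex_finite_lim_seq u).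
{ apply ex_lim_seq_cauchy_corr. intros eps.
  assert (hz : is_lim_seq (fun n => k * q ^ n) 0).
  { replace (Finite 0) with (Rbar_mult k 0) by (simpl; f_equal; ring).
    apply (is_lim_seq_scal_l _ k 0). apply is_lim_seq_geom. rewrite Rabs_pos_eq; lra. }
  apply is_lim_seq_spec in hz. destruct (hz (pos_div_2 eps)) as [N hN]. exists N.
  intros n m hn hm.
  assert (a1 := hd' N (n - N)%nat). assert (a2 := hd' N (m - N)%nat).
  replace (N + (n - N))%nat with n in a1 by lia. replace (N + (m - N))%nat with m in a2 by lia.
  assert (b := hN N (le_n N)). rewrite Rminus_0_r in b.
  simpl in b. generalize (Rle_abs (k * q ^ N)). intros.
  replace (u n - u m) with ((u n - u N) - (u m - u N)) by ring.
  eapply Rle_lt_trans; [apply Rabs_triang|]. rewrite Rabs_Ropp. lra. }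
destruct hc as [l hl]. exists l. intros n.
apply (is_lim_seq_le (fun m => Rabs (u (m + n)%nat - u n)) (fun _ => k * q ^ n)
  (Rabs (l - u n)) (k * q ^ n)).
- intros m. rewrite Nat.add_comm. apply hd'.
- apply (is_lim_seq_abs _ (l - u n)). apply is_lim_seq_minus'; [|apply is_lim_seq_const].
  now apply is_lim_seq_incr_n.
- apply is_lim_seq_const.
Qed.

Lemma geometric_cauchy_C (x : nat -> C) (q e : R) : 0 <= q < 1 -> 0 <= e ->
  (forall n, Cmod (x (S n) - x n) <= e * q ^ n) ->
  exists l, forall n, Cmod (l - x n) <= 2 * (e / (1 - q)) * q ^ n.
Proof.
intros hq he h.
destruct (geometric_cauchy_R (fun n => Re (x n)) q e hq he) as [l1 h1].
{ intros n. eapply Rle_trans; [|apply h]. apply (re_le_Cmod (x (S n) - x n)). }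
destruct (geometric_cauchy_R (fun n => Im (x n)) q e hq he) as [l2 h2].
{ intros n. eapply Rle_trans; [|apply h]. apply (im_le_Cmod (x (S n) - x n)). }
exists (l1, l2). intros n. eapply Rle_trans; [apply Cmod_le_Re_Im|].
change (Re ((l1, l2) - x n)%C) with (l1 - Re (x n)). change (Im ((l1, l2) - x n)%C) with (l2 - Im (x n)).
generalize (h1 n) (h2 n). lra.
Qed.

(** The Newton map [x - (G x - w) / D] with frozen derivative contracts by [q] on the disk of radius
    [r], and the bound on [w - G z0] keeps its iterates there. The last clause compares the limit
    with [z0] once more and locates the preimage. *)
Lemma newton_surjective (G : C -> C) (z0 D w : C) (q r : R) :
  D <> RtoC 0 -> 0 <= q < 1 -> 0 <= r ->
  (forall x y, Cmod (x - z0) <= r -> Cmod (y - z0) <= r ->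
     Cmod (G x - G y - D * (x - y)) <= q * Cmod D * Cmod (x - y)) ->
  Cmod (w - G z0) <= (1 - q) * r * Cmod D ->
  exists x, Cmod (x - z0) <= r /\ G x = w /\
    (1 - q) * Cmod D * Cmod (x - z0) <= Cmod (w - G z0).
Proof.
intros hD hq hr hG hw.
assert (pD : 0 < Cmod D) by now apply Cmod_gt_0.
set (Phi := fun x => (x - (G x - w) / D)%C).
assert (hPhi : forall x y, Cmod (x - z0) <= r -> Cmod (y - z0) <= r ->
  Cmod (Phi x - Phi y) <= q * Cmod (x - y)).
{ intros x y hx hy. unfold Phi.
  replace (x - (G x - w) / D - (y - (G y - w) / D))%C
    with (- ((G x - G y - D * (x - y)) / D))%C by (field; auto).
  rewrite Cmod_opp, Cmod_div by auto.
  apply Rmult_le_reg_r with (Cmod D); auto. unfold Rdiv.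
  rewrite Rmult_assoc, Rinv_l, Rmult_1_r by lra.
  generalize (hG x y hx hy). lra. }
set (e := Cmod (w - G z0) / Cmod D).
assert (he : 0 <= e) by (apply Rdiv_le_0_compat; [apply Cmod_ge_0|auto]).
assert (eC : e * Cmod D = Cmod (w - G z0)) by (unfold e; field; lra).
assert (her : e <= (1 - q) * r) by (apply Rmult_le_reg_r with (Cmod D); lra).
set (x := fun n => Nat.iter n Phi z0).
assert (hz0 : Cmod (z0 - z0) <= r).
{ replace (z0 - z0)%C with (RtoC 0) by ring. now rewrite Cmod_0. }
assert (hqn : forall n, 0 <= q ^ n) by (intros; apply pow_le; lra).
assert (hle : forall n y, y <= r * (1 - q ^ n) -> y <= r).
{ intros n y hy. assert (0 <= r * q ^ n) by (apply Rmult_le_pos; auto). lra. }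
(* The gap [r q^n] left by the first bound has room for the next step, of length at most
   [(1 - q) r q^n]. *)
assert (hx : forall n, Cmod (x n - z0) <= r * (1 - q ^ n) /\ Cmod (x (S n) - x n) <= e * q ^ n).
{ induction n as [|n [IH1 IH2]].
  - split; simpl.
    + replace (z0 - z0)%C with (RtoC 0) by ring. rewrite Cmod_0. lra.
    + unfold x; simpl. unfold Phi.
      replace (z0 - (G z0 - w) / D - z0)%C with ((w - G z0) / D)%C by (field; auto).
      rewrite Cmod_div by auto. fold e. lra.
  - assert (h1 : Cmod (x (S n) - z0) <= r * (1 - q ^ S n)).
    { replace (x (S n) - z0)%C with ((x (S n) - x n) + (x n - z0))%C by ring.
      eapply Rle_trans; [apply Cmod_triangle|]. change (q ^ S n) with (q * q ^ n). assert (hn := hqn n).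
      assert (e * q ^ n <= (1 - q) * r * q ^ n) by (apply Rmult_le_compat_r; auto). lra. }
    split; auto.
    assert (b1 : Cmod (x (S n) - z0) <= r) by exact (hle (S n) _ h1).
    assert (b0 : Cmod (x n - z0) <= r) by exact (hle n _ IH1).
    change (x (S (S n))) with (Phi (x (S n))). change (x (S n)) with (Phi (x n)) at 2.
    eapply Rle_trans; [apply hPhi; auto|]. change (q ^ S n) with (q * q ^ n).
    replace (e * (q * q ^ n)) with (q * (e * q ^ n)) by ring. apply Rmult_le_compat_l; lra. }
destruct (geometric_cauchy_C x q e hq he) as [l hl]; [apply hx|].
set (k := 2 * (e / (1 - q))) in *.
assert (hlr : Cmod (l - z0) <= r).
{ apply le_of_geom with k q; auto. intros n.
  replace (l - z0)%C with ((l - x n) + (x n - z0))%C by ring.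
  eapply Rle_trans; [apply Cmod_triangle|]. generalize (hl n) (hle n _ (proj1 (hx n))). lra. }
assert (hGl : G l = w).
{ assert (h0 : Cmod (G l - w) <= 0).
  { apply le_of_geom with ((1 + q) * Cmod D * k + Cmod D * e) q; auto. intros n.
    assert (hxn : Cmod (x n - z0) <= r) by (apply (hle n); apply hx).
    assert (h1 := hG l (x n) hlr hxn).
    assert (h2 := proj2 (hx n)).
    assert (h3 : Cmod (G (x n) - w) <= Cmod D * (e * q ^ n)).
    { replace (G (x n) - w)%C with (- (D * (x (S n) - x n)))%C.
      - rewrite Cmod_opp, Cmod_mult. apply Rmult_le_compat_l; auto. lra.
      - change (x (S n)) with (Phi (x n)). unfold Phi. field. auto. }
    replace (G l - w)%C with ((G l - G (x n) - D * (l - x n)) + D * (l - x n) + (G (x n) - w))%C by ring.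
    eapply Rle_trans; [apply Cmod_triangle|].
    eapply Rle_trans; [apply Rplus_le_compat_r; apply Cmod_triangle|].
    rewrite (Cmod_mult D).
    assert (Cmod D * Cmod (l - x n) <= Cmod D * (k * q ^ n)) by (apply Rmult_le_compat_l; [lra|apply hl]).
    assert (q * (Cmod D * Cmod (l - x n)) <= q * (Cmod D * (k * q ^ n))) by (apply Rmult_le_compat_l; [lra|assumption]).
    lra. }
  replace (G l) with (G l - w + w)%C by ring.
  rewrite (Cmod_eq_0 (G l - w)); [ring|]. generalize (Cmod_ge_0 (G l - w)). lra. }
exists l. split; [auto|split; [auto|]].
assert (h1 := hG l z0 hlr hz0). rewrite hGl in h1.
assert (h2 := Cmod_minus_ge (D * (l - z0)) (w - G z0)).
rewrite (Cmod_minus_sym (D * (l - z0))), (Cmod_mult D) in h2. lra.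
Qed.

Lemma Cmod2_lip (M : R) (z w : C) : Cmod z <= M -> Cmod w <= M ->
  Rabs (Cmod z ^ 2 - Cmod w ^ 2) <= 2 * M * Cmod (z - w).
Proof.
intros hz hw.
assert (h1 := Cmod_minus_ge z w). assert (h2 := Cmod_minus_ge w z).
rewrite (Cmod_minus_sym w z) in h2.
generalize (Cmod_ge_0 z) (Cmod_ge_0 w) (Cmod_ge_0 (z - w)). intros.
replace (Cmod z ^ 2 - Cmod w ^ 2) with ((Cmod z - Cmod w) * (Cmod z + Cmod w)) by ring.
rewrite Rabs_mult, (Rabs_pos_eq (Cmod z + Cmod w)) by lra.
assert (Rabs (Cmod z - Cmod w) <= Cmod (z - w)) by (apply Rabs_le; lra).
generalize (Rabs_pos (Cmod z - Cmod w)). nra.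
Qed.

Lemma C11_Cmod2_LipC (a b c d : R) (G G' : C -> C) : C11 (in_rect a b c d) G G' ->
  exists L, 0 <= L /\ LipC L a b c d (fun z => Cmod (G' z) ^ 2).
Proof.
intros h. destruct (C11_deriv_lip _ _ _ h) as [L [hL h1]].
destruct h as [M [hM [h2 _]]].
exists (2 * M * L). split; [nra|].
intros z w hz hw. eapply Rle_trans; [apply (Cmod2_lip M); [apply h2|apply h2]; auto|].
rewrite (Rmult_assoc (2 * M)). apply Rmult_le_compat_l; [lra|auto].
Qed.

Section Area.

Variables (G G' : C -> C) (a b c d a' b' c' d' A B : R).
Hypothesis hG : C11 (in_rect a b c d) G G'.
Hypothesis hinj : forall z w, in_rect a b c d z -> in_rect a b c d w -> G z = G w -> z = w.
Hypothesis hell : forall z, in_rect a b c d z -> in_ellipse A B (G z).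
Hypotheses (ha : a < a') (hab : a' < b') (hb : b' < b).
Hypotheses (hc : c < c') (hcd : c' < d') (hd : d' < d).
Hypotheses (hA : 0 < A) (hB : 0 < B).

Lemma in_ellipse_box (w : C) : in_ellipse A B w -> Rabs (Re w) <= A /\ Rabs (Im w) <= B.
Proof.
intros h. unfold in_ellipse in h.
assert (k : forall x l, 0 < l -> (x / l) ^ 2 <= 1 -> Rabs x <= l).
{ intros x l hl hx. replace x with (l * (x / l)) by (field; lra).
  rewrite Rabs_mult, (Rabs_pos_eq l) by lra.
  rewrite <- pow2_abs in hx. generalize (Rabs_pos (x / l)). nra. }
generalize (pow2_ge_0 (Re w / A)) (pow2_ge_0 (Im w / B)). split; apply k; lra.
Qed.

(** One radius [r] serves all points with [|G'| >= eta]: on a disk of radius [r] the relative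
    variation of the derivative is at most [q], and the margin between the two rectangles keeps the
    disk in the domain. *)
Lemma newton_on_rect (q eta : R) : 0 < q < 1 -> 0 < eta ->
  exists r, 0 < r /\ forall z0 w, in_rect a' b' c' d' z0 -> eta <= Cmod (G' z0) ->
    Cmod (w - G z0) <= (1 - q) * r * Cmod (G' z0) ->
    exists x, in_rect a b c d x /\ G x = w /\
      (1 - q) * Cmod (G' z0) * Cmod (x - z0) <= Cmod (w - G z0).
Proof.
intros hq heta.
destruct (C11_deriv_lip _ _ _ hG) as [L [hL hL']].
destruct hG as [M [hM [_ hM']]].
set (r0 := Rmin (Rmin (a' - a) (b - b')) (Rmin (c' - c) (d - d'))).
(* [2 * M] pays for the quadratic error over a distance [2 r], [L] for the variation of [G'] over a
   distance [r], and 1 keeps the denominator positive. *)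
set (r := Rmin r0 (q * eta / (2 * M + L + 1))).
assert (hr0 : 0 < r0) by (unfold r0; repeat apply Rmin_pos; lra).
assert (hr : 0 < r).
{ apply Rmin_pos; auto. apply Rdiv_lt_0_compat; nra. }
exists r. split; auto. intros z0 w hz0 hD hw.
assert (hin : forall x, Cmod (x - z0) <= r -> in_rect a b c d x).
{ intros x hx. destruct hz0 as [z1 z2].
  assert (r <= r0) by apply Rmin_l.
  assert (r0 <= Rmin (a' - a) (b - b')) by apply Rmin_l.
  assert (r0 <= Rmin (c' - c) (d - d')) by apply Rmin_r.
  generalize (Rmin_l (a' - a) (b - b')) (Rmin_r (a' - a) (b - b'))
    (Rmin_l (c' - c) (d - d')) (Rmin_r (c' - c) (d - d')).
  generalize (re_le_Cmod (x - z0)) (im_le_Cmod (x - z0)).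
  destruct x as [x1 x2]. destruct z0 as [y1 y2]. simpl in *. intros.
  assert (k1 : Rabs (x1 - y1) <= r) by (unfold Rminus; lra).
  assert (k2 : Rabs (x2 - y2) <= r) by (unfold Rminus; lra).
  apply Rabs_le_between' in k1. apply Rabs_le_between' in k2.
  split; simpl; lra. }
assert (hr' : r * (2 * M + L + 1) <= q * eta).
{ apply Rle_trans with (q * eta / (2 * M + L + 1) * (2 * M + L + 1)).
  - apply Rmult_le_compat_r; [lra|apply Rmin_r].
  - right. field. lra. }
destruct (newton_surjective G z0 (G' z0) w q r) as [x [h1 [h2 h3]]]; auto; try lra.
- apply Cmod_ge_neq_0 with eta; auto.
- intros x y hx hy.
  destruct (hM' x y) as [_ k]; auto.
  assert (k2 := hL' y z0 (hin y hy) (hin z0 ltac:(replace (z0 - z0)%C with (RtoC 0) by ring; rewrite Cmod_0; lra))).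
  replace (G x - G y - G' z0 * (x - y))%C
    with ((G x - G y - G' y * (x - y)) + (G' y - G' z0) * (x - y))%C by ring.
  eapply Rle_trans; [apply Cmod_triangle|]. rewrite (Cmod_mult (G' y - G' z0)).
  assert (Cmod (x - y) <= 2 * r).
  { replace (x - y)%C with ((x - z0) - (y - z0))%C by ring.
    eapply Rle_trans; [apply Cmod_minus_le|]. lra. }
  assert (p := Cmod_ge_0 (x - y)). assert (p' := Cmod_ge_0 (y - z0)).
  assert (L * Cmod (y - z0) <= L * r) by nra.
  assert (M * Cmod (x - y) <= M * (2 * r)) by nra.
  assert (M * Cmod (x - y) + Cmod (G' y - G' z0) <= q * Cmod (G' z0)) by nra.
  nra.
- exists x. auto.
Qed.

(** The bump around [G (z i j)] has radius [l = (1 - q) r |G'|], hence integral [bump_mass * l^2],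
    so the integral of the sum [N] of all bumps is a Riemann sum of [|G'|^2] up to a constant. At
    [w = G x] the last clause of [newton_on_rect] bounds each bump by the bump of fixed radius [r]
    around [x], evaluated at [z i j]. Thus [N w] is at most a sum of one bump over the source grid,
    about [r^2 bump_mass / (s t)]. Integrating this bound over the ellipse, the factor
    [r^2 bump_mass] cancels and only [(1 - q)^2] is lost. *)
Lemma area_aux (q eta : R) : 0 < q < 1 -> 0 < eta ->
  DInt (fun z => Cmod (G' z) ^ 2) a' b' c' d'
  <= PI * A * B / (1 - q) ^ 2 + eta ^ 2 * ((b' - a') * (d' - c')).
Proof.
intros hq heta.
destruct (newton_on_rect q eta hq heta) as [r [hr hN]].
assert (hG2 : C11 (in_rect a' b' c' d') G G').
{ apply C11_sub with (in_rect a b c d); auto. unfold in_rect. intros z hz. lra. }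
destruct (C11_Cmod2_LipC _ _ _ _ _ _ hG2) as [L [hL hLip]].
assert (hmass := bump_mass_pos).
assert (hir := Rinv_0_lt_compat r hr).
set (ar := (b' - a') * (d' - c')).
assert (har : 0 < ar) by (apply Rmult_lt_0_compat; lra).
assert (hPI : 0 < PI * A * B) by (generalize PI_RGT_0; intros; apply Rmult_lt_0_compat; [apply Rmult_lt_0_compat|]; auto).
set (len := (b' - a') + (d' - c')).
(* The two terms are the errors of the Riemann sums of [|G'|^2] and of the source bump, both
   proportional to [s + t]. *)
apply le_of_harmonic with (L * ar * len + PI * A * B * (/ r * ar * len) / (bump_mass * ((1 - q) * r) ^ 2)).
intros n.
assert (hn : 0 < INR (S n)) by (apply lt_0_INR; lia).
set (s := (b' - a') / INR (S n)). set (t := (d' - c') / INR (S n)).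
assert (hs : 0 < s) by (apply Rdiv_lt_0_compat; lra).
assert (ht : 0 < t) by (apply Rdiv_lt_0_compat; lra).
assert (hst : s + t = len / INR (S n)) by (unfold s, t, len; field; lra).
set (z := fun i j : nat => ((a' + INR i * s)%R, (c' + INR j * t)%R) : C).
assert (hz : forall i j, (i <= n)%nat -> (j <= n)%nat -> in_rect a' b' c' d' (z i j)).
{ intros i j hi hj. unfold in_rect, z; simpl.
  assert (INR i <= INR (S n)) by (apply le_INR; lia). assert (INR j <= INR (S n)) by (apply le_INR; lia).
  assert (0 <= INR i) by apply pos_INR. assert (0 <= INR j) by apply pos_INR.
  assert (INR (S n) * s = b' - a') by (unfold s; field; lra).
  assert (INR (S n) * t = d' - c') by (unfold t; field; lra).
  assert (0 <= INR i * s <= INR (S n) * s) by (split; [apply Rmult_le_pos|apply Rmult_le_compat_r]; lra).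
  assert (0 <= INR j * t <= INR (S n) * t) by (split; [apply Rmult_le_pos|apply Rmult_le_compat_r]; lra).
  lra. }
set (l := fun i j => (1 - q) * r * Cmod (G' (z i j))).
(* Grid points where the derivative is small are discarded; they contribute at most eta^2 times the area. *)
set (T := fun i j w => if Rlt_dec (Cmod (G' (z i j))) eta then 0 else bump (G (z i j)) (l i j) w).
assert (hl : forall i j, ~ Cmod (G' (z i j)) < eta -> 0 < l i j).
{ intros i j h. unfold l. repeat apply Rmult_lt_0_compat; lra. }
assert (hTL : forall i j, exists K, 0 <= K /\ LipC K (-A) A (-B) B (T i j)).
{ intros i j. unfold T. destruct (Rlt_dec _ _) as [h|h].
  - exists 0. split; [lra|]. intros x y _ _. rewrite Rminus_diag, Rabs_R0. lra.
  - exists (/ l i j). split; [left; apply Rinv_0_lt_compat; auto|]. apply bump_LipC. auto. }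
assert (hTL2 : forall i, exists K, 0 <= K /\ LipC K (-A) A (-B) B (fun w => sum_f_R0 (fun j => T i j w) n)).
{ intros i. apply LipC_sum. auto. }
set (N := fun w => sum_f_R0 (fun i => sum_f_R0 (fun j => T i j w) n) n).
destruct (LipC_sum (-A) A (-B) B (fun i w => sum_f_R0 (fun j => T i j w) n) n hTL2) as [K [hK hKL]].
assert (hT0 : forall i j w, (i <= n)%nat -> (j <= n)%nat ->
  T i j w = 0 \/ exists x, in_rect a b c d x /\ G x = w /\ T i j w <= bump x r (z i j)).
{ intros i j w hi hj. unfold T. destruct (Rlt_dec _ _) as [h|h]; [now left|].
  destruct (Rle_dec (Cmod (w - G (z i j))) (l i j)) as [h1|h1].
  - right. destruct (hN (z i j) w) as [x [x1 [x2 x3]]]; auto; [lra|].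
    exists x. split; [auto|split; [auto|]]. unfold bump.
    apply Rle_max_compat_l.
    assert (Cmod (x - z i j) / r <= Cmod (w - G (z i j)) / l i j); [|rewrite (Cmod_minus_sym (z i j)); lra].
    apply Rmult_le_reg_r with (l i j); [auto|]. unfold Rdiv.
    rewrite (Rmult_assoc (Cmod (w - G (z i j)))), Rinv_l by (generalize (hl i j h); lra).
    eapply Rle_trans; [|rewrite Rmult_1_r; exact x3]. right. unfold l. field. lra.
  - left. apply bump_out; auto. lra. }
assert (hbump : forall x, sum_f_R0 (fun i => sum_f_R0 (fun j => bump x r (z i j)) n) n
  <= (r ^ 2 * bump_mass + / r * ar * (s + t)) / (s * t)).
{ intros x.
  assert (k := riemann_sum_2d a' b' c' d' (Rlt_le _ _ hab) (Rlt_le _ _ hcd) (/ r) (bump x r) n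
     (Rlt_le _ _ hir) (bump_LipC x r a' b' c' d' hr)).
  cbv zeta in k. fold s t in k. fold (z) in k.
  assert (k2 := DInt_bump_le x r a' b' c' d' hr (Rlt_le _ _ hab) (Rlt_le _ _ hcd)).
  apply Rmult_le_reg_r with (s * t); [now apply Rmult_lt_0_compat|].
  replace ((r ^ 2 * bump_mass + / r * ar * (s + t)) / (s * t) * (s * t))
    with (r ^ 2 * bump_mass + / r * ar * (s + t)) by (field; lra).
  apply Rabs_le_between' in k. unfold z. unfold ar. lra. }
set (kk := (r ^ 2 * bump_mass + / r * ar * (s + t)) / (s * t)) in *.
assert (hkk : 0 <= kk).
{ apply Rle_trans with (2 := hbump (RtoC 0)). apply cond_pos_sum. intros i.
  apply cond_pos_sum. intros j. apply bump_ge_0. }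
assert (hN0 : forall w, (exists x, in_rect a b c d x /\ G x = w) \/ N w = 0).
{ intros w. destruct (Classical_Prop.classic (exists x, in_rect a b c d x /\ G x = w)) as [h|h]; [now left|right].
  unfold N. rewrite (sum_eq _ (fun _ => 0)); [now rewrite sum_cte; ring|]. intros i hi.
  rewrite (sum_eq _ (fun _ => 0)); [now rewrite sum_cte; ring|]. intros j hj.
  destruct (hT0 i j w hi hj) as [e|[x [h1 [h2 _]]]]; auto. exfalso. apply h. now exists x. }
assert (hup : DInt N (-A) A (-B) B <= kk * (PI * A * B)).
{ apply DInt_ellipse_le with K; auto.
  - intros w. destruct (hN0 w) as [[x [h1 h2]]|e]; [|lra].
    apply Rle_trans with (2 := hbump x). unfold N.
    apply sum_Rle. intros i hi. apply sum_Rle. intros j hj.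
    destruct (hT0 i j w hi hj) as [e|[y [k1 [k2 k3]]]].
    + rewrite e. apply bump_ge_0.
    (* Injectivity enters here: the preimages found from different grid points are all equal to
       [x]. *)
    + replace x with y; auto. apply hinj; auto. congruence.
  - intros w hw. destruct (hN0 w) as [[x [h1 h2]]|e]; [|lra].
    exfalso. apply hw. rewrite <- h2. auto. }
set (chi := fun i j => if Rlt_dec (Cmod (G' (z i j))) eta then 0 else Cmod (G' (z i j)) ^ 2).
assert (hint : DInt N (-A) A (-B) B = (bump_mass * ((1 - q) * r) ^ 2) *
   sum_f_R0 (fun i => sum_f_R0 (fun j => chi i j) n) n).
{ unfold N.
  rewrite (DInt_sum (-A) A (-B) B ltac:(lra) ltac:(lra) (fun i w => sum_f_R0 (fun j => T i j w) n) n hTL2).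
  rewrite scal_sum. apply sum_eq. intros i hi.
  rewrite (DInt_sum (-A) A (-B) B ltac:(lra) ltac:(lra) (fun j w => T i j w) n (hTL i)).
  rewrite Rmult_comm, scal_sum. apply sum_eq. intros j hj. unfold T, chi.
  destruct (Rlt_dec _ _) as [h|h].
  - unfold DInt. rewrite (RInt_ext _ (fun _ => 0)).
    + rewrite RInt_const_R, !Rmult_0_l, Rmult_0_r. reflexivity.
    + intros u _. rewrite RInt_const_R. apply Rmult_0_r.
  (* The circle of radius [l i j] around [G (z i j)] lies in the image, hence in the ellipse; its
     four extreme points put the support of the bump inside the box. *)
  - assert (hbox : forall w, Cmod (w - G (z i j)) = l i j -> Rabs (Re w) <= A /\ Rabs (Im w) <= B).
    { intros w hw. apply in_ellipse_box. destruct (hN (z i j) w) as [x [x1 [x2 x3]]]; auto; [lra|right; auto|].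
      rewrite <- x2. auto. }
    assert (hlij := hl i j h).
    destruct (hbox (G (z i j) + RtoC (l i j))%C) as [b1 _].
    { replace (G (z i j) + RtoC (l i j) - G (z i j))%C with (RtoC (l i j)) by ring. rewrite Cmod_R, Rabs_pos_eq; lra. }
    destruct (hbox (G (z i j) - RtoC (l i j))%C) as [b2 _].
    { replace (G (z i j) - RtoC (l i j) - G (z i j))%C with (- RtoC (l i j))%C by ring. rewrite Cmod_opp, Cmod_R, Rabs_pos_eq; lra. }
    destruct (hbox (G (z i j) + Ci * RtoC (l i j))%C) as [_ b3].
    { replace (G (z i j) + Ci * RtoC (l i j) - G (z i j))%C with (Ci * RtoC (l i j))%C by ring.
      rewrite Cmod_mult, Cmod_Ci, Cmod_R, Rabs_pos_eq; lra. }
    destruct (hbox (G (z i j) - Ci * RtoC (l i j))%C) as [_ b4].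
    { replace (G (z i j) - Ci * RtoC (l i j) - G (z i j))%C with (- (Ci * RtoC (l i j)))%C by ring.
      rewrite Cmod_opp, Cmod_mult, Cmod_Ci, Cmod_R, Rabs_pos_eq; lra. }
    rewrite (DInt_bump_eq (G (z i j)) (l i j)); auto.
    + unfold l. ring.
    + clear - b2. destruct (G (z i j)) as [x y]. simpl in *. apply Rabs_le_between in b2. lra.
    + clear - b1. destruct (G (z i j)) as [x y]. simpl in *. apply Rabs_le_between in b1. lra.
    + clear - b4. destruct (G (z i j)) as [x y]. simpl in *. apply Rabs_le_between in b4. lra.
    + clear - b3. destruct (G (z i j)) as [x y]. simpl in *. apply Rabs_le_between in b3. lra. }
assert (hrs := riemann_sum_2d a' b' c' d' (Rlt_le _ _ hab) (Rlt_le _ _ hcd) L _ n hL hLip).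
cbv zeta in hrs. fold s t in hrs.
set (S1 := sum_f_R0 (fun i => sum_f_R0 (fun j => Cmod (G' ((a' + INR i * s)%R, (c' + INR j * t)%R)) ^ 2) n) n) in *.
set (S2 := sum_f_R0 (fun i => sum_f_R0 (fun j => chi i j) n) n) in *.
assert (h12 : S1 <= S2 + INR (S n) * (INR (S n) * eta ^ 2)).
{ assert (Rabs (S1 - S2) <= INR (S n) * (INR (S n) * eta ^ 2)).
  { apply sum_f_R0_abs_diff. intros i hi. apply sum_f_R0_abs_diff. intros j hj.
    unfold chi. fold (z i j). destruct (Rlt_dec _ _) as [h|h].
    - rewrite Rminus_0_r, Rabs_pos_eq by apply pow2_ge_0. apply pow_incr.
      split; [apply Cmod_ge_0|lra].
    - rewrite Rminus_diag, Rabs_R0. apply pow2_ge_0. }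
  generalize (Rle_abs (S1 - S2)). lra. }
apply Rabs_le_between' in hrs.
assert (hst0 : 0 < s * t) by now apply Rmult_lt_0_compat.
set (m := bump_mass * ((1 - q) * r) ^ 2) in *.
assert (hm : 0 < m).
{ apply Rmult_lt_0_compat; auto. apply pow_lt. apply Rmult_lt_0_compat; lra. }
assert (h2 : s * t * S2 <= (r ^ 2 * bump_mass + / r * ar * (s + t)) * (PI * A * B) / m).
{ apply Rmult_le_reg_r with m; auto.
  replace ((r ^ 2 * bump_mass + / r * ar * (s + t)) * (PI * A * B) / m * m)
    with (s * t * (kk * (PI * A * B))) by (unfold kk; field; lra).
  rewrite Rmult_assoc. apply Rmult_le_compat_l; [lra|]. lra. }
assert (h3 : s * t * S1 <= s * t * S2 + eta ^ 2 * ar).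
{ apply Rle_trans with (s * t * (S2 + INR (S n) * (INR (S n) * eta ^ 2))).
  - apply Rmult_le_compat_l; lra.
  - right. unfold ar, s, t. field. lra. }
replace (PI * A * B / (1 - q) ^ 2) with (r ^ 2 * bump_mass * (PI * A * B) / m)
  by (unfold m; field; lra).
replace ((L * ar * len + PI * A * B * (/ r * ar * len) / m) / INR (S n))
  with (L * ar * (s + t) + PI * A * B * (/ r * ar * (s + t)) / m) by (rewrite hst; field; lra).
replace ((r ^ 2 * bump_mass + / r * ar * (s + t)) * (PI * A * B) / m)
  with (r ^ 2 * bump_mass * (PI * A * B) / m + PI * A * B * (/ r * ar * (s + t)) / m) in h2 by (field; lra).
unfold ar in *. lra.
Qed.

(** In [area_aux] both [q] and [eta] are set to [e = 1 / (n + 2)], which is below 1 for every [n],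
    and [1 - (1 - e)^2 <= 2 e] gives the rate. *)
Lemma injective_area_le : DInt (fun z => Cmod (G' z) ^ 2) a' b' c' d' <= PI * A * B.
Proof.
set (X := DInt (fun z => Cmod (G' z) ^ 2) a' b' c' d').
set (ar := (b' - a') * (d' - c')).
assert (har : 0 < ar) by (apply Rmult_lt_0_compat; lra).
apply le_of_harmonic with (2 * Rabs X + ar). intros n.
assert (hn : 0 < INR (S (S n))) by (apply lt_0_INR; lia).
set (e := / INR (S (S n))).
assert (he : 0 < e) by now apply Rinv_0_lt_compat.
assert (hn1 : INR (S (S n)) = INR (S n) + 1) by apply S_INR.
assert (hn0 : 0 < INR (S n)) by (apply lt_0_INR; lia).
assert (he' : e < / INR (S n)) by (apply Rinv_lt_contravar; [nra|lra]).
assert (he1 : e < 1).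
{ unfold e. rewrite <- Rinv_1. apply Rinv_lt_contravar; lra. }
assert (h := area_aux e e ltac:(lra) he). fold X ar in h.
assert (h1 : X * (1 - e) ^ 2 <= PI * A * B + e ^ 2 * ar).
{ assert (hq : 0 < (1 - e) ^ 2) by (apply pow_lt; lra).
  apply Rle_trans with ((PI * A * B / (1 - e) ^ 2 + e ^ 2 * ar) * (1 - e) ^ 2).
  - apply Rmult_le_compat_r; lra.
  - replace ((PI * A * B / (1 - e) ^ 2 + e ^ 2 * ar) * (1 - e) ^ 2)
      with (PI * A * B + e ^ 2 * ar * (1 - e) ^ 2) by (field; lra).
    assert (0 <= e ^ 2 * ar) by nra. assert ((1 - e) ^ 2 <= 1) by nra. nra. }
unfold Rdiv.
assert (X * (1 - (1 - e) ^ 2) <= Rabs X * (2 * e)).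
{ generalize (Rle_abs X) (Rabs_pos X). intros.
  assert (ht : 0 <= 1 - (1 - e) ^ 2 <= 2 * e) by nra.
  apply Rle_trans with (Rabs X * (1 - (1 - e) ^ 2)).
  - apply Rmult_le_compat_r; lra.
  - apply Rmult_le_compat_l; lra. }
assert (e ^ 2 * ar <= e * ar) by (apply Rmult_le_compat_r; [lra|nra]).
assert ((2 * Rabs X + ar) * e <= (2 * Rabs X + ar) * / INR (S n)).
{ apply Rmult_le_compat_l; [generalize (Rabs_pos X); lra|lra]. }
lra.
Qed.

End Area.

(** * Parseval's identity on vertical segments *)

Lemma is_derive_quadratic (f : R -> R) (x l M r : R) : 0 < r ->
  (forall y, Rabs (y - x) < r -> Rabs (f y - f x - l * (y - x)) <= M * (y - x) ^ 2) ->
  is_derive f x l.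
Proof.
intros hr h. apply is_derive_Reals. intros eps heps.
assert (hM : 0 < Rabs M + 1) by (generalize (Rabs_pos M); lra).
assert (hd : 0 < Rmin r (eps / (Rabs M + 1))).
{ apply Rmin_pos; auto. now apply Rdiv_lt_0_compat. }
exists (mkposreal _ hd). intros t ht htd. simpl in htd.
assert (h1 : Rabs t < r) by (eapply Rlt_le_trans; [exact htd|apply Rmin_l]).
assert (h2 : Rabs t < eps / (Rabs M + 1)) by (eapply Rlt_le_trans; [exact htd|apply Rmin_r]).
assert (h0 := h (x + t)). replace (x + t - x) with t in h0 by ring.
specialize (h0 h1).
replace ((f (x + t) - f x) / t - l) with ((f (x + t) - f x - l * t) / t) by (field; auto).
assert (pt : 0 < Rabs t) by now apply Rabs_pos_lt.
rewrite Rabs_div by auto. apply Rmult_lt_reg_r with (Rabs t); auto.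
unfold Rdiv. rewrite Rmult_assoc, Rinv_l, Rmult_1_r by lra.
apply Rle_lt_trans with (1 := h0). rewrite <- pow2_abs.
apply Rle_lt_trans with ((Rabs M + 1) * Rabs t * Rabs t).
- assert (0 <= Rabs t ^ 2) by apply pow2_ge_0. generalize (Rle_abs M). nra.
- apply Rmult_lt_compat_r; auto.
  apply Rmult_lt_reg_r with (/ (Rabs M + 1)); [now apply Rinv_0_lt_compat|].
  replace ((Rabs M + 1) * Rabs t * / (Rabs M + 1)) with (Rabs t) by (field; lra). exact h2.
Qed.

(** Puts [[0, 2 pi]] into the interior of [[-1, 8]], the vertical range of the strips below, so that
    derivatives at both ends of the period are two-sided. The sum [1 - 1/3 + 1/5] of Leibniz's
    series is sharp enough. *)
Lemma two_PI_lt_7 : 2 * PI < 7.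
Proof.
assert (k := PI_ineq 1). unfold tg_alt, PI_tg in k. simpl in k. lra.
Qed.

Lemma Re_vertical_lip (x0 x1 x : R) (f : C -> C) (M : R) : x0 <= x <= x1 ->
  (forall z w, in_rect x0 x1 (-1) 8 z -> in_rect x0 x1 (-1) 8 w -> Cmod (f z - f w) <= M * Cmod (z - w)) ->
  Lip M (-1) 8 (fun y => Re (f (x, y))).
Proof.
intros hx h y y' hy hy'.
change (Rabs (Re (f (x, y) - f (x, y'))%C) <= M * Rabs (y - y')).
eapply Rle_trans; [apply re_le_Cmod|].
rewrite <- (Cmod_vertical x). apply h; split; simpl; lra.
Qed.

Lemma Lip_ex_RInt_circle (M : R) (f : R -> R) : 0 <= M -> Lip M (-1) 8 f -> ex_RInt f 0 (2 * PI).
Proof.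
intros hM h. generalize two_PI_lt_7 PI_RGT_0. intros.
apply (lip_ex_RInt M); auto; [lra|]. intros y y' hy hy'. apply h; lra.
Qed.

(** Along a vertical line [f] has derivative [i f'], so [Im f] is an antiderivative of [Re f'], and
    its increment over a period vanishes. *)
Lemma RInt_vertical_derivative (x0 x1 x : R) (f f' : C -> C) : x0 <= x <= x1 ->
  C11 (in_rect x0 x1 (-1) 8) f f' -> f (x, 2 * PI) = f (x, 0) ->
  is_RInt (fun y => Re (f' (x, y))) 0 (2 * PI) 0.
Proof.
intros hx h hper.
assert (hpi := two_PI_lt_7). assert (hpi' := PI_RGT_0).
replace 0 with (minus (Im (f (x, 2 * PI))) (Im (f (x, 0)))) at 2
  by (rewrite hper; apply (minus_eq_zero (G := R_AbelianGroup))).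
assert (hl := C11_deriv_lip _ _ _ h). destruct hl as [L [hL hl]].
destruct h as [M [hM [_ h]]].
apply (is_RInt_derive (V := R_CompleteNormedModule) (fun y => Im (f (x, y)))).
- intros y hy. rewrite Rmin_left, Rmax_right in hy by lra.
  apply is_derive_quadratic with M (1/2); [lra|]. intros t ht.
  apply Rabs_lt_between in ht.
  destruct (h (x, t) (x, y)) as [_ k]; [split; simpl; lra|split; simpl; lra|].
  rewrite Cmod_vertical, pow2_abs in k. eapply Rle_trans; [|exact k].
  eapply Rle_trans; [|apply im_le_Cmod]. right. f_equal.
  destruct (f (x, t)), (f (x, y)), (f' (x, y)). simpl. ring.
- intros y hy. rewrite Rmin_left, Rmax_right in hy by lra.
  assert (hLip := Re_vertical_lip x0 x1 x f' L hx hl).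
  apply (lip_continuous L (1/2)); [lra|]. intros t ht. apply Rabs_lt_between in ht. apply hLip; lra.
Qed.

(** Over [n + 1] equal steps the total increment is at most [M (b - a)^2 / (n + 1)]. Applied to
    vertical means, this takes the place of differentiation under the integral sign. *)
Lemma quadratic_constant (psi : R -> R) (a b M : R) : a <= b ->
  (forall x y, a <= x <= b -> a <= y <= b -> Rabs (psi x - psi y) <= M * (x - y) ^ 2) ->
  psi a = psi b.
Proof.
intros hab h.
assert (k : Rabs (psi b - psi a) <= 0).
{ apply le_of_harmonic with (M * (b - a) ^ 2). intros n.
  assert (hn : 0 < INR (S n)) by (apply lt_0_INR; lia).
  set (s := (b - a) / INR (S n)).
  assert (hs : 0 <= s) by (apply Rdiv_le_0_compat; lra).
  assert (hbs : a + INR (S n) * s = b) by (unfold s; field; lra).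
  assert (hk : forall m, (m <= S n)%nat -> Rabs (psi (a + INR m * s) - psi a) <= INR m * (M * s ^ 2)).
  { induction m as [|m IH]; intros hm.
    - simpl. rewrite Rmult_0_l, Rplus_0_r, Rminus_diag, Rabs_R0. lra.
    - assert (h0 := pos_INR m). assert (h1 := S_INR m).
      assert (h2 : INR (S m) <= INR (S n)) by (apply le_INR; lia).
      assert (h3 : INR (S m) * s <= INR (S n) * s) by (apply Rmult_le_compat_r; auto).
      assert (h4 : 0 <= INR m * s) by (apply Rmult_le_pos; auto).
      replace (psi (a + INR (S m) * s) - psi a)
        with ((psi (a + INR (S m) * s) - psi (a + INR m * s)) + (psi (a + INR m * s) - psi a)) by ring.
      eapply Rle_trans; [apply Rabs_triang|].
      assert (k1 := h (a + INR (S m) * s) (a + INR m * s)).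
      replace (a + INR (S m) * s - (a + INR m * s)) with s in k1 by (rewrite h1; ring).
      rewrite h1 in *. specialize (IH ltac:(lia)).
      assert (Rabs (psi (a + (INR m + 1) * s) - psi (a + INR m * s)) <= M * s ^ 2) by (apply k1; lra).
      lra. }
  specialize (hk (S n) (le_n _)). rewrite hbs in hk.
  rewrite Rplus_0_l. eapply Rle_trans; [exact hk|]. right. unfold s. field. lra. }
generalize (Rabs_pos (psi b - psi a)). intros.
assert (e : Rabs (psi b - psi a) = 0) by lra.
destruct (Req_dec (psi b - psi a) 0) as [e0|e0]; [lra|]. now apply Rabs_no_R0 in e0.
Qed.

(* [f] is holomorphic on the half strip [Re z <= x1], [2 pi i]-periodic, and [O(exp(s Re z))] at [-infinity]; that is, [f] is a function of [exp z] with a zero of order at least [s] at the origin. *)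
Definition decaying (x1 s : R) (f f' : C -> C) : Prop :=
  (forall x0, C11 (in_rect x0 x1 (-1) 8) f f') /\
  (forall x, x <= x1 -> f (x, 2 * PI) = f (x, 0)) /\
  (exists K, forall x y, x <= x1 -> Cmod (f (x, y)) <= K * exp (s * x)).

(** Cauchy's theorem on the half strip: the mean over a period does not depend on the abscissa,
    because its first order variation is the integral of [Re f'], which vanishes by periodicity. The
    decay at [-infinity] then forces the value 0. *)
Lemma decaying_mean_zero (x1 s x : R) (f f' : C -> C) :
  0 < s -> x <= x1 -> decaying x1 s f f' ->
  is_RInt (fun y => Re (f (x, y))) 0 (2 * PI) 0.
Proof.
intros hs hx [hf [hper [K hK]]].
assert (hpi := two_PI_lt_7). assert (hpi' := PI_RGT_0).
set (psi := fun x => RInt (fun y => Re (f (x, y))) 0 (2 * PI)).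
assert (hex : forall x, x <= x1 -> ex_RInt (fun y => Re (f (x, y))) 0 (2 * PI)).
{ intros t ht. destruct (hf t) as [M [hM [_ h]]]. apply (Lip_ex_RInt_circle M); auto.
  apply (Re_vertical_lip t x1); [lra|]. intros z w hz hw. apply h; auto. }
assert (hconst : forall x0, x0 <= x -> psi x0 = psi x).
{ intros x0 hx0.
  destruct (C11_deriv_lip _ _ _ (hf x0)) as [L [hL hl]].
  assert (hfx := hf x0).
  destruct (hf x0) as [M [hM [_ h]]].
  apply quadratic_constant with (M * (2 * PI)); auto.
  intros u v hu hv.
  assert (hd := RInt_vertical_derivative x0 x1 v f f' ltac:(lra) hfx (hper v ltac:(lra))).
  assert (hs' : is_RInt (fun y => scal (u - v) (Re (f' (v, y)))) 0 (2 * PI) (scal (u - v) 0))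
    by (apply (is_RInt_scal (V := R_NormedModule)); exact hd).
  assert (hv' := RInt_correct _ _ _ (hex v ltac:(lra))).
  assert (hsum := is_RInt_plus (V := R_NormedModule) _ _ _ _ _ _ hv' hs').
  replace (psi v) with (RInt (fun y => plus (Re (f (v, y))) (scal (u - v) (Re (f' (v, y))))) 0 (2 * PI)).
  - eapply Rle_trans; [apply RInt_abs_diff with (e := M * (u - v) ^ 2)|].
    + lra.
    + apply hex. lra.
    + exists (plus (RInt (fun y => Re (f (v, y))) 0 (2 * PI)) (scal (u - v) 0)). exact hsum.
    + intros y hy.
      destruct (h (u, y) (v, y)) as [_ k]; [split; simpl; lra|split; simpl; lra|].
      rewrite Cmod_horizontal, pow2_abs in k. eapply Rle_trans; [|exact k].
      eapply Rle_trans; [|apply re_le_Cmod]. right. f_equal.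
      unfold plus, scal; simpl; unfold mult; simpl.
      destruct (f (u, y)), (f (v, y)), (f' (v, y)). simpl. ring.
    + lra.
  - etransitivity; [apply (is_RInt_unique (V := R_CompleteNormedModule) _ _ _ _ hsum)|]. unfold plus, scal; simpl; unfold mult; simpl.
    unfold psi. ring. }
assert (hbd : forall x0, x0 <= x1 -> Rabs (psi x0) <= 2 * PI * (Rabs K * exp (s * x0))).
{ intros x0 hx0.
  assert (k : Rabs (psi x0 - RInt (fun _ => 0) 0 (2 * PI)) <= (2 * PI - 0) * (Rabs K * exp (s * x0))).
  { apply RInt_abs_diff; [lra|now apply hex|apply ex_RInt_const|].
    intros y _. rewrite Rminus_0_r. eapply Rle_trans; [apply re_le_Cmod|].
    eapply Rle_trans; [apply hK; auto|].
    apply Rmult_le_compat_r; [left; apply exp_pos|apply Rle_abs]. }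
  rewrite RInt_const_R, Rmult_0_r, !Rminus_0_r in k. exact k. }
assert (hz : Rabs (psi x) <= 0).
{ apply le_of_harmonic with (2 * PI * (Rabs K * exp (s * x))). intros n.
  assert (hn : 0 < INR (S n)) by (apply lt_0_INR; lia).
  set (m := INR (S n)) in *.
  (* At this abscissa the bound carries the factor [exp (- m)], which is at most [1 / m]. *)
  rewrite <- (hconst (x - m / s)).
  - eapply Rle_trans; [apply hbd|].
    + assert (0 < m / s) by (now apply Rdiv_lt_0_compat). lra.
    + replace (s * (x - m / s)) with (s * x + - m) by (field; lra).
      rewrite exp_plus, exp_Ropp, Rplus_0_l.
      assert (he : / exp m <= / m).
      { apply Rinv_le_contravar; auto. generalize (exp_ineq1_le m). lra. }
      assert (0 <= 2 * PI * (Rabs K * exp (s * x))).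
      { apply Rmult_le_pos; [lra|]. apply Rmult_le_pos; [apply Rabs_pos|left; apply exp_pos]. }
      replace (2 * PI * (Rabs K * (exp (s * x) * / exp m)))
        with (2 * PI * (Rabs K * exp (s * x)) * / exp m) by ring.
      now apply Rmult_le_compat_l.
  - assert (0 < m / s) by (now apply Rdiv_lt_0_compat). lra. }
assert (e : psi x = 0).
{ destruct (Req_dec (psi x) 0) as [e0|e0]; [auto|]. apply Rabs_no_R0 in e0.
  generalize (Rabs_pos (psi x)). lra. }
assert (hi : is_RInt (fun y => Re (f (x, y))) 0 (2 * PI) (psi x))
  by (apply (RInt_correct (V := R_CompleteNormedModule)); auto).
rewrite e in hi. exact hi.
Qed.

Lemma C11_cexp_scal (x0 x1 : R) (k : C) :
  C11 (in_rect x0 x1 (-1) 8) (fun z => cexp (k * z)) (fun z => k * cexp (k * z))%C.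
Proof.
set (B := Rabs x0 + Rabs x1 + 8).
assert (hB : forall z, in_rect x0 x1 (-1) 8 z -> Cmod z <= B).
{ intros z [h1 h2]. eapply Rle_trans; [apply Cmod_le_Re_Im|]. unfold B.
  assert (Rabs (Re z) <= Rabs x0 + Rabs x1).
  { unfold Rabs. destruct (Rcase_abs (Re z)), (Rcase_abs x0), (Rcase_abs x1); lra. }
  assert (Rabs (Im z) <= 8) by (apply Rabs_le; lra). lra. }
eapply C11_ext; [|apply (C11_comp _ (fun z => Cmod z <= Cmod k * B) (fun z => k * z)%C (fun _ => k * 1)%C cexp cexp)].
- intros z hz. simpl. split; [reflexivity|]. ring.
- intros z hz. rewrite Cmod_mult. apply Rmult_le_compat_l; auto. apply Cmod_ge_0.
- apply C11_scal. now apply C11_id with B.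
- now apply C11_cexp with (Cmod k * B).
Qed.

Lemma Cmod2_plus (z w : C) : Cmod (z + w) ^ 2 = Cmod z ^ 2 + 2 * Re (Cconj z * w)%C + Cmod w ^ 2.
Proof. rewrite !Cmod2_alt. destruct z, w. simpl. ring. Qed.

(** On a fixed vertical line conjugation turns a mode into a constant times the opposite mode, so
    cross terms in Parseval's identity are again values of holomorphic functions. *)
Lemma cexp_conj (n x y : R) :
  Cconj (cexp (RtoC n * (x, y))) = (RtoC (exp (2 * n * x)) * cexp (- RtoC n * (x, y)))%C.
Proof.
unfold cexp, Cconj. simpl.
replace (n * x - 0 * y) with (n * x) by ring. replace (n * y + 0 * x) with (n * y) by ring.
replace (- n * x - - 0 * y) with (- (n * x)) by ring.
replace (- n * y + - 0 * x) with (- (n * y)) by ring.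
rewrite cos_neg, sin_neg, exp_Ropp.
replace (2 * n * x) with (n * x + n * x) by ring. rewrite exp_plus.
generalize (exp_pos (n * x)). intros.
apply injective_projections; simpl; field; lra.
Qed.

Lemma Cmod_cexp_scal (n x y : R) : Cmod (cexp (RtoC n * (x, y))) = exp (n * x).
Proof. rewrite Cmod_cexp. f_equal. simpl. ring. Qed.

Lemma C11_Cmod2_ex_RInt (x1 x : R) (f f' : C -> C) : x <= x1 ->
  C11 (in_rect x x1 (-1) 8) f f' -> ex_RInt (fun y => Cmod (f' (x, y)) ^ 2) 0 (2 * PI).
Proof.
intros hx h. destruct (C11_Cmod2_LipC _ _ _ _ _ _ h) as [L [hL k]].
apply (Lip_ex_RInt_circle L); auto. intros y y' hy hy'.
eapply Rle_trans; [apply k; split; simpl; lra|]. rewrite Cmod_vertical. lra.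
Qed.

(** The cross term between the mode and [f'] is a constant times [exp (- n z) f'], that is
    [n g + g'] with [g = k exp (- n z) f]. The part [g] has mean zero because it decays at rate
    [s - n > 0], the part [g'] because it is the derivative of a periodic function. The hypothesis
    on [cexp] says that the real number [n] is an integer. *)
Lemma parseval_step (x1 s n x : R) (b : C) (F' f f' : C -> C) :
  cexp (- RtoC n * (0, 2 * PI)) = RtoC 1 ->
  (forall z, f' z = F' z - RtoC n * b * cexp (RtoC n * z))%C ->
  n < s -> x <= x1 -> decaying x1 s f f' ->
  RInt (fun y => Cmod (F' (x, y)) ^ 2) 0 (2 * PI)
  = 2 * PI * (n ^ 2 * Cmod b ^ 2 * exp (2 * n * x))
    + RInt (fun y => Cmod (f' (x, y)) ^ 2) 0 (2 * PI).
Proof.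
intros hn hF hns hx hdec.
rewrite (RInt_ext _ (fun y => Cmod (RtoC n * b * cexp (RtoC n * (x, y)) + f' (x, y)) ^ 2))
  by (intros y _; rewrite hF; do 2 f_equal; ring).
set (k := (Cconj (RtoC n * b) * RtoC (exp (2 * n * x)))%C).
set (e := fun z => cexp (- RtoC n * z)).
set (g := fun z => (k * (e z * f z))%C).
set (g' := fun z => (k * ((- RtoC n * e z) * f z + e z * f' z))%C).
assert (hg : decaying x1 (s - n) g g').
{ destruct hdec as [h1 [h2 [K h3]]]. split; [|split].
  - intros x0. apply C11_scal. apply C11_mult; [apply C11_cexp_scal|apply h1].
  - intros t ht. unfold g, e. rewrite h2 by auto. f_equal. f_equal.
    replace ((t, 2 * PI)) with ((t, 0%R) + (0%R, (2 * PI)%R))%C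
      by (apply injective_projections; simpl; ring).
    rewrite Cmult_plus_distr_l, cexp_plus, hn. ring.
  - exists (Cmod k * K). intros t y ht. unfold g, e. rewrite !Cmod_mult.
    replace (- RtoC n)%C with (RtoC (- n)) by (now rewrite RtoC_opp).
    rewrite Cmod_cexp_scal.
    replace (exp ((s - n) * t)) with (exp (- n * t) * exp (s * t))
      by (rewrite <- exp_plus; f_equal; ring).
    generalize (h3 t y ht). intros h.
    rewrite (Rmult_assoc (Cmod k)). apply Rmult_le_compat_l; [apply Cmod_ge_0|].
    rewrite <- Rmult_assoc, (Rmult_comm K), Rmult_assoc.
    apply Rmult_le_compat_l; [left; apply exp_pos|auto]. }
assert (hz1 := decaying_mean_zero x1 (s - n) x g g' ltac:(lra) hx hg).
assert (hz2 : is_RInt (fun y => Re (g' (x, y))) 0 (2 * PI) 0).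
{ destruct hg as [h1 [h2 _]]. apply (RInt_vertical_derivative x x1 x g); auto. lra. }
assert (hE := RInt_correct _ _ _ (C11_Cmod2_ex_RInt x1 x f f' hx (proj1 hdec x))).
set (I := RInt (fun y => Cmod (f' (x, y)) ^ 2) 0 (2 * PI)) in *.
set (q := n ^ 2 * Cmod b ^ 2 * exp (2 * n * x)).
assert (hq : is_RInt (fun _ : R => q) 0 (2 * PI) (scal (2 * PI - 0) q)) by apply (is_RInt_const (V := R_NormedModule)).
assert (hs1 := is_RInt_scal (V := R_NormedModule) _ _ _ (2 * n) _ hz1).
assert (hs2 := is_RInt_scal (V := R_NormedModule) _ _ _ 2 _ hz2).
assert (hsum := is_RInt_plus (V := R_NormedModule) _ _ _ _ _ _ hq
  (is_RInt_plus (V := R_NormedModule) _ _ _ _ _ _ hs1 (is_RInt_plus (V := R_NormedModule) _ _ _ _ _ _ hs2 hE))).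
assert (hfin := is_RInt_unique (V := R_CompleteNormedModule) _ _ _ _ hsum).
transitivity (plus (scal (2 * PI - 0) q) (plus (scal (2 * n) 0) (plus (scal 2 0) I))).
- etransitivity; [|exact hfin]. apply RInt_ext. intros y _.
  unfold plus, scal; simpl; unfold mult; simpl.
  change (Cmod (RtoC n * b * cexp (RtoC n * (x, y)) + f' (x, y)) ^ 2 =
    q + (2 * n * Re (g (x, y)) + (2 * Re (g' (x, y)) + Cmod (f' (x, y)) ^ 2))).
  rewrite Cmod2_plus.
  assert (h1 : Cmod (RtoC n * b * cexp (RtoC n * (x, y))) ^ 2 = q).
  { rewrite !Cmod_mult, Cmod_cexp_scal, Cmod_R. unfold q.
    rewrite !Rpow_mult_distr, pow2_abs.
    replace (2 * n * x) with (n * x + n * x) by ring. rewrite exp_plus. ring. }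
  rewrite h1.
  assert (h2 : (Cconj (RtoC n * b * cexp (RtoC n * (x, y))) * f' (x, y))%C
     = (RtoC n * g (x, y) + g' (x, y))%C).
  { rewrite Cmult_conj, cexp_conj. unfold g', g, k, e. ring. }
  rewrite h2.
  replace (Re (RtoC n * g (x, y) + g' (x, y))%C) with (n * Re (g (x, y)) + Re (g' (x, y)))
    by (destruct (g (x, y)), (g' (x, y)); simpl; ring).
  ring.
- unfold plus, scal; simpl; unfold mult; simpl. fold q. ring.
Qed.

Lemma cexp_nat_period (k : nat) : cexp (RtoC (INR k) * (0%R, (2 * PI)%R)) = RtoC 1.
Proof.
induction k as [|k IH].
- simpl INR. replace (0 * (0%R, (2 * PI)%R))%C with (RtoC 0) by ring. apply cexp_0.
- rewrite S_INR, RtoC_plus, Cmult_plus_distr_r, cexp_plus, IH, !Cmult_1_l.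
  unfold cexp. simpl. rewrite exp_0, cos_2PI, sin_2PI.
  apply injective_projections; simpl; ring.
Qed.

Lemma cexp_opp_nat_period (k : nat) : cexp (- RtoC (INR k) * (0%R, (2 * PI)%R)) = RtoC 1.
Proof.
replace (- RtoC (INR k) * (0%R, (2 * PI)%R))%C with (- (RtoC (INR k) * (0%R, (2 * PI)%R)))%C by ring.
rewrite cexp_opp, cexp_nat_period. field.
Qed.

(** * The area theorem *)

Lemma RInt_shrink (L M a b t : R) (f : R -> R) : 0 < t -> a + t <= b - t -> 0 <= L ->
  Lip L a b f -> (forall x, a <= x <= b -> f x <= M) ->
  RInt f a b <= RInt f (a + t) (b - t) + 2 * t * M.
Proof.
intros ht hab hL hf hM.
assert (he : ex_RInt f a b) by (apply (lip_ex_RInt L); auto; lra).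
assert (hsub : forall c d, a <= c -> c <= d -> d <= b -> ex_RInt f c d).
{ intros. apply (ex_RInt_sub _ a b); auto. }
assert (he1 := hsub a (a + t) ltac:(lra) ltac:(lra) ltac:(lra)).
assert (he2 := hsub (a + t) b ltac:(lra) ltac:(lra) ltac:(lra)).
assert (he3 := hsub (a + t) (b - t) ltac:(lra) ltac:(lra) ltac:(lra)).
assert (he4 := hsub (b - t) b ltac:(lra) ltac:(lra) ltac:(lra)).
rewrite <- (RInt_Chasles (V := R_CompleteNormedModule) f a (a + t) b he1 he2).
rewrite <- (RInt_Chasles (V := R_CompleteNormedModule) f (a + t) (b - t) b he3 he4).
unfold plus; simpl.
assert (k1 : RInt f a (a + t) <= (a + t - a) * M).
{ rewrite <- RInt_const_R. apply RInt_le; auto; [lra|apply ex_RInt_const|]. intros x hx. apply hM. lra. }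
assert (k2 : RInt f (b - t) b <= (b - (b - t)) * M).
{ rewrite <- RInt_const_R. apply RInt_le; auto; [lra|apply ex_RInt_const|]. intros x hx. apply hM. lra. }
lra.
Qed.

(** The area bound asks for a margin inside the domain of injectivity, whereas Parseval's identity
    uses a full period; the frame of width [t] between them costs a multiple of [t]. *)
Lemma DInt_shrink (L M a b c d t : R) (f : C -> R) :
  0 < t -> a + t <= b - t -> c + t <= d - t -> 0 <= L -> 0 <= M ->
  LipC L a b c d f -> (forall z, in_rect a b c d z -> f z <= M) ->
  DInt f a b c d <= DInt f (a + t) (b - t) (c + t) (d - t) + 2 * t * M * ((d - c) + (b - a)).
Proof.
intros ht hab hcd hL hM hf hfM. unfold DInt.
set (F := fun u => RInt (fun v => f (u, v)) c d).
assert (hLF : 0 <= (d - c) * L) by (apply Rmult_le_pos; lra).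
assert (hF : Lip ((d - c) * L) a b F) by (apply LipC_inner; auto; lra).
assert (hFM : forall u, a <= u <= b -> F u <= (d - c) * M).
{ intros u hu. unfold F. rewrite <- RInt_const_R. apply RInt_le; [lra| |apply ex_RInt_const|].
  - apply (LipC_inner_ex a b c d) with L; auto; lra.
  - intros v hv. apply hfM. split; simpl; lra. }
eapply Rle_trans; [apply (RInt_shrink ((d - c) * L) ((d - c) * M) a b t F); auto|].
assert (hLip2 : LipC L (a + t) (b - t) (c + t) (d - t) f).
{ intros z w hz hw. apply hf; unfold in_rect in *; lra. }
assert (hex2 : ex_RInt (fun u => RInt (fun v => f (u, v)) (c + t) (d - t)) (a + t) (b - t))
  by (apply (LipC_outer_ex _ _ _ _ hab hcd L); auto).
assert (k : RInt F (a + t) (b - t) <=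
  RInt (fun u => RInt (fun v => f (u, v)) (c + t) (d - t) + 2 * t * M) (a + t) (b - t)).
{ apply RInt_le; auto.
  - apply (lip_ex_RInt ((d - c) * L)); auto. intros x y hx hy. apply hF; lra.
  - apply (ex_RInt_plus (V := R_NormedModule)); [exact hex2|apply ex_RInt_const].
  - intros u hu. unfold F. apply (RInt_shrink L M c d t (fun v => f (u, v))); auto.
    + apply (LipC_slice a b c d); auto. lra.
    + intros v hv. apply hfM. split; simpl; lra. }
assert (e : RInt (fun u => RInt (fun v => f (u, v)) (c + t) (d - t) + 2 * t * M) (a + t) (b - t)
  = RInt (fun u => RInt (fun v => f (u, v)) (c + t) (d - t)) (a + t) (b - t)
    + (b - t - (a + t)) * (2 * t * M)).
{ rewrite <- RInt_const_R.
  apply (RInt_plus (V := R_CompleteNormedModule)); [exact hex2|apply ex_RInt_const]. }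
assert (0 <= t * M) by (apply Rmult_le_pos; lra).
assert (0 <= t * (t * M)) by (apply Rmult_le_pos; lra).
lra.
Qed.

Lemma cexp_period (n x : R) : cexp (RtoC n * (0, 2 * PI)) = RtoC 1 ->
  cexp (RtoC n * (x, 2 * PI)) = cexp (RtoC n * (x, 0)).
Proof.
intros h.
replace ((x, (2 * PI)%R)) with ((x, 0%R) + (0%R, (2 * PI)%R))%C
  by (apply injective_projections; simpl; ring).
rewrite Cmult_plus_distr_l, cexp_plus, h. ring.
Qed.

(** Scaling the semi-axes to 1 moves [(X cos y, Y sin y)] into the disk of radius [1 - q / B], and
    [e] to a vector of length at most [q / B], as [B] is the smaller semi-axis. *)
Lemma in_ellipse_perturb (A B X Y q : R) (e : C) (y : R) : 0 < B -> B <= A -> 0 <= q ->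
  Cmod e <= q -> Rabs X / A + q / B <= 1 -> Rabs Y / B + q / B <= 1 ->
  in_ellipse A B (((X * cos y)%R, (Y * sin y)%R) + e)%C.
Proof.
intros hB hAB hq he hX hY. unfold in_ellipse.
assert (hA : 0 < A) by lra.
set (v := ((X / A * cos y)%R, (Y / B * sin y)%R) : C).
set (e' := ((Re e / A)%R, (Im e / B)%R) : C).
assert (hqB : 0 <= q / B) by (apply Rdiv_le_0_compat; lra).
assert (hv : Cmod v <= 1 - q / B).
{ assert (h0 : 0 <= 1 - q / B) by (assert (0 <= Rabs Y / B) by (apply Rdiv_le_0_compat; [apply Rabs_pos|lra]); lra).
  apply Rsqr_incr_0_var; auto. unfold Rsqr.
  replace (Cmod v * Cmod v) with (Cmod v ^ 2) by ring. rewrite Cmod2_alt. unfold v; simpl Re; simpl Im.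
  assert (a1 : (X / A) ^ 2 <= (1 - q / B) ^ 2).
  { rewrite <- pow2_abs, Rabs_div, (Rabs_pos_eq A) by lra. apply pow_incr. split; [|lra].
    apply Rdiv_le_0_compat; [apply Rabs_pos|auto]. }
  assert (a2 : (Y / B) ^ 2 <= (1 - q / B) ^ 2).
  { rewrite <- pow2_abs, Rabs_div, (Rabs_pos_eq B) by lra. apply pow_incr. split; [|lra].
    apply Rdiv_le_0_compat; [apply Rabs_pos|auto]. }
  assert (a3 := sin2_cos2 y). unfold Rsqr in a3.
  replace ((1 - q / B) * (1 - q / B)) with ((1 - q / B) ^ 2 * (cos y ^ 2) + (1 - q / B) ^ 2 * (sin y ^ 2))
    by (rewrite <- Rmult_plus_distr_l; replace (cos y ^ 2 + sin y ^ 2) with 1 by (simpl; lra); ring).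
  rewrite !Rpow_mult_distr.
  apply Rplus_le_compat; apply Rmult_le_compat_r; auto; apply pow2_ge_0. }
assert (he' : Cmod e' <= q / B).
{ apply Rle_trans with (Cmod e / B).
  - apply Rsqr_incr_0_var; [|apply Rdiv_le_0_compat; [apply Cmod_ge_0|lra]]. unfold Rsqr.
    replace (Cmod e' * Cmod e') with (Cmod e' ^ 2) by ring.
    replace (Cmod e / B * (Cmod e / B)) with (Cmod e ^ 2 * (/ B) ^ 2) by (field; lra).
    rewrite !Cmod2_alt. unfold e'; simpl Re; simpl Im. unfold Rdiv. rewrite !Rpow_mult_distr.
    rewrite Rmult_plus_distr_r. apply Rplus_le_compat_r. apply Rmult_le_compat_l; [apply pow2_ge_0|].
    apply pow_incr. split; [left; now apply Rinv_0_lt_compat|]. apply Rinv_le_contravar; auto.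
  - apply div_le_compat; auto. }
assert (h1 : Cmod (v + e') <= 1) by (eapply Rle_trans; [apply Cmod_triangle|lra]).
assert (h2 : Cmod (v + e') ^ 2 <= 1 ^ 2) by (apply pow_incr; split; [apply Cmod_ge_0|auto]).
rewrite Cmod2_alt in h2. unfold v, e' in h2. simpl Re in h2; simpl Im in h2.
replace (Re (((X * cos y)%R, (Y * sin y)%R) + e)%C / A) with (X / A * cos y + Re e / A)
  by (destruct e; simpl; field; lra).
replace (Im (((X * cos y)%R, (Y * sin y)%R) + e)%C / B) with (Y / B * sin y + Im e / B)
  by (destruct e; simpl; field; lra).
lra.
Qed.

Section AreaTheorem.

Variables (h h' : C -> C) (rho k : R) (c2 c3 c4 : C).
Hypotheses (hrho : 0 < rho < 1) (hk : 0 <= k).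
Hypothesis hC : C11 (fun u => Cmod u <= rho) h h'.
Variable K : R.
Hypothesis hK : 0 <= K.
Hypothesis hexp : forall u, Cmod u <= rho ->
  Cmod (h u - (1 + RtoC k * u + c2 * (u * u) + c3 * (u * u * u) + c4 * (u * u * u * u))) <= K * Cmod u ^ 5.
Hypothesis hinj : forall z w, z <> RtoC 0 -> w <> RtoC 0 ->
  Cmod (z * z) <= rho -> Cmod (w * w) <= rho -> (h (z * z) / z = h (w * w) / w)%C -> z = w.

(** Half of [ln rho], because [h] is evaluated at the square of [exp z]. *)
Let x1 := ln rho / 2.
(* [G z = F (exp z)] for [F z = h (z ^ 2) / z]. *)
Let G (z : C) : C := (cexp (RtoC (-1) * z) * h (cexp (RtoC 2 * z)))%C.
Let G' (z : C) : C := (RtoC (-1) * cexp (RtoC (-1) * z) * h (cexp (RtoC 2 * z))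
  + cexp (RtoC (-1) * z) * (h' (cexp (RtoC 2 * z)) * (RtoC 2 * cexp (RtoC 2 * z))))%C.

Lemma exp_2x1 : exp (2 * x1) = rho.
Proof. unfold x1. replace (2 * (ln rho / 2)) with (ln rho) by field. apply exp_ln. lra. Qed.

Lemma Cmod_cexp2 (z : C) : Re z <= x1 -> Cmod (cexp (RtoC 2 * z)) <= rho.
Proof.
intros hz. rewrite Cmod_cexp, <- exp_2x1. apply exp_le_compat.
destruct z. simpl in *. lra.
Qed.

Lemma G_C11 (x0 : R) : C11 (in_rect x0 x1 (-1) 8) G G'.
Proof.
unfold G, G'. apply C11_mult; [apply C11_cexp_scal|].
apply (C11_comp _ (fun u => Cmod u <= rho)).
- intros z [hz _]. apply Cmod_cexp2. lra.
- apply C11_cexp_scal.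
- exact hC.
Qed.

Lemma cexp_m1 (z : C) : cexp (RtoC (-1) * z) = (/ cexp z)%C.
Proof. rewrite <- cexp_opp. f_equal. apply injective_projections; simpl; ring. Qed.

Lemma cexp_2 (z : C) : cexp (RtoC 2 * z) = (cexp z * cexp z)%C.
Proof. rewrite <- cexp_plus. f_equal. apply injective_projections; simpl; ring. Qed.

Lemma cexp_modes (z : C) : let w := cexp z in
  cexp (RtoC 1 * z) = w /\ cexp (RtoC 3 * z) = (w * w * w)%C /\
  cexp (RtoC 5 * z) = (w * w * w * w * w)%C /\ cexp (RtoC 7 * z) = (w * w * w * w * w * w * w)%C.
Proof.
intros w. unfold w. rewrite <- !cexp_plus.
repeat split; f_equal; apply injective_projections; simpl; ring.
Qed.

Lemma G_eq (z : C) : G z = (h (cexp z * cexp z) / cexp z)%C.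
Proof. unfold G. rewrite cexp_m1, cexp_2. unfold Cdiv. ring. Qed.

(** [G] with its modes of frequency -1, 1, 3, 5, 7 removed in turn; all frequencies are odd because
    [F] is. The derivatives carry redundant factors such as [RtoC 1] so that they match
    [parseval_step] by conversion. *)
Let E0 z := (G z - RtoC 1 * cexp (RtoC (-1) * z))%C.
Let E0' z := (G' z - RtoC (-1) * RtoC 1 * cexp (RtoC (-1) * z))%C.
Let E1 z := (E0 z - RtoC k * cexp (RtoC 1 * z))%C.
Let E1' z := (E0' z - RtoC 1 * RtoC k * cexp (RtoC 1 * z))%C.
Let E2 z := (E1 z - c2 * cexp (RtoC 3 * z))%C.
Let E2' z := (E1' z - RtoC 3 * c2 * cexp (RtoC 3 * z))%C.
Let E3 z := (E2 z - c3 * cexp (RtoC 5 * z))%C.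
Let E3' z := (E2' z - RtoC 5 * c3 * cexp (RtoC 5 * z))%C.
Let E4 z := (E3 z - c4 * cexp (RtoC 7 * z))%C.
Let E4' z := (E3' z - RtoC 7 * c4 * cexp (RtoC 7 * z))%C.

Lemma C11_sub_mode (x0 n : R) (b : C) (f f' : C -> C) :
  C11 (in_rect x0 x1 (-1) 8) f f' ->
  C11 (in_rect x0 x1 (-1) 8) (fun z => f z - b * cexp (RtoC n * z))%C
    (fun z => f' z - RtoC n * b * cexp (RtoC n * z))%C.
Proof.
intros hf. eapply C11_ext; [|apply C11_minus; [exact hf|apply (C11_scal _ b _ _ (C11_cexp_scal x0 x1 (RtoC n)))]].
intros z _. simpl. split; [reflexivity|]. ring.
Qed.

Lemma int_period (m : nat) : cexp (RtoC (INR m) * (0%R, (2 * PI)%R)) = RtoC 1 /\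
  cexp (- RtoC (INR m) * (0%R, (2 * PI)%R)) = RtoC 1.
Proof. split; [apply cexp_nat_period|apply cexp_opp_nat_period]. Qed.

Lemma G_period (x : R) : G (x, 2 * PI) = G (x, 0).
Proof.
unfold G. rewrite (cexp_period 2 x), (cexp_period (-1) x); auto.
- replace (RtoC (-1)) with (- RtoC (INR 1))%C by (rewrite <- RtoC_opp; f_equal; simpl; ring).
  apply int_period.
- replace 2 with (INR 2) at 1 by (simpl; ring). apply int_period.
Qed.

(** An earlier truncation puts the dropped terms into the remainder; since [Cmod u <= 1], one
    constant serves all orders. *)
Lemma remainder_bounds (u : C) : Cmod u <= rho ->
  let K' := K + k + Cmod c2 + Cmod c3 + Cmod c4 in
  Cmod (h u - 1) <= K' * Cmod u ^ 1 /\
  Cmod (h u - (1 + RtoC k * u)) <= K' * Cmod u ^ 2 /\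
  Cmod (h u - (1 + RtoC k * u + c2 * (u * u))) <= K' * Cmod u ^ 3 /\
  Cmod (h u - (1 + RtoC k * u + c2 * (u * u) + c3 * (u * u * u))) <= K' * Cmod u ^ 4.
Proof.
intros hu K'. assert (h5 := hexp u hu).
assert (p := Cmod_ge_0 u). assert (p2 := Cmod_ge_0 c2). assert (p3 := Cmod_ge_0 c3). assert (p4 := Cmod_ge_0 c4).
assert (step : forall (a b : C) (A B : R) (m : nat), 0 <= A -> 0 <= B ->
  Cmod a <= A * Cmod u ^ (S m) -> Cmod b <= B * Cmod u ^ m -> Cmod (a + b) <= (A + B) * Cmod u ^ m).
{ intros a b A' B' m hA hB ha hb. eapply Rle_trans; [apply Cmod_triangle|].
  rewrite Rmult_plus_distr_r. apply Rplus_le_compat; auto.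
  eapply Rle_trans; [exact ha|]. apply Rmult_le_compat_l; auto.
  simpl. assert (0 <= Cmod u ^ m) by (apply pow_le; auto). nra. }
assert (b4 : Cmod (h u - (1 + RtoC k * u + c2 * (u * u) + c3 * (u * u * u))) <= (K + Cmod c4) * Cmod u ^ 4).
{ replace (h u - (1 + RtoC k * u + c2 * (u * u) + c3 * (u * u * u)))%C
    with (h u - (1 + RtoC k * u + c2 * (u * u) + c3 * (u * u * u) + c4 * (u * u * u * u)) + c4 * (u * u * u * u))%C by ring.
  apply step; auto. rewrite !Cmod_mult. right. ring. }
assert (b3 : Cmod (h u - (1 + RtoC k * u + c2 * (u * u))) <= (K + Cmod c4 + Cmod c3) * Cmod u ^ 3).
{ replace (h u - (1 + RtoC k * u + c2 * (u * u)))%C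
    with (h u - (1 + RtoC k * u + c2 * (u * u) + c3 * (u * u * u)) + c3 * (u * u * u))%C by ring.
  apply step; auto; [lra|]. rewrite !Cmod_mult. right. ring. }
assert (b2 : Cmod (h u - (1 + RtoC k * u)) <= (K + Cmod c4 + Cmod c3 + Cmod c2) * Cmod u ^ 2).
{ replace (h u - (1 + RtoC k * u))%C
    with (h u - (1 + RtoC k * u + c2 * (u * u)) + c2 * (u * u))%C by ring.
  apply step; auto; [lra|]. rewrite !Cmod_mult. right. ring. }
assert (b1 : Cmod (h u - 1) <= (K + Cmod c4 + Cmod c3 + Cmod c2 + k) * Cmod u ^ 1).
{ replace (h u - 1)%C with (h u - (1 + RtoC k * u) + RtoC k * u)%C by ring.
  apply step; auto; [lra|]. rewrite !Cmod_mult, Cmod_R, Rabs_pos_eq by auto. right. ring. }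
assert (w : forall A' m, A' <= K' -> A' * Cmod u ^ m <= K' * Cmod u ^ m).
{ intros A' m hA. apply Rmult_le_compat_r; auto. now apply pow_le. }
unfold K' in *.
repeat split; (eapply Rle_trans; [eassumption|apply w; lra]).
Qed.

(** Evaluation at [exp (2 z)] doubles the order and division by [exp z] lowers it by one. The
    resulting exponents 1, 3, 5, 7, 9 exceed by 2 the last frequency removed. *)
Lemma decaying_remainder (f f' r : C -> C) (Q : R) (m : nat) :
  (forall x0, C11 (in_rect x0 x1 (-1) 8) f f') ->
  (forall x, f (x, 2 * PI) = f (x, 0)) ->
  (forall z, f z = (r (cexp z * cexp z) / cexp z)%C) ->
  (forall u, Cmod u <= rho -> Cmod (r u) <= Q * Cmod u ^ m) ->
  decaying x1 (2 * INR m - 1) f f'.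
Proof.
intros hf hp he hr. split; [auto|split; [auto|]].
exists Q. intros x y hx. rewrite he.
assert (hn := cexp_neq_0 (x, y)).
rewrite Cmod_div by auto.
assert (hz : Cmod (cexp (x, y) * cexp (x, y)) <= rho).
{ rewrite <- cexp_2. apply Cmod_cexp2. exact hx. }
assert (h0 := hr _ hz). rewrite Cmod_mult, Cmod_cexp in h0. rewrite Cmod_cexp. simpl Re in *.
assert (hx0 := exp_pos x).
apply Rmult_le_reg_r with (exp x); auto. unfold Rdiv.
rewrite Rmult_assoc, Rinv_l, Rmult_1_r by lra.
eapply Rle_trans; [exact h0|]. right.
rewrite Rmult_assoc, <- !exp_plus. f_equal.
replace ((2 * INR m - 1) * x + x) with (INR m * (x + x)) by ring.
clear. generalize (x + x) as y. intros y. induction m as [|m IH].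
- simpl. now rewrite Rmult_0_l, exp_0.
- rewrite S_INR, Rmult_plus_distr_r, exp_plus, <- IH, Rmult_1_l. simpl. ring.
Qed.

Ltac modes := unfold E4, E3, E2, E1, E0.
Ltac periodic := intros t; modes; rewrite G_period, !cexp_period by assumption; reflexivity.
Ltac quotient := intros z; modes; destruct (cexp_modes z) as [m1 [m3 [m5 m7]]];
  rewrite G_eq, cexp_m1, ?m1, ?m3, ?m5, ?m7; field; apply cexp_neq_0.

(** Each [parseval_step] leaves the integral for the next remainder; the last of these integrals is
    dropped as nonnegative. *)
Lemma bessel (x : R) : x <= x1 ->
  2 * PI * (exp (- 2 * x) + k ^ 2 * exp (2 * x) + 9 * Cmod c2 ^ 2 * exp (6 * x)
     + 25 * Cmod c3 ^ 2 * exp (10 * x) + 49 * Cmod c4 ^ 2 * exp (14 * x))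
  <= RInt (fun y => Cmod (G' (x, y)) ^ 2) 0 (2 * PI).
Proof.
intros hx.
assert (p_1 : cexp (- RtoC (-1) * (0%R, (2 * PI)%R)) = RtoC 1).
{ replace (- RtoC (-1))%C with (RtoC (INR 1)) by (rewrite <- RtoC_opp; f_equal; simpl; ring). apply int_period. }
assert (q_1 : cexp (RtoC (-1) * (0%R, (2 * PI)%R)) = RtoC 1).
{ replace (RtoC (-1)) with (- RtoC (INR 1))%C by (rewrite <- RtoC_opp; f_equal; simpl; ring). apply int_period. }
assert (pp : forall m n, INR m = n -> cexp (RtoC n * (0%R, (2 * PI)%R)) = RtoC 1 /\
  cexp (- RtoC n * (0%R, (2 * PI)%R)) = RtoC 1) by (intros m n <-; apply int_period).
destruct (pp 1%nat 1 ltac:(simpl; ring)) as [q1 p1].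
destruct (pp 3%nat 3 ltac:(simpl; ring)) as [q3 p3].
destruct (pp 5%nat 5 ltac:(simpl; ring)) as [q5 p5].
destruct (pp 7%nat 7 ltac:(simpl; ring)) as [q7 p7].
set (K' := K + k + Cmod c2 + Cmod c3 + Cmod c4).
assert (d0 : decaying x1 (2 * INR 1 - 1) E0 E0').
{ apply decaying_remainder with (fun u => h u - 1)%C K'; [|periodic|quotient|].
  - intros x0. exact (C11_sub_mode _ _ _ _ _ (G_C11 x0)).
  - intros u hu. apply (remainder_bounds u hu). }
assert (d1 : decaying x1 (2 * INR 2 - 1) E1 E1').
{ apply decaying_remainder with (fun u => h u - (1 + RtoC k * u))%C K'; [|periodic|quotient|].
  - intros x0. exact (C11_sub_mode _ _ _ _ _ (proj1 d0 x0)).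
  - intros u hu. apply (remainder_bounds u hu). }
assert (d2 : decaying x1 (2 * INR 3 - 1) E2 E2').
{ apply decaying_remainder with (fun u => h u - (1 + RtoC k * u + c2 * (u * u)))%C K'; [|periodic|quotient|].
  - intros x0. exact (C11_sub_mode _ _ _ _ _ (proj1 d1 x0)).
  - intros u hu. apply (remainder_bounds u hu). }
assert (d3 : decaying x1 (2 * INR 4 - 1) E3 E3').
{ apply decaying_remainder with (fun u => h u - (1 + RtoC k * u + c2 * (u * u) + c3 * (u * u * u)))%C K'; [|periodic|quotient|].
  - intros x0. exact (C11_sub_mode _ _ _ _ _ (proj1 d2 x0)).
  - intros u hu. apply (remainder_bounds u hu). }
assert (d4 : decaying x1 (2 * INR 5 - 1) E4 E4').
{ apply decaying_remainder with (fun u => h u - (1 + RtoC k * u + c2 * (u * u) + c3 * (u * u * u) + c4 * (u * u * u * u)))%C K; [|periodic|quotient|].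
  - intros x0. exact (C11_sub_mode _ _ _ _ _ (proj1 d3 x0)).
  - intros u hu. now apply hexp. }
assert (s0 := parseval_step x1 (2 * INR 1 - 1) (-1) x (RtoC 1) G' E0 E0' p_1 (fun _ => eq_refl) ltac:(simpl; lra) hx d0).
assert (s1 := parseval_step x1 (2 * INR 2 - 1) 1 x (RtoC k) E0' E1 E1' p1 (fun _ => eq_refl) ltac:(simpl; lra) hx d1).
assert (s2 := parseval_step x1 (2 * INR 3 - 1) 3 x c2 E1' E2 E2' p3 (fun _ => eq_refl) ltac:(simpl; lra) hx d2).
assert (s3 := parseval_step x1 (2 * INR 4 - 1) 5 x c3 E2' E3 E3' p5 (fun _ => eq_refl) ltac:(simpl; lra) hx d3).
assert (s4 := parseval_step x1 (2 * INR 5 - 1) 7 x c4 E3' E4 E4' p7 (fun _ => eq_refl) ltac:(simpl; lra) hx d4).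
assert (hfin : 0 <= RInt (fun y => Cmod (E4' (x, y)) ^ 2) 0 (2 * PI)).
{ apply RInt_ge_0.
  - generalize PI_RGT_0. lra.
  - apply (C11_Cmod2_ex_RInt x1 x E4); auto. apply (proj1 d4).
  - intros y _. apply pow2_ge_0. }
rewrite s0, s1, s2, s3, s4.
rewrite Cmod_1, Cmod_R, pow2_abs.
replace (2 * -1 * x) with (- 2 * x) by ring.
replace (2 * 1 * x) with (2 * x) by ring.
replace (2 * 3 * x) with (6 * x) by ring.
replace (2 * 5 * x) with (10 * x) by ring.
replace (2 * 7 * x) with (14 * x) by ring.
lra.
Qed.

Let K2 := K + k + Cmod c2 + Cmod c3 + Cmod c4.
(* Semi-axes of an ellipse that contains [F z] for [e <= |z| <= exp x1]: the map [1 / z + k z] sends the circle [|z| = e] to an ellipse, and the last term absorbs the remainder. *)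
Let Ax (e : R) := / e + k * e + 2 * K2 * e ^ 3.
Let Bx (e : R) := / e - k * e + 2 * K2 * e ^ 3.

Lemma K2_nonneg : 0 <= K2.
Proof. unfold K2. generalize (Cmod_ge_0 c2) (Cmod_ge_0 c3) (Cmod_ge_0 c4). lra. Qed.

(** The condition on [x0] makes [1 / e] large. As [|exp z|] grows from [e] to [t], the term [1 / t]
    falls by at least [(t - e) / e], which outweighs the growth of [k t] and of [2 K2 t^3], at most
    [(k + 6 K2) (t - e)]. The summand [3 k] also gives [Ax e <= 2 * Bx e]. *)
Lemma G_in_ellipse (x0 : R) (z : C) : exp x0 * (3 * k + 6 * K2 + 3) <= 1 ->
  in_rect x0 x1 (-1) 8 z -> in_ellipse (Ax (exp x0)) (Bx (exp x0)) (G z).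
Proof.
intros hx0 [hz _]. destruct z as [x y]. simpl in hz.
assert (hK2 := K2_nonneg).
set (e := exp x0) in *. set (t := exp x).
assert (he : 0 < e) by apply exp_pos.
assert (het : e <= t) by (apply exp_le_compat; lra).
assert (htr : t * t <= rho).
{ unfold t. rewrite <- exp_plus, <- exp_2x1. apply exp_le_compat. lra. }
assert (ht1 : t <= 1) by nra.
assert (hexy : cexp (x, y) = ((t * cos y)%R, (t * sin y)%R)) by reflexivity.
set (u := (cexp (x, y) * cexp (x, y))%C).
assert (hmu : Cmod u = t * t) by (unfold u; now rewrite Cmod_mult, !Cmod_cexp).
destruct (remainder_bounds u ltac:(lra)) as [_ [hr _]]. fold K2 in hr. rewrite hmu in hr.
set (er := ((h u - (1 + RtoC k * u)) / cexp (x, y))%C).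
assert (her : Cmod er <= K2 * t ^ 3).
{ unfold er. rewrite Cmod_div by apply cexp_neq_0. rewrite Cmod_cexp. simpl Re. fold t.
  apply Rmult_le_reg_r with t; [lra|]. unfold Rdiv. rewrite Rmult_assoc, Rinv_l by lra.
  rewrite Rmult_1_r. eapply Rle_trans; [exact hr|]. right. ring. }
assert (hG : G (x, y) = ((((/ t + k * t) * cos y)%R, (- (/ t - k * t) * sin y)%R) + er)%C).
{ rewrite G_eq. fold u.
  replace ((h u) / cexp (x, y))%C with (/ cexp (x, y) + RtoC k * cexp (x, y) + er)%C
    by (unfold er, u; field; apply cexp_neq_0).
  f_equal. rewrite <- cexp_opp.
  assert (hm : cexp (- (x, y)) = ((/ t * cos y)%R, (- / t * sin y)%R)).
  { unfold cexp. simpl. rewrite cos_neg, sin_neg, exp_Ropp. fold t. f_equal. ring. }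
  rewrite hm, hexy. apply injective_projections; simpl; ring. }
rewrite hG.
set (I := / e). set (i := / t).
assert (hi : 1 <= i) by (unfold i; rewrite <- Rinv_1; apply Rinv_le_contravar; lra).
assert (hI : 3 * k + 6 * K2 + 3 <= I).
{ unfold I. apply Rmult_le_reg_l with e; auto. rewrite Rinv_r; lra. }
assert (hIi : I - i = (t - e) * (i * I)) by (unfold I, i; field; lra).
assert (hII : (t - e) * I <= I - i).
{ rewrite hIi. apply Rmult_le_compat_l; [lra|]. nra. }
assert (hte : (t - e) * (3 * k + 6 * K2 + 3) <= (t - e) * I) by (apply Rmult_le_compat_l; lra).
assert (hcube : 0 <= t ^ 3 - e ^ 3 <= 3 * (t - e)).
{ replace (t ^ 3 - e ^ 3) with ((t - e) * (t * t + t * e + e * e)) by ring.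
  assert (0 <= t * t + t * e + e * e <= 3) by nra. split; [nra|].
  rewrite (Rmult_comm 3). apply Rmult_le_compat_l; lra. }
assert (hKc : K2 * (t ^ 3 - e ^ 3) <= K2 * (3 * (t - e))) by (apply Rmult_le_compat_l; lra).
assert (hKc0 : 0 <= K2 * (t ^ 3 - e ^ 3)) by (apply Rmult_le_pos; lra).
assert (hke : 0 <= k * (t - e)) by (apply Rmult_le_pos; lra).
assert (hKe : 0 <= K2 * (t - e)) by (apply Rmult_le_pos; lra).
assert (he3 : 0 <= e ^ 3) by (apply pow_le; lra).
assert (hKe3 : 0 <= K2 * e ^ 3) by (apply Rmult_le_pos; lra).
assert (hkee : k * e <= k) by nra.
assert (hkt : k * t <= k) by nra.
assert (ht3 : 0 <= t ^ 3 <= 1) by (split; [apply pow_le; lra|replace 1 with (1 ^ 3) by ring; apply pow_incr; lra]).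
assert (hKt : 0 <= K2 * t ^ 3 <= K2) by nra.
assert (hB : 0 < Bx e) by (unfold Bx; fold I; lra).
assert (hk0 : 0 <= k * e) by nra. assert (hkt0 : 0 <= k * t) by nra.
assert (hAB : Bx e <= Ax e) by (unfold Ax, Bx; lra).
(* Replaces the error [K2 t^3 / Bx e] by [2 K2 t^3 / Ax e], whence the factor 2 in the semi-axes. *)
assert (hA2B : Ax e <= 2 * Bx e) by (unfold Ax, Bx; fold I; lra).
apply (in_ellipse_perturb _ _ _ _ (K2 * t ^ 3)); auto; try lra.
- rewrite (Rabs_pos_eq (i + k * t)) by lra.
  apply Rmult_le_reg_r with (Ax e); [lra|].
  replace (((i + k * t) / Ax e + K2 * t ^ 3 / Bx e) * Ax e)
    with (i + k * t + K2 * t ^ 3 * (Ax e / Bx e)) by (field; lra).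
  assert (Ax e / Bx e <= 2).
  { apply Rmult_le_reg_r with (Bx e); auto. unfold Rdiv. rewrite Rmult_assoc, Rinv_l; lra. }
  assert (K2 * t ^ 3 * (Ax e / Bx e) <= K2 * t ^ 3 * 2) by (apply Rmult_le_compat_l; lra).
  unfold Ax at 2. fold I. lra.
- rewrite Rabs_Ropp. apply Rmult_le_reg_r with (Bx e); auto.
  replace ((Rabs (i - k * t) / Bx e + K2 * t ^ 3 / Bx e) * Bx e)
    with (Rabs (i - k * t) + K2 * t ^ 3) by (field; lra).
  unfold Bx. fold I.
  unfold Rabs. destruct (Rcase_abs (i - k * t)); lra.
Qed.

(** Injectivity of [F] gives [cexp z = cexp w], and a strip of height less than [2 pi] contains no
    two points that differ by a nonzero period. *)
Lemma G_injective (x0 t : R) (z w : C) : 0 < t ->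
  in_rect x0 x1 t (2 * PI - t) z -> in_rect x0 x1 t (2 * PI - t) w -> G z = G w -> z = w.
Proof.
intros ht [hz hz'] [hw hw'] e. rewrite !G_eq in e.
assert (h0 : cexp z = cexp w).
{ apply hinj; auto using cexp_neq_0; rewrite <- cexp_2; apply Cmod_cexp2; lra. }
assert (hre : Re z = Re w).
{ apply exp_inv. rewrite <- !Cmod_cexp. now rewrite h0. }
destruct z as [a b], w as [c d]. simpl in *. subst c.
assert (h1 : cexp ((a, b) - (a, d)) = RtoC 1).
{ unfold Cminus. rewrite cexp_plus, h0, cexp_opp. field. apply cexp_neq_0. }
assert (h2 : cos (b - d) = 1).
{ assert (h3 := f_equal Re h1). unfold cexp in h3. simpl in h3.
  replace (a + - a) with 0 in h3 by ring. rewrite exp_0, Rmult_1_l in h3. exact h3. }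
f_equal.
assert (h3 : sin ((b - d) / 2) = 0).
{ replace (b - d) with (2 * ((b - d) / 2)) in h2 by field. rewrite cos_2a_sin in h2. nra. }
assert (hPI := PI_RGT_0).
destruct (Rtotal_order ((b - d) / 2) 0) as [hlt|[heq|hgt]]; [| lra |].
- assert (0 < sin (- ((b - d) / 2))) by (apply sin_gt_0; lra). rewrite sin_neg in H. lra.
- assert (0 < sin ((b - d) / 2)) by (apply sin_gt_0; lra). lra.
Qed.

Lemma area_upper (x0 : R) : x0 < x1 -> exp x0 * (3 * k + 6 * K2 + 3) <= 1 ->
  DInt (fun z => Cmod (G' z) ^ 2) x0 x1 0 (2 * PI) <= PI * Ax (exp x0) * Bx (exp x0).
Proof.
intros hx hx0.
assert (hK2 := K2_nonneg). assert (hpi := two_PI_lt_7). assert (hpi' := PI_RGT_0).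
assert (hC11 := G_C11 x0).
assert (hC11' : C11 (in_rect x0 x1 0 (2 * PI)) G G').
{ apply C11_sub with (2 := hC11). intros z [h1 h2]. split; lra. }
destruct (C11_Cmod2_LipC _ _ _ _ _ _ hC11') as [L [hL hLip]].
assert (hbd : exists M, 0 <= M /\ forall z, in_rect x0 x1 0 (2 * PI) z -> Cmod (G' z) ^ 2 <= M).
{ destruct hC11' as [M [hM [hM' _]]]. exists (M ^ 2). split; [apply pow2_ge_0|].
  intros z hz. apply pow_incr. split; [apply Cmod_ge_0|]. apply hM'. auto. }
destruct hbd as [M [hM hM']].
assert (he : 0 < exp x0) by apply exp_pos.
assert (hI : 3 * k + 6 * K2 + 3 <= / exp x0).
{ apply Rmult_le_reg_l with (exp x0); auto. rewrite Rinv_r; lra. }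
assert (he1 : exp x0 <= 1) by nra.
assert (hke : 0 <= k * exp x0 <= k) by nra.
assert (he3 : 0 <= K2 * exp x0 ^ 3) by (apply Rmult_le_pos; [auto|apply pow_le; lra]).
assert (hA : 0 < Ax (exp x0)) by (unfold Ax; lra).
assert (hB : 0 < Bx (exp x0)) by (unfold Bx; lra).
(* Margins up to [m] leave a nonempty rectangle in both directions. *)
set (m := Rmin ((x1 - x0) / 4) (1/2)).
assert (hm : 0 < m) by (apply Rmin_pos; lra).
assert (hm1 : m <= (x1 - x0) / 4) by apply Rmin_l. assert (hm2 : m <= 1/2) by apply Rmin_r.
assert (hPI3 : 3 <= 2 * PI) by (generalize PI2_3_2; unfold PI2; lra).
apply le_of_harmonic with (2 * m * M * ((2 * PI - 0) + (x1 - x0))). intros n.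
assert (hn : 1 <= INR (S n)) by (rewrite S_INR; generalize (pos_INR n); lra).
set (t := m / INR (S n)).
assert (ht : 0 < t) by (apply Rdiv_lt_0_compat; lra).
assert (htm : t <= m).
{ apply Rmult_le_reg_r with (INR (S n)); [lra|]. unfold t, Rdiv. rewrite Rmult_assoc, Rinv_l by lra. nra. }
eapply Rle_trans; [apply (DInt_shrink L M x0 x1 0 (2 * PI) t); auto; lra|].
apply Rplus_le_compat; [|right; unfold t; field; lra].
(* In the vertical direction half of the margin cuts the period open to keep [cexp] injective; the
   other half is the distance to the inner rectangle. *)
apply (injective_area_le G G' x0 x1 (t / 2) (2 * PI - t / 2)); auto; try lra.
- apply C11_sub with (2 := hC11). intros z [h1 h2]. split; lra.
- intros z w hz hw. apply (G_injective x0 (t / 2)); auto. lra.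
- intros z [h1 h2]. apply G_in_ellipse; auto. split; lra.
Qed.

(** [bessel] integrated in [x]: the mode of frequency [n] contributes [2 pi n^2 exp (2 n x)], with
    antiderivative [pi n exp (2 n x)]. This is the origin of the weights 1, 3, 5, 7, and of the
    opposite sign for [n = -1]. *)
Lemma area_lower (x0 : R) : x0 <= x1 ->
  PI * ((exp (- 2 * x0) - exp (- 2 * x1)) + k ^ 2 * (exp (2 * x1) - exp (2 * x0))
    + 3 * Cmod c2 ^ 2 * (exp (6 * x1) - exp (6 * x0))
    + 5 * Cmod c3 ^ 2 * (exp (10 * x1) - exp (10 * x0))
    + 7 * Cmod c4 ^ 2 * (exp (14 * x1) - exp (14 * x0)))
  <= DInt (fun z => Cmod (G' z) ^ 2) x0 x1 0 (2 * PI).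
Proof.
intros hx. assert (hpi := two_PI_lt_7). assert (hpi' := PI_RGT_0).
set (W := fun x => 2 * PI * (exp (- 2 * x) + k ^ 2 * exp (2 * x) + 9 * Cmod c2 ^ 2 * exp (6 * x)
     + 25 * Cmod c3 ^ 2 * exp (10 * x) + 49 * Cmod c4 ^ 2 * exp (14 * x))).
set (V := fun x => PI * (- exp (- 2 * x) + k ^ 2 * exp (2 * x) + 3 * Cmod c2 ^ 2 * exp (6 * x)
     + 5 * Cmod c3 ^ 2 * exp (10 * x) + 7 * Cmod c4 ^ 2 * exp (14 * x))).
assert (hW : is_RInt W x0 x1 (minus (V x1) (V x0))).
{ apply (is_RInt_derive (V := R_CompleteNormedModule)).
  - intros x _. unfold V, W. auto_derive; auto. ring.
  - intros x _. apply continuity_pt_filterlim. apply derivable_continuous_pt. unfold W. reg. }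
replace (PI * _) with (minus (V x1) (V x0)) by (unfold minus, plus, opp, V; simpl; ring).
rewrite <- (is_RInt_unique _ _ _ _ hW). unfold DInt.
assert (hC11' : C11 (in_rect x0 x1 0 (2 * PI)) G G').
{ apply C11_sub with (2 := G_C11 x0). intros z [h1 h2]. split; lra. }
destruct (C11_Cmod2_LipC _ _ _ _ _ _ hC11') as [L [hL hLip]].
assert (hcd : 0 <= 2 * PI) by lra.
apply RInt_le; auto.
- eexists; exact hW.
- exact (LipC_outer_ex x0 x1 0 (2 * PI) hx hcd L (fun z => Cmod (G' z) ^ 2) hL hLip).
- intros x hx'. apply bessel. lra.
Qed.

(** In the comparison of [area_lower] with [area_upper] the terms [1 / e^2] cancel, and everything
    else that depends on [e] is [O(e)]. *)
Lemma area_theorem_real :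
  k ^ 2 * rho + 3 * Cmod c2 ^ 2 * rho ^ 3 + 5 * Cmod c3 ^ 2 * rho ^ 5 + 7 * Cmod c4 ^ 2 * rho ^ 7 <= / rho.
Proof.
assert (hK2 := K2_nonneg). assert (hpi := PI_RGT_0).
set (e0 := Rmin (exp x1 / 2) (/ (3 * k + 6 * K2 + 3))).
assert (hx1p := exp_pos x1).
assert (he0 : 0 < e0) by (apply Rmin_pos; [lra|apply Rinv_0_lt_compat; lra]).
assert (he1 : e0 <= exp x1 / 2) by apply Rmin_l.
assert (he2 : e0 <= / (3 * k + 6 * K2 + 3)) by apply Rmin_r.
(* Bounds the errors by [Q * e]: the lower limits of the antiderivatives, and the excess of
   [Ax e * Bx e] over [1 / e^2]. *)
set (Q := k ^ 2 + 3 * Cmod c2 ^ 2 + 5 * Cmod c3 ^ 2 + 7 * Cmod c4 ^ 2 + 4 * K2 + 4 * K2 ^ 2).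
assert (hrho1 : exp (- 2 * x1) = / rho).
{ replace (- 2 * x1) with (- (2 * x1)) by ring. now rewrite exp_Ropp, exp_2x1. }
assert (hpw : forall m : nat, exp (INR m * (2 * x1)) = rho ^ m).
{ induction m as [|m IH]; [simpl; now rewrite Rmult_0_l, exp_0|].
  rewrite S_INR, Rmult_plus_distr_r, exp_plus, IH, Rmult_1_l, exp_2x1. simpl. ring. }
assert (h3 := hpw 3%nat). assert (h5 := hpw 5%nat). assert (h7 := hpw 7%nat).
replace (INR 3 * (2 * x1)) with (6 * x1) in h3 by (simpl; ring).
replace (INR 5 * (2 * x1)) with (10 * x1) in h5 by (simpl; ring).
replace (INR 7 * (2 * x1)) with (14 * x1) in h7 by (simpl; ring).
apply le_of_harmonic with (Q * e0). intros n.
assert (hn : 1 <= INR (S n)) by (rewrite S_INR; generalize (pos_INR n); lra).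
set (e := e0 / INR (S n)).
assert (he : 0 < e) by (apply Rdiv_lt_0_compat; lra).
assert (hee0 : e <= e0).
{ apply Rmult_le_reg_r with (INR (S n)); [lra|]. unfold e, Rdiv. rewrite Rmult_assoc, Rinv_l by lra. nra. }
set (x0 := ln e).
assert (hex0 : exp x0 = e) by now apply exp_ln.
assert (hx01 : x0 < x1) by (apply exp_lt_inv; lra).
assert (hsmall : exp x0 * (3 * k + 6 * K2 + 3) <= 1).
{ rewrite hex0. apply Rle_trans with (/ (3 * k + 6 * K2 + 3) * (3 * k + 6 * K2 + 3)).
  - apply Rmult_le_compat_r; lra.
  - right. field. lra. }
assert (up := area_upper x0 hx01 hsmall). assert (lo := area_lower x0 (Rlt_le _ _ hx01)).
assert (ul := Rle_trans _ _ _ lo up). rewrite (Rmult_assoc PI (Ax _)) in ul.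
apply Rmult_le_reg_l in ul; auto.
rewrite hex0 in ul.
assert (ee : e <= 1) by (assert (e * 3 <= 1) by (rewrite hex0 in hsmall; nra); lra).
assert (hp2 : exp (2 * x0) = e ^ 2).
{ replace (2 * x0) with (x0 + x0) by ring. rewrite exp_plus, hex0. ring. }
assert (hpm : exp (- 2 * x0) = / e ^ 2).
{ replace (- 2 * x0) with (- (2 * x0)) by ring. now rewrite exp_Ropp, hp2. }
assert (hpow : forall m a : R, a <= m -> 0 <= a -> exp (m * x0) <= exp (a * x0)).
{ intros m a ham ha. apply exp_le_compat.
  assert (x0 <= 0) by (unfold x0; rewrite <- ln_1; destruct ee as [ee| ->]; [left; apply ln_increasing; auto|lra]).
  nra. }
assert (hx1e : exp (1 * x0) = e) by (rewrite Rmult_1_l; auto).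
assert (g2 := hpow 2 1 ltac:(lra) ltac:(lra)). assert (g6 := hpow 6 1 ltac:(lra) ltac:(lra)).
assert (g10 := hpow 10 1 ltac:(lra) ltac:(lra)). assert (g14 := hpow 14 1 ltac:(lra) ltac:(lra)).
rewrite hx1e in *.
rewrite hrho1, exp_2x1, h3, h5, h7, hpm in ul.
assert (hAB : Ax e * Bx e <= / e ^ 2 + 4 * K2 * e + 4 * K2 ^ 2 * e).
{ unfold Ax, Bx.
  replace ((/ e + k * e + 2 * K2 * e ^ 3) * (/ e - k * e + 2 * K2 * e ^ 3))
    with (/ e ^ 2 + 4 * K2 * e ^ 2 + 4 * K2 ^ 2 * e ^ 6 - (k * e) ^ 2) by (field; lra).
  assert (e ^ 2 <= e) by nra.
  assert (e ^ 6 <= e).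
  { replace (e ^ 6) with (e * e ^ 5) by ring. assert (e ^ 5 <= 1 ^ 5) by (apply pow_incr; lra).
    rewrite pow1 in H0. rewrite <- (Rmult_1_r e) at 3. apply Rmult_le_compat_l; lra. }
  assert (K2 * e ^ 2 <= K2 * e) by (apply Rmult_le_compat_l; auto).
  assert (K2 ^ 2 * e ^ 6 <= K2 ^ 2 * e) by (apply Rmult_le_compat_l; [apply pow2_ge_0|auto]).
  generalize (pow2_ge_0 (k * e)). lra. }
assert (mon : forall a x, 0 <= a -> x <= e -> a * x <= a * e) by (intros; apply Rmult_le_compat_l; auto).
assert (m1 := mon (k ^ 2) _ (pow2_ge_0 _) g2).
assert (m2 := mon (Cmod c2 ^ 2) _ (pow2_ge_0 _) g6).
assert (m3 := mon (Cmod c3 ^ 2) _ (pow2_ge_0 _) g10).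
assert (m4 := mon (Cmod c4 ^ 2) _ (pow2_ge_0 _) g14).
replace (Q * e0 / INR (S n)) with (Q * e) by (unfold e; field; lra).
unfold Q. lra.
Qed.

End AreaTheorem.

(** * Complex power series *)

(** A total function, with default values on divergent sequences; what is known about it comes from
    [Clim_geometric]. *)
Definition Clim (x : nat -> C) : C :=
  (real (Lim_seq (fun n => Re (x n))), real (Lim_seq (fun n => Im (x n)))).

Lemma is_lim_seq_geometric (u : nat -> R) (l k q : R) : 0 <= q < 1 ->
  (forall n, Rabs (l - u n) <= k * q ^ n) -> is_lim_seq u l.
Proof.
intros hq h.
assert (hz : is_lim_seq (fun n => k * q ^ n) 0).
{ replace (Finite 0) with (Rbar_mult k 0) by (simpl; f_equal; ring).
  apply (is_lim_seq_scal_l _ k 0). apply is_lim_seq_geom. rewrite Rabs_pos_eq; lra. }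
apply is_lim_seq_spec. apply is_lim_seq_spec in hz.
intros eps. destruct (hz eps) as [N hN]. exists N. intros n hn.
rewrite Rabs_minus_sym. eapply Rle_lt_trans; [apply h|].
generalize (hN n hn) (Rle_abs (k * q ^ n)). rewrite Rminus_0_r. lra.
Qed.

Lemma Clim_geometric (x : nat -> C) (q e : R) : 0 <= q < 1 -> 0 <= e ->
  (forall n, Cmod (x (S n) - x n) <= e * q ^ n) ->
  forall n, Cmod (Clim x - x n) <= 2 * (e / (1 - q)) * q ^ n.
Proof.
intros hq he h.
destruct (geometric_cauchy_C x q e hq he h) as [l hl].
replace (Clim x) with l; [exact hl|].
unfold Clim.
rewrite (is_lim_seq_unique _ (Re l)), (is_lim_seq_unique _ (Im l)).
- now destruct l.
- apply is_lim_seq_geometric with (2 * (e / (1 - q))) q; auto. intros n.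
  eapply Rle_trans; [|apply hl]. apply (im_le_Cmod (l - x n)).
- apply is_lim_seq_geometric with (2 * (e / (1 - q))) q; auto. intros n.
  eapply Rle_trans; [|apply hl]. apply (re_le_Cmod (l - x n)).
Qed.

Fixpoint Csum (u : nat -> C) (n : nat) : C :=
  match n with O => u O | S m => (Csum u m + u (S m))%C end.

Lemma geom_sum_le (q : R) (n : nat) : 0 <= q < 1 -> sum_f_R0 (fun k => q ^ k) n <= / (1 - q).
Proof.
intros hq. rewrite tech3 by lra.
unfold Rdiv. rewrite <- (Rmult_1_l (/ (1 - q))) at 2.
apply Rmult_le_compat_r; [left; apply Rinv_0_lt_compat; lra|].
generalize (pow_le q (S n)). lra.
Qed.

Lemma Csum_le (u : nat -> C) (e d q : R) (n : nat) : 0 <= q < 1 -> 0 <= e -> 0 <= d ->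
  (forall k, Cmod (u k) <= e * q ^ k * d) -> Cmod (Csum u n) <= e / (1 - q) * d.
Proof.
intros hq he hd h.
assert (k : Cmod (Csum u n) <= e * d * sum_f_R0 (fun k => q ^ k) n).
{ induction n as [|n IH].
  - simpl. generalize (h O). simpl. lra.
  - simpl Csum. simpl sum_f_R0. eapply Rle_trans; [apply Cmod_triangle|].
    generalize (h (S n)). simpl. lra. }
eapply Rle_trans; [exact k|].
replace (e / (1 - q) * d) with (e * d * / (1 - q)) by (unfold Rdiv; ring).
apply Rmult_le_compat_l; [now apply Rmult_le_pos|now apply geom_sum_le].
Qed.

Lemma Csum_minus (u v : nat -> C) (n : nat) :
  (Csum u n - Csum v n)%C = Csum (fun k => u k - v k)%C n.
Proof. induction n as [|n IH]; simpl; [reflexivity|]. rewrite <- IH. ring. Qed.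

Lemma Csum_mult (u : nat -> C) (c : C) (n : nat) : (Csum u n * c)%C = Csum (fun k => u k * c)%C n.
Proof. induction n as [|n IH]; simpl; [reflexivity|]. rewrite <- IH. ring. Qed.

(** The bounds in [C11] compare values at two points, so they pass from the terms to partial sums
    and then to limits, all with the constant [e / (1 - q)]. Termwise differentiation is part of the
    conclusion. *)
Lemma C11_series (S : C -> Prop) (f f' : nat -> C -> C) (e q : R) :
  0 <= q < 1 -> 0 <= e ->
  (forall k z, S z -> Cmod (f k z) <= e * q ^ k /\ Cmod (f' k z) <= e * q ^ k) ->
  (forall k z w, S z -> S w -> Cmod (f k z - f k w) <= e * q ^ k * Cmod (z - w) /\
     Cmod (f k z - f k w - f' k w * (z - w)) <= e * q ^ k * Cmod (z - w) ^ 2) ->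
  C11 S (fun z => Clim (Csum (fun k => f k z))) (fun z => Clim (Csum (fun k => f' k z))).
Proof.
intros hq he h1 h2.
set (F := fun z => Clim (Csum (fun k => f k z))). set (F' := fun z => Clim (Csum (fun k => f' k z))).
assert (hqn : forall n, 0 <= q ^ n) by (intros; apply pow_le; lra).
assert (hqS : forall n, q ^ Datatypes.S n <= q ^ n) by (intros n; simpl; generalize (hqn n); nra).
set (c := 2 * (e / (1 - q))).
assert (he' : 0 <= e / (1 - q)) by (apply Rdiv_le_0_compat; lra).
assert (lim : forall (g : nat -> C -> C), (forall k z, S z -> Cmod (g k z) <= e * q ^ k) ->
  forall z n, S z -> Cmod (Clim (Csum (fun k => g k z)) - Csum (fun k => g k z) n) <= c * q ^ n).
{ intros g hg z n hz. apply Clim_geometric; auto. intros m. simpl.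
  replace (Csum (fun k => g k z) m + g (Datatypes.S m) z - Csum (fun k => g k z) m)%C with (g (Datatypes.S m) z) by ring.
  eapply Rle_trans; [apply hg; auto|]. apply Rmult_le_compat_l; auto. }
assert (lF := lim f (fun k z hz => proj1 (h1 k z hz))).
assert (lF' := lim f' (fun k z hz => proj2 (h1 k z hz))).
set (M := e / (1 - q)) in *.
assert (bd : forall (g : nat -> C -> C), (forall k z, S z -> Cmod (g k z) <= e * q ^ k) ->
  forall z, S z -> Cmod (Clim (Csum (fun k => g k z))) <= M).
{ intros g hg z hz. apply le_of_geom with c q; auto. intros n.
  replace (Clim (Csum (fun k => g k z))) with
    ((Clim (Csum (fun k => g k z)) - Csum (fun k => g k z) n) + Csum (fun k => g k z) n)%C by ring.
  eapply Rle_trans; [apply Cmod_triangle|].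
  generalize (lim g hg z n hz) (Csum_le (fun k => g k z) e 1 q n hq he Rle_0_1).
  intros k1 k2. assert (Cmod (Csum (fun k => g k z) n) <= M * 1).
  { apply k2. intros k. rewrite Rmult_1_r. auto. }
  lra. }
exists M. split; [auto|split].
- intros z hz. split; apply bd; auto; intros; apply h1; auto.
- intros z w hz hw. assert (p := Cmod_ge_0 (z - w)).
  split.
  + apply le_of_geom with (2 * c) q; auto. intros n.
    replace (F z - F w)%C with ((F z - Csum (fun k => f k z) n) - (F w - Csum (fun k => f k w) n)
      + (Csum (fun k => f k z) n - Csum (fun k => f k w) n))%C by ring.
    eapply Rle_trans; [apply Cmod_triangle|].
    eapply Rle_trans; [apply Rplus_le_compat_r; apply Cmod_minus_le|].
    assert (b1 := lF z n hz). assert (b2 := lF w n hw). fold (F z) in b1. fold (F w) in b2.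
    rewrite Csum_minus.
    assert (b3 := Csum_le (fun k => f k z - f k w)%C e (Cmod (z - w)) q n hq he p (fun k => proj1 (h2 k z w hz hw))).
    fold M in b3. lra.
  + apply le_of_geom with (2 * c + c * Cmod (z - w)) q; auto. intros n.
    replace (F z - F w - F' w * (z - w))%C with ((F z - Csum (fun k => f k z) n) - (F w - Csum (fun k => f k w) n)
      - (F' w - Csum (fun k => f' k w) n) * (z - w)
      + (Csum (fun k => f k z) n - Csum (fun k => f k w) n - Csum (fun k => f' k w) n * (z - w)))%C by ring.
    eapply Rle_trans; [apply Cmod_triangle|].
    eapply Rle_trans; [apply Rplus_le_compat_r; apply Cmod_minus_le|].
    eapply Rle_trans; [apply Rplus_le_compat_r; apply Rplus_le_compat_r; apply Cmod_minus_le|].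
    assert (b1 := lF z n hz). assert (b2 := lF w n hw). fold (F z) in b1. fold (F w) in b2.
    assert (b4 := lF' w n hw). fold (F' w) in b4.
    rewrite Csum_minus, Csum_mult, Csum_minus, Cmod_mult.
    assert (b3 := Csum_le (fun k => f k z - f k w - f' k w * (z - w))%C e (Cmod (z - w) ^ 2) q n hq he
       (pow2_ge_0 _) (fun k => proj2 (h2 k z w hz hw))).
    fold M in b3.
    assert (Cmod (F' w - Csum (fun k => f' k w) n) * Cmod (z - w) <= c * q ^ n * Cmod (z - w))
      by (apply Rmult_le_compat_r; auto).
    lra.
Qed.

Definition dpow (k : nat) (z : C) : C :=
  match k with O => RtoC 0 | S j => (RtoC (INR (S j)) * z ^ j)%C end.

Lemma dpow_S (k : nat) (z : C) : dpow (S k) z = (z ^ k + z * dpow k z)%C.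
Proof.
destruct k as [|k].
- simpl. ring.
- unfold dpow. rewrite !S_INR, !RtoC_plus. simpl Cpow. ring.
Qed.

(** The factors [r] and [r ^ 2] on the left avoid the exponents [k - 1] and [k - 2]. Induction on
    [k] through [z^(k+1) - w^(k+1) = z (z^k - w^k) + w^k (z - w)]. *)
Lemma monomial_bounds (r : R) (k : nat) (z w : C) : 0 < r -> Cmod z <= r -> Cmod w <= r ->
  r * Cmod (dpow k z) <= INR k * r ^ k /\
  r * Cmod (z ^ k - w ^ k) <= INR k * r ^ k * Cmod (z - w) /\
  r ^ 2 * Cmod (z ^ k - w ^ k - dpow k w * (z - w)) <= INR k ^ 2 * r ^ k * Cmod (z - w) ^ 2.
Proof.
intros hr hz hw.
assert (hp : forall z j, Cmod z <= r -> Cmod (z ^ j)%C <= r ^ j).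
{ intros t j ht. rewrite Cmod_pow. apply pow_incr. split; [apply Cmod_ge_0|auto]. }
assert (hrk : forall j, 0 < r ^ j) by (intros; now apply pow_lt).
assert (hd : forall z j, Cmod z <= r -> r * Cmod (dpow j z) <= INR j * r ^ j).
{ intros t j ht. destruct j as [|j].
  - simpl. rewrite Cmod_0. lra.
  - unfold dpow. rewrite Cmod_mult, Cmod_R, Rabs_pos_eq by apply pos_INR.
    assert (hj := hp t j ht). assert (hj' := pos_INR (S j)).
    replace (INR (S j) * r ^ S j) with (r * (INR (S j) * r ^ j)) by (simpl pow; ring).
    apply Rmult_le_compat_l; [lra|]. apply Rmult_le_compat_l; auto. }
split; [now apply hd|].
assert (p := Cmod_ge_0 (z - w)). set (d := Cmod (z - w)) in *.
induction k as [|k [IH1 IH2]].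
- simpl. replace (1 - 1)%C with (RtoC 0) by ring. replace (0 - 0 * (z - w))%C with (RtoC 0) by ring.
  rewrite Cmod_0. lra.
- assert (hkk := pos_INR k). assert (hk1 := S_INR k).
  split.
  + replace (z ^ S k - w ^ S k)%C with (z * (z ^ k - w ^ k) + w ^ k * (z - w))%C by (simpl; ring).
    apply Rle_trans with (r * (Cmod z * Cmod (z ^ k - w ^ k) + Cmod (w ^ k) * d)).
    * apply Rmult_le_compat_l; [lra|]. eapply Rle_trans; [apply Cmod_triangle|]. rewrite !Cmod_mult. right; reflexivity.
    * assert (a1 : Cmod z * (r * Cmod (z ^ k - w ^ k)) <= r * (INR k * r ^ k * d)).
      { apply Rmult_le_compat; auto; [apply Cmod_ge_0|apply Rmult_le_pos; [lra|apply Cmod_ge_0]]. }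
      assert (a2 : Cmod (w ^ k) * d <= r ^ k * d) by (apply Rmult_le_compat_r; auto).
      assert (a3 : r * (Cmod (w ^ k) * d) <= r * (r ^ k * d)) by (apply Rmult_le_compat_l; lra).
      rewrite hk1. simpl pow. lra.
  + rewrite dpow_S.
    replace (z ^ S k - w ^ S k - (w ^ k + w * dpow k w) * (z - w))%C
      with (z * (z ^ k - w ^ k - dpow k w * (z - w)) + dpow k w * ((z - w) * (z - w)))%C by (simpl; ring).
    apply Rle_trans with (r ^ 2 * (Cmod z * Cmod (z ^ k - w ^ k - dpow k w * (z - w)) + Cmod (dpow k w) * (d * d))).
    * apply Rmult_le_compat_l; [apply pow2_ge_0|]. eapply Rle_trans; [apply Cmod_triangle|]. rewrite !Cmod_mult. right; reflexivity.
    * assert (a1 : Cmod z * (r ^ 2 * Cmod (z ^ k - w ^ k - dpow k w * (z - w))) <= r * (INR k ^ 2 * r ^ k * d ^ 2)).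
      { apply Rmult_le_compat; auto; [apply Cmod_ge_0|apply Rmult_le_pos; [apply pow2_ge_0|apply Cmod_ge_0]]. }
      assert (a2 : r * Cmod (dpow k w) * (r * (d * d)) <= INR k * r ^ k * (r * (d * d))).
      { apply Rmult_le_compat_r; [repeat apply Rmult_le_pos; lra|]. now apply hd. }
      assert (a3 : 0 <= r ^ k * (r * (d * d))).
      { repeat apply Rmult_le_pos; try lra. left; auto. }
      assert (a4 : 0 <= INR k * (r ^ k * (r * (d * d)))) by (apply Rmult_le_pos; auto).
      rewrite hk1. simpl pow in *. lra.
Qed.

Lemma is_pseries_Csum (a : nat -> C) (z l : C) :
  @is_pseries C_AbsRing C_NormedModule a z l ->
  forall eps, 0 < eps -> exists N, forall n, (N <= n)%nat ->
    Cmod (Csum (fun k => a k * z ^ k)%C n - l) < eps.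
Proof.
intros h eps heps.
assert (hs : forall n, sum_n (fun k => @scal C_AbsRing C_NormedModule (pow_n z k) (a k)) n = Csum (fun k => a k * z ^ k)%C n).
{ assert (hp : forall k, @pow_n C_AbsRing z k = (z ^ k)%C).
  { induction k as [|k IH]; [reflexivity|]. simpl. rewrite IH. reflexivity. }
  assert (ht : forall k, @scal C_AbsRing C_NormedModule (pow_n z k) (a k) = (a k * z ^ k)%C).
  { intros k. rewrite hp. change (z ^ k * a k = a k * z ^ k)%C. ring. }
  induction n as [|n IH].
  - rewrite sum_O. apply ht.
  - rewrite sum_Sn, IH, ht. reflexivity. }
unfold is_pseries, is_series in h.
pose proof (proj1 (@filterlim_locally_ball_norm C_AbsRing nat C_NormedModule eventually _ _ _) h) as h2; clear h; rename h2 into h.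
destruct (h (mkposreal eps heps)) as [N hN]. exists N. intros n hn.
specialize (hN n hn). rewrite hs in hN. exact hN.
Qed.

Lemma pseries_terms_bounded (a : nat -> C) (r : R) (l : C) : 0 <= r ->
  @is_pseries C_AbsRing C_NormedModule a (RtoC r) l ->
  exists M, 0 <= M /\ forall n, Cmod (a n) * r ^ n <= M.
Proof.
intros hr h. destruct (is_pseries_Csum a _ l h 1 Rlt_0_1) as [N hN].
assert (hfin : exists M, 0 <= M /\ forall n, (n <= N)%nat -> Cmod (a n) * r ^ n <= M).
{ clear hN. induction N as [|N [M [hM IH]]].
  - exists (Cmod (a O) * r ^ O). split; [apply Rmult_le_pos; [apply Cmod_ge_0|now apply pow_le]|].
    intros n hn. replace n with O by lia. lra.
  - exists (Rmax M (Cmod (a (S N)) * r ^ S N)). split; [eapply Rle_trans; [exact hM|apply Rmax_l]|].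
    intros n hn. destruct (Nat.eq_dec n (S N)) as [->|e]; [apply Rmax_r|].
    eapply Rle_trans; [apply IH; lia|apply Rmax_l]. }
destruct hfin as [M [hM hM']]. exists (M + 2). split; [lra|]. intros n.
destruct (le_lt_dec n N) as [hn|hn]; [generalize (hM' n hn); lra|].
destruct n as [|n]; [lia|].
assert (h1 := hN (S n) ltac:(lia)). assert (h2 := hN n ltac:(lia)).
set (s := Csum (fun k => (a k * RtoC r ^ k)%C) n) in *.
change (Csum (fun k => (a k * RtoC r ^ k)%C) (S n)) with (s + a (S n) * RtoC r ^ S n)%C in h1.
assert (h3 : Cmod (a (S n) * RtoC r ^ S n) <= 2).
{ replace (a (S n) * RtoC r ^ S n)%C with ((s + a (S n) * RtoC r ^ S n - l) - (s - l))%C by ring.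
  eapply Rle_trans; [apply Cmod_minus_le|]. lra. }
rewrite Cmod_mult, Cmod_pow, Cmod_R, Rabs_pos_eq in h3 by auto. lra.
Qed.

Lemma n_pow_bounded (t : R) : 0 < t < 1 -> exists B, 0 <= B /\ forall n, INR n * t ^ n <= B.
Proof.
(* Bernoulli's inequality for [(1 + x)^n] with [1 + x = 1 / t]. *)
intros ht. set (x := / t - 1).
assert (hx : 0 < x).
{ unfold x. assert (1 < / t) by (rewrite <- Rinv_1; apply Rinv_lt_contravar; lra). lra. }
exists (/ x). split; [left; now apply Rinv_0_lt_compat|]. intros n.
assert (h := poly n x hx). replace (1 + x) with (/ t) in h by (unfold x; ring).
rewrite pow_inv in h. assert (hp : 0 < t ^ n) by (apply pow_lt; lra).
apply Rmult_le_reg_r with x; auto. rewrite Rinv_l by lra.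
apply (Rmult_le_compat_r (t ^ n)) in h; [|lra]. rewrite Rinv_l in h by lra. lra.
Qed.

(** Write [r = t^4]: one factor [t^n] bounds the coefficient, two absorb [n^2], and the last one is
    the geometric rate. *)
Lemma coefficient_decay (a : nat -> C) (r : R) : 0 < r < 1 ->
  (forall t, 0 < t < 1 -> exists M, 0 <= M /\ forall n, Cmod (a n) * t ^ n <= M) ->
  exists q e, 0 <= q < 1 /\ 0 <= e /\ forall n, (INR n ^ 2 + 1) * (Cmod (a n) * r ^ n) <= e * q ^ n.
Proof.
intros hr h.
set (s := sqrt r). set (t := sqrt s).
assert (hs : 0 < s < 1) by (split; [now apply sqrt_lt_R0|rewrite <- sqrt_1; apply sqrt_lt_1_alt; lra]).
assert (ht : 0 < t < 1) by (split; [now apply sqrt_lt_R0|rewrite <- sqrt_1; apply sqrt_lt_1_alt; lra]).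
assert (est : r = t ^ 4).
{ assert (t * t = s) by (apply sqrt_sqrt; lra). assert (s * s = r) by (apply sqrt_sqrt; lra).
  rewrite <- H0, <- H. ring. }
destruct (h t ht) as [M [hM hM']]. destruct (n_pow_bounded t ht) as [B [hB hB']].
exists t, ((B ^ 2 + 1) * M). split; [lra|split; [apply Rmult_le_pos; [generalize (pow2_ge_0 B); lra|auto]|]].
intros n. assert (hp : 0 < t ^ n <= 1).
{ split; [apply pow_lt; lra|]. rewrite <- (pow1 n). apply pow_incr. lra. }
rewrite est, <- pow_mult, Nat.mul_comm, pow_mult.
set (x := t ^ n) in *. specialize (hM' n). fold x in hM'. specialize (hB' n). fold x in hB'.
replace ((INR n ^ 2 + 1) * (Cmod (a n) * x ^ 4))
  with (((INR n * x) ^ 2 + x ^ 2) * (Cmod (a n) * x) * x) by ring.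
apply Rmult_le_compat_r; [lra|].
assert (0 <= INR n * x) by (apply Rmult_le_pos; [apply pos_INR|lra]).
assert ((INR n * x) ^ 2 <= B ^ 2) by (apply pow_incr; lra).
assert (x ^ 2 <= 1) by nra.
apply Rmult_le_compat; auto.
- generalize (pow2_ge_0 (INR n * x)) (pow2_ge_0 x). lra.
- apply Rmult_le_pos; [apply Cmod_ge_0|lra].
- lra.
Qed.

(** * Expansions to fourth order at the origin *)

Definition expands (r : R) (f : C -> C) (a0 a1 a2 a3 a4 : C) : Prop :=
  exists K, 0 <= K /\ forall u, Cmod u <= r ->
    Cmod (f u - (a0 + a1 * u + a2 * (u * u) + a3 * (u * u * u) + a4 * (u * u * u * u))) <= K * Cmod u ^ 5.

Lemma expands_poly (r : R) (a0 a1 a2 a3 a4 : C) :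
  expands r (fun u => a0 + a1 * u + a2 * (u * u) + a3 * (u * u * u) + a4 * (u * u * u * u))%C a0 a1 a2 a3 a4.
Proof.
exists 0. split; [lra|]. intros u _.
match goal with |- Cmod (?x - ?x) <= _ => replace (x - x)%C with (RtoC 0) by ring end.
rewrite Cmod_0. lra.
Qed.

Lemma poly4_bound (r : R) (u a0 a1 a2 a3 a4 : C) : r <= 1 -> Cmod u <= r ->
  Cmod (a0 + a1 * u + a2 * (u * u) + a3 * (u * u * u) + a4 * (u * u * u * u))
  <= Cmod a0 + Cmod a1 + Cmod a2 + Cmod a3 + Cmod a4.
Proof.
intros hr hu.
assert (p := Cmod_ge_0 u).
assert (p1 := Cmod_ge_0 a1). assert (p2 := Cmod_ge_0 a2). assert (p3 := Cmod_ge_0 a3). assert (p4 := Cmod_ge_0 a4).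
assert (hm : forall a b, Cmod b <= 1 -> Cmod (a * b) <= Cmod a).
{ intros a b hb. rewrite Cmod_mult. generalize (Cmod_ge_0 a). nra. }
assert (q1 : Cmod u <= 1) by lra.
assert (q2 : Cmod (u * u) <= 1) by (eapply Rle_trans; [now apply hm|auto]).
assert (q3 : Cmod (u * u * u) <= 1) by (eapply Rle_trans; [now apply hm|auto]).
assert (q4 : Cmod (u * u * u * u) <= 1) by (eapply Rle_trans; [now apply hm|auto]).
generalize (Cmod_triangle (a0 + a1 * u + a2 * (u * u) + a3 * (u * u * u)) (a4 * (u * u * u * u)))
  (Cmod_triangle (a0 + a1 * u + a2 * (u * u)) (a3 * (u * u * u)))
  (Cmod_triangle (a0 + a1 * u) (a2 * (u * u))) (Cmod_triangle a0 (a1 * u))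
  (hm a1 _ q1) (hm a2 _ q2) (hm a3 _ q3) (hm a4 _ q4). lra.
Qed.

(** With [P], [Q] the two polynomials, [f g - P Q = (f - P) g + P (g - Q)]; the terms of [P Q] of
    degree above 4 join the error. *)
Lemma expands_mult (r : R) (f g : C -> C) (a0 a1 a2 a3 a4 b0 b1 b2 b3 b4 : C) : r <= 1 ->
  expands r f a0 a1 a2 a3 a4 -> expands r g b0 b1 b2 b3 b4 ->
  expands r (fun u => f u * g u)%C (a0 * b0) (a0 * b1 + a1 * b0) (a0 * b2 + a1 * b1 + a2 * b0)
    (a0 * b3 + a1 * b2 + a2 * b1 + a3 * b0) (a0 * b4 + a1 * b3 + a2 * b2 + a3 * b1 + a4 * b0).
Proof.
intros hr [K [hK hf]] [L [hL hg]].
set (A := Cmod a0 + Cmod a1 + Cmod a2 + Cmod a3 + Cmod a4).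
set (B := Cmod b0 + Cmod b1 + Cmod b2 + Cmod b3 + Cmod b4).
(* [t0] to [t3] are the coefficients of degree 5 to 8 in the product; a fifth coefficient 0 brings
   them into the form of [poly4_bound]. *)
set (t0 := (a1 * b4 + a2 * b3 + a3 * b2 + a4 * b1)%C).
set (t1 := (a2 * b4 + a3 * b3 + a4 * b2)%C).
set (t2 := (a3 * b4 + a4 * b3)%C).
set (t3 := (a4 * b4)%C).
set (T := Cmod t0 + Cmod t1 + Cmod t2 + Cmod t3 + Cmod 0).
assert (pos : forall z, 0 <= Cmod z) by (intros; apply Cmod_ge_0).
assert (hA : 0 <= A) by (unfold A; repeat apply Rplus_le_le_0_compat; auto).
assert (hB : 0 <= B) by (unfold B; repeat apply Rplus_le_le_0_compat; auto).
assert (hT : 0 <= T) by (unfold T; repeat apply Rplus_le_le_0_compat; auto).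
exists (K * (B + L) + A * L + T).
assert (0 <= K * (B + L)) by (apply Rmult_le_pos; lra). assert (0 <= A * L) by (apply Rmult_le_pos; lra).
split; [lra|]. intros u hu.
assert (p := Cmod_ge_0 u). assert (p5 : 0 <= Cmod u ^ 5 <= 1).
{ split; [now apply pow_le|]. rewrite <- (pow1 5). apply pow_incr. lra. }
set (P := (a0 + a1 * u + a2 * (u * u) + a3 * (u * u * u) + a4 * (u * u * u * u))%C).
set (Q := (b0 + b1 * u + b2 * (u * u) + b3 * (u * u * u) + b4 * (u * u * u * u))%C).
assert (hP : Cmod P <= A) by (apply (poly4_bound r); auto).
assert (hQ : Cmod Q <= B) by (apply (poly4_bound r); auto).
assert (hfu := hf u hu). fold P in hfu. assert (hgu := hg u hu). fold Q in hgu.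
assert (hgb : Cmod (g u) <= B + L).
{ replace (g u) with (Q + (g u - Q))%C by ring. eapply Rle_trans; [apply Cmod_triangle|].
  assert (L * Cmod u ^ 5 <= L * 1) by (apply Rmult_le_compat_l; lra). lra. }
match goal with |- Cmod ?x <= _ => replace x with
  ((f u - P) * g u + P * (g u - Q)
   + (t0 + t1 * u + t2 * (u * u) + t3 * (u * u * u) + 0 * (u * u * u * u)) * (u * u * u * u * u))%C
  by (unfold P, Q, t0, t1, t2, t3; ring) end.
eapply Rle_trans; [apply Cmod_triangle|].
eapply Rle_trans; [apply Rplus_le_compat_r; apply Cmod_triangle|].
assert (hW := poly4_bound r u t0 t1 t2 t3 0 hr hu). fold T in hW.
rewrite (Cmod_mult (f u - P)), (Cmod_mult P), (Cmod_mult (t0 + _ + _ + _ + _)).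
replace (Cmod (u * u * u * u * u)) with (Cmod u ^ 5) by (rewrite !Cmod_mult; ring).
assert (Cmod (f u - P) * Cmod (g u) <= K * Cmod u ^ 5 * (B + L)) by (apply Rmult_le_compat; auto).
assert (Cmod P * Cmod (g u - Q) <= A * (L * Cmod u ^ 5)) by (apply Rmult_le_compat; auto).
set (W := Cmod (t0 + t1 * u + t2 * (u * u) + t3 * (u * u * u) + 0 * (u * u * u * u))) in *.
assert (W * Cmod u ^ 5 <= T * Cmod u ^ 5) by (apply Rmult_le_compat_r; lra).
lra.
Qed.

Lemma Csum_shift (a : nat -> C) (z : C) (n : nat) :
  Csum (fun k => a k * z ^ k)%C (S n) = (a O + z * Csum (fun k => a (S k) * z ^ k)%C n)%C.
Proof.
induction n as [|n IH].
- simpl. ring.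
- change (Csum (fun k => a k * z ^ k)%C (S (S n)))
    with (Csum (fun k => a k * z ^ k)%C (S n) + a (S (S n)) * z ^ (S (S n)))%C.
  rewrite IH. change (Csum (fun k => a (S k) * z ^ k)%C (S n))
    with (Csum (fun k => a (S k) * z ^ k)%C n + a (S (S n)) * z ^ S n)%C.
  change (z ^ S (S n))%C with (z * z ^ S n)%C. ring.
Qed.

Lemma Csum_tail (u : nat -> C) (m n : nat) (e d q : R) : 0 <= q < 1 -> 0 <= e -> 0 <= d ->
  (forall k, Cmod (u (S (k + m))) <= e * q ^ k * d) ->
  Cmod (Csum u (n + m) - Csum u m) <= e / (1 - q) * d.
Proof.
intros hq he hd h.
destruct n as [|n].
- simpl. replace (Csum u m - Csum u m)%C with (RtoC 0) by ring. rewrite Cmod_0.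
  apply Rmult_le_pos; auto. apply Rdiv_le_0_compat; lra.
- replace (Csum u (S n + m) - Csum u m)%C with (Csum (fun k => u (S (k + m))) n).
  + now apply Csum_le.
  + induction n as [|n IH]; simpl in *; [ring|]. rewrite IH. ring.
Qed.

Lemma small_eq_0 (x : C) : (forall eps, 0 < eps -> Cmod x <= eps) -> x = RtoC 0.
Proof.
intros h. apply Cmod_eq_0. destruct (Req_dec (Cmod x) 0) as [e|e]; auto.
assert (p := Cmod_ge_0 x). generalize (h (Cmod x / 2) ltac:(lra)). lra.
Qed.

(** [p] is the sum of the shifted series. Convergence on all of the unit disk bounds the
    coefficients by [M / t^n] for each [t < 1], which leaves room on the disk of radius [r] for the
    weights [n] and [n^2] of the derivative and of the quadratic error. *)
Lemma quotient_series (f : C -> C) (a : nat -> C) (r : R) : 0 < r < 1 ->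
  taylor_coefficients f a ->
  exists p p', C11 (fun z => Cmod z <= r) p p' /\
    expands r p (a 1%nat) (a 2%nat) (a 3%nat) (a 4%nat) (a 5%nat) /\
    forall z, Cmod z <= r -> f z = (a O + z * p z)%C.
Proof.
intros hr ha.
set (b := fun n => a (S n)).
destruct (coefficient_decay b r hr) as [q [e [hq [he hb]]]].
{ intros t ht.
  destruct (pseries_terms_bounded a t (f (RtoC t)) ltac:(lra)) as [M [hM hM']].
  - apply ha. unfold unit_disk. rewrite Cmod_R, Rabs_pos_eq; lra.
  - exists (M / t). split; [apply Rdiv_le_0_compat; lra|]. intros n.
    apply Rmult_le_reg_r with t; [lra|]. unfold Rdiv. rewrite (Rmult_assoc M), Rinv_l by lra.
    generalize (hM' (S n)). simpl. unfold b. lra. }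
assert (hqn : forall n, 0 <= q ^ n) by (intros; apply pow_le; lra).
assert (hbr : forall k, 0 <= Cmod (b k) * r ^ k).
{ intros. apply Rmult_le_pos; [apply Cmod_ge_0|apply pow_le; lra]. }
assert (hb0 : forall k, Cmod (b k) * r ^ k <= e * q ^ k).
{ intros k. generalize (hb k) (pow2_ge_0 (INR k)) (hbr k). nra. }
assert (hb2 : forall k, INR k ^ 2 * (Cmod (b k) * r ^ k) <= e * q ^ k).
{ intros k. generalize (hb k) (hbr k). nra. }
assert (hb1 : forall k, INR k * (Cmod (b k) * r ^ k) <= e * q ^ k).
{ intros k. assert (INR k <= INR k ^ 2 + 1) by (generalize (pow2_ge_0 (INR k - 1)) (pos_INR k); nra).
  generalize (hb k) (hbr k). nra. }
(* Compensates the factors [r] and [r ^ 2] in [monomial_bounds]. *)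
set (e2 := e / r ^ 2).
assert (hr2 : 0 < r ^ 2 <= r) by nra.
assert (he2 : e2 * r ^ 2 = e) by (unfold e2; field; lra).
assert (he2' : 0 <= e2) by (apply Rdiv_le_0_compat; lra).
set (F := fun k z => (b k * z ^ k)%C). set (F' := fun k z => (b k * dpow k z)%C).
assert (hpw : forall k z, Cmod z <= r -> Cmod (F k z) <= e * q ^ k).
{ intros k z hz. unfold F. rewrite Cmod_mult, Cmod_pow. eapply Rle_trans; [|apply hb0].
  apply Rmult_le_compat_l; [apply Cmod_ge_0|]. apply pow_incr. split; [apply Cmod_ge_0|auto]. }
assert (hee : forall k, e * q ^ k <= e2 * q ^ k).
{ intros k. apply Rmult_le_compat_r; auto. rewrite <- he2. nra. }
assert (hC : C11 (fun z => Cmod z <= r) (fun z => Clim (Csum (fun k => F k z))) (fun z => Clim (Csum (fun k => F' k z)))).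
{ apply C11_series with e2 q; auto.
  - intros k z hz. destruct (monomial_bounds r k z z ltac:(lra) hz hz) as [m1 _].
    split; [eapply Rle_trans; [now apply hpw|auto]|].
    unfold F'. rewrite Cmod_mult.
    apply Rmult_le_reg_l with (r ^ 2); [lra|].
    replace (r ^ 2 * (e2 * q ^ k)) with (e * q ^ k) by (rewrite <- he2; ring).
    eapply Rle_trans; [|apply (hb1 k)].
    apply Rle_trans with (Cmod (b k) * (r * Cmod (dpow k z))).
    + generalize (Cmod_ge_0 (b k)) (Cmod_ge_0 (dpow k z)). intros p1 p2.
      assert (0 <= Cmod (b k) * Cmod (dpow k z)) by (apply Rmult_le_pos; auto). nra.
    + apply (Rmult_le_compat_l (Cmod (b k))) in m1; [|apply Cmod_ge_0]. lra.
  - intros k z w hz hw. destruct (monomial_bounds r k z w ltac:(lra) hz hw) as [_ [m2 m3]].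
    assert (p := Cmod_ge_0 (z - w)). set (d := Cmod (z - w)) in *.
    unfold F, F'. split.
    + replace (b k * z ^ k - b k * w ^ k)%C with (b k * (z ^ k - w ^ k))%C by ring.
      rewrite Cmod_mult. apply Rmult_le_reg_l with (r ^ 2); [lra|].
      replace (r ^ 2 * (e2 * q ^ k * d)) with (e * q ^ k * d) by (rewrite <- he2; ring).
      apply Rle_trans with (INR k * (Cmod (b k) * r ^ k) * d); [|apply Rmult_le_compat_r; auto].
      apply (Rmult_le_compat_l (Cmod (b k))) in m2; [|apply Cmod_ge_0].
      assert (0 <= Cmod (b k) * Cmod (z ^ k - w ^ k)) by (apply Rmult_le_pos; apply Cmod_ge_0). nra.
    + replace (b k * z ^ k - b k * w ^ k - b k * dpow k w * (z - w))%C
        with (b k * (z ^ k - w ^ k - dpow k w * (z - w)))%C by ring.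
      rewrite Cmod_mult. apply Rmult_le_reg_l with (r ^ 2); [lra|].
      replace (r ^ 2 * (e2 * q ^ k * d ^ 2)) with (e * q ^ k * d ^ 2) by (rewrite <- he2; ring).
      apply Rle_trans with (INR k ^ 2 * (Cmod (b k) * r ^ k) * d ^ 2);
        [|apply Rmult_le_compat_r; auto; apply pow2_ge_0].
      apply (Rmult_le_compat_l (Cmod (b k))) in m3; [|apply Cmod_ge_0]. lra. }
set (p := fun z => Clim (Csum (fun k => F k z))) in *.
assert (hlim : forall z n, Cmod z <= r -> Cmod (p z - Csum (fun k => F k z) n) <= 2 * (e / (1 - q)) * q ^ n).
{ intros z n hz. apply Clim_geometric; auto. intros m. simpl Csum.
  replace (Csum (fun k => F k z) m + F (S m) z - Csum (fun k => F k z) m)%C with (F (S m) z) by ring.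
  eapply Rle_trans; [now apply hpw|]. apply Rmult_le_compat_l; auto. simpl. generalize (hqn m). nra. }
exists p, (fun z => Clim (Csum (fun k => F' k z))). split; [exact hC|split].
- exists (e / r ^ 5 / (1 - q)).
  assert (hr5 : 0 < r ^ 5) by (apply pow_lt; lra).
  split; [repeat apply Rdiv_le_0_compat; lra|]. intros u hu.
  assert (hu0 := Cmod_ge_0 u).
  match goal with |- Cmod (_ - ?x) <= _ => replace x with (Csum (fun k => F k u) 4)
    by (unfold F, b; simpl; ring) end.
  apply le_of_geom with (2 * (e / (1 - q))) q; auto. intros n.
  replace (p u - Csum (fun k => F k u) 4)%C with
    ((p u - Csum (fun k => F k u) (n + 4)) + (Csum (fun k => F k u) (n + 4) - Csum (fun k => F k u) 4))%C by ring.
  eapply Rle_trans; [apply Cmod_triangle|]. rewrite Rplus_comm. apply Rplus_le_compat.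
  + apply Csum_tail; auto.
    * apply Rdiv_le_0_compat; lra.
    * now apply pow_le.
    * intros k. unfold F. rewrite Cmod_mult, Cmod_pow.
      replace (S (k + 4)) with (k + 5)%nat by lia. rewrite pow_add.
      apply Rmult_le_reg_r with (r ^ 5); auto.
      replace (e / r ^ 5 * q ^ k * Cmod u ^ 5 * r ^ 5) with (e * q ^ k * Cmod u ^ 5) by (field; lra).
      apply Rle_trans with (e * q ^ (k + 5) * Cmod u ^ 5).
      -- replace (Cmod (b (k + 5)%nat) * (Cmod u ^ k * Cmod u ^ 5) * r ^ 5)
           with (Cmod (b (k + 5)%nat) * (Cmod u ^ k * r ^ 5) * Cmod u ^ 5) by ring.
         apply Rmult_le_compat_r; [now apply pow_le|].
         eapply Rle_trans; [|apply hb0]. apply Rmult_le_compat_l; [apply Cmod_ge_0|].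
         rewrite pow_add. apply Rmult_le_compat_r; [lra|]. apply pow_incr. auto.
      -- apply Rmult_le_compat_r; [now apply pow_le|]. apply Rmult_le_compat_l; auto.
         rewrite pow_add. assert (q ^ 5 <= 1) by (rewrite <- (pow1 5); apply pow_incr; lra).
         generalize (hqn k) (hqn 5%nat). nra.
  + eapply Rle_trans; [now apply hlim|]. apply Rmult_le_compat_l.
    * apply Rmult_le_pos; [lra|]. apply Rdiv_le_0_compat; lra.
    * rewrite pow_add. assert (q ^ 4 <= 1) by (rewrite <- (pow1 4); apply pow_incr; lra).
      generalize (hqn n) (hqn 4%nat). nra.
- intros z hz.
  assert (h0 : (f z - (a O + z * p z))%C = RtoC 0).
  { apply small_eq_0. intros eps heps.
    destruct (is_pseries_Csum a z (f z) (ha z ltac:(unfold unit_disk; lra)) eps heps) as [N hN].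
    apply le_of_geom with (2 * (e / (1 - q))) q; auto. intros n.
    assert (h1 := hN (S (n + N)) ltac:(lia)). rewrite Csum_shift in h1.
    assert (h2 := hlim z (n + N)%nat hz).
    change (Csum (fun k => a (S k) * z ^ k)%C (n + N)) with (Csum (fun k => F k z) (n + N)) in h1.
    set (s := Csum (fun k => F k z) (n + N)) in *.
    replace (f z - (a O + z * p z))%C with (- ((a O + z * s) - f z) - z * (p z - s))%C by ring.
    eapply Rle_trans; [apply Cmod_minus_le|]. rewrite Cmod_opp, Cmod_mult.
    assert (0 <= 2 * (e / (1 - q))) by (apply Rmult_le_pos; [lra|apply Rdiv_le_0_compat; lra]).
    assert (q ^ (n + N) <= q ^ n).
    { rewrite pow_add. assert (q ^ N <= 1) by (rewrite <- (pow1 N); apply pow_incr; lra).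
      generalize (hqn n) (hqn N). nra. }
    assert (2 * (e / (1 - q)) * q ^ (n + N) <= 2 * (e / (1 - q)) * q ^ n) by (apply Rmult_le_compat_l; auto).
    generalize (Cmod_ge_0 z) (Cmod_ge_0 (p z - s)). nra. }
  replace (f z) with (f z - (a O + z * p z) + (a O + z * p z))%C by ring. rewrite h0. ring.
Qed.

Lemma expands_at_0 (r : R) (f : C -> C) (a0 a1 a2 a3 a4 : C) : 0 <= r ->
  expands r f a0 a1 a2 a3 a4 -> f (RtoC 0) = a0.
Proof.
intros hr [K [hK h]]. assert (h0 := h (RtoC 0)). rewrite Cmod_0 in h0.
assert (e : (f (RtoC 0) - a0)%C = RtoC 0).
{ apply Cmod_eq_0. specialize (h0 hr).
  replace (f 0 - (a0 + a1 * 0 + a2 * (0 * 0) + a3 * (0 * 0 * 0) + a4 * (0 * 0 * 0 * 0)))%C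
    with (f 0 - a0)%C in h0 by ring.
  rewrite pow_i in h0 by lia. generalize (Cmod_ge_0 (f 0 - a0)). lra. }
replace (f 0) with (f 0 - a0 + a0)%C by ring. rewrite e. ring.
Qed.

(** The coefficients are tied to [f] by convergence alone, so [a 1] has to be compared with the
    derivative: [p z = f z / z] is Lipschitz with [p 0 = a 1], and at small real [t] it is the
    difference quotient of [f]. *)
Lemma taylor_normalized (f : C -> C) (a : nat -> C) : class_S f -> taylor_coefficients f a ->
  a O = RtoC 0 /\ a 1%nat = RtoC 1.
Proof.
intros [_ [_ [h0 h1]]] ha.
destruct (quotient_series f a (1/2) ltac:(lra) ha) as [p [p' [hC [hE hf]]]].
assert (e0 : a O = RtoC 0).
{ rewrite hf in h0 by (rewrite Cmod_0; lra). rewrite <- h0. ring. }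
split; auto.
assert (hp0 := expands_at_0 (1/2) _ _ _ _ _ _ ltac:(lra) hE).
destruct hC as [M [hM [_ hL]]].
assert (e1 : (a 1%nat - 1)%C = RtoC 0).
{ apply small_eq_0. intros eps heps.
  destruct h1 as [_ hd].
  specialize (hd (RtoC 0) (fun P hP => hP) (mkposreal (eps / 2) ltac:(lra))).
  destruct hd as [d hd].
  (* Below [d] for the difference quotient, below 1/2 for the expansion of [f], and so small that
     the Lipschitz error [M t] is at most [eps / 2]. *)
  set (t := Rmin (Rmin (d / 2) (1/4)) (eps / (2 * (M + 1)))).
  assert (hd0 := cond_pos d).
  assert (ht : 0 < t) by (unfold t; repeat apply Rmin_pos; try lra; apply Rdiv_lt_0_compat; lra).
  assert (ht1 : t <= Rmin (d / 2) (1/4)) by apply Rmin_l.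
  assert (ht2 : t <= d / 2) by (eapply Rle_trans; [exact ht1|apply Rmin_l]).
  assert (ht3 : t <= 1/4) by (eapply Rle_trans; [exact ht1|apply Rmin_r]).
  assert (ht4 : t * (2 * (M + 1)) <= eps).
  { apply Rle_trans with (eps / (2 * (M + 1)) * (2 * (M + 1))).
    - apply Rmult_le_compat_r; [lra|apply Rmin_r].
    - right. field. lra. }
  assert (hct : Cmod (RtoC t) = t) by (rewrite Cmod_R, Rabs_pos_eq; lra).
  assert (hb : Cmod (RtoC t - 0) < d).
  { replace (RtoC t - 0)%C with (RtoC t) by ring. lra. }
  assert (h2 : Cmod ((f (RtoC t) - f (RtoC 0)) - (RtoC t - 0) * 1) <= eps / 2 * Cmod (RtoC t - 0))
    by exact (hd (RtoC t) hb).
  replace (RtoC t - 0)%C with (RtoC t) in h2 by ring. rewrite hct in h2.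
  rewrite h0, hf, e0 in h2 by lra.
  destruct (hL (RtoC t) (RtoC 0)) as [h3 _]; [lra|rewrite Cmod_0; lra|].
  replace (RtoC t - 0)%C with (RtoC t) in h3 by ring. rewrite hct, hp0 in h3.
  assert (h4 : t * Cmod (p (RtoC t) - 1) <= eps / 2 * t).
  { rewrite <- hct at 1. rewrite <- Cmod_mult.
    replace (RtoC t * (p (RtoC t) - 1))%C with (0 + RtoC t * p (RtoC t) - 0 - RtoC t * 1)%C by ring. exact h2. }
  assert (h5 : Cmod (p (RtoC t) - 1) <= eps / 2).
  { apply Rmult_le_reg_l with t; auto. lra. }
  replace (a 1%nat - 1)%C with ((p (RtoC t) - 1) - (p (RtoC t) - a 1%nat))%C by ring.
  eapply Rle_trans; [apply Cmod_minus_le|]. nra. }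
replace (a 1%nat) with (a 1%nat - 1 + 1)%C by ring. rewrite e1. ring.
Qed.

(** * Holomorphic square roots *)

(** Turns a positive gauge function into the type that [compactness_value_2d] expects; the default 1
    is never reached there. *)
Definition posreal_of (x : R) : posreal :=
  match Rlt_dec 0 x with left h => mkposreal x h | right _ => mkposreal 1 Rlt_0_1 end.

Lemma posreal_of_eq (x : R) : 0 < x -> posreal_of x = x :> R.
Proof. unfold posreal_of. destruct (Rlt_dec 0 x); [reflexivity|contradiction]. Qed.

(** Compactness of the square [[-r, r]^2] for the gauge [g]. Around a point of the disk [g] is so
    small, compared with [|p|] there, that [|p|] stays above [g] nearby; around a point outside, it
    is so small that no point of the disk is reached. The uniform lower bound [d] of the gauges met
    is then a lower bound of [|p|]. *)
Lemma nonvanishing_lower_bound (p : C -> C) (L r : R) : 0 <= L -> 0 <= r ->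
  (forall z w, Cmod z <= r -> Cmod w <= r -> Cmod (p z - p w) <= L * Cmod (z - w)) ->
  (forall z, Cmod z <= r -> p z <> RtoC 0) ->
  exists m, 0 < m /\ forall z, Cmod z <= r -> m <= Cmod (p z).
Proof.
intros hL hr hp h0.
set (g := fun u v : R => if Rle_dec (Cmod (u, v)) r then Cmod (p (u, v)) / (4 * (L + 1))
  else (Cmod (u, v) - r) / 2).
assert (hg : forall u v, 0 < g u v).
{ intros u v. unfold g. destruct (Rle_dec _ _) as [h|h]; [|lra].
  apply Rdiv_lt_0_compat; [|lra]. apply Cmod_gt_0. auto. }
destruct (compactness_value_2d (-r) r (-r) r (fun u v => posreal_of (g u v))) as [d hd].
assert (hd0 := cond_pos d).
exists d. split; auto. intros [x y] hz.
assert (hx := re_le_Cmod (x, y)). assert (hy := im_le_Cmod (x, y)). simpl in hx, hy.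
assert (hx' : - r <= x <= r) by (apply Rabs_le_between; lra).
assert (hy' : - r <= y <= r) by (apply Rabs_le_between; lra).
apply Rnot_lt_le. intros hlt.
apply (hd x y hx' hy'). intros [u [v [_ [_ [h1 [h2 h3]]]]]].
rewrite posreal_of_eq in h1, h2, h3 by auto.
assert (hdist : Cmod ((x, y) - (u, v)) < 2 * g u v).
{ eapply Rle_lt_trans; [apply Cmod_le_Re_Im|]. simpl. unfold Rminus in h1, h2. lra. }
unfold g in *. destruct (Rle_dec (Cmod (u, v)) r) as [h|h].
- set (e := Cmod (p (u, v)) / (4 * (L + 1))) in *.
  assert (he : Cmod (p (u, v)) = 4 * (L + 1) * e) by (unfold e; field; lra).
  assert (k1 := hp (u, v) (x, y) h hz). rewrite (Cmod_minus_sym (u, v)) in k1.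
  assert (k2 := Cmod_minus_ge (p (u, v)) (p (x, y))). nra.
- assert (k := Cmod_minus_ge (u, v) (x, y)). rewrite (Cmod_minus_sym (u, v)) in k. lra.
Qed.

(** The principal branch, by the half-angle formula; the divisor is positive off the closed negative
    real axis. *)
Definition csqrt (w : C) : C :=
  let x := sqrt ((Cmod w + Re w) / 2) in (x, Im w / (2 * x)).

Lemma csqrt_sqr (w : C) : 0 < Cmod w + Re w -> (csqrt w * csqrt w)%C = w.
Proof.
intros hw. unfold csqrt.
assert (h : 0 < (Cmod w + Re w) / 2) by lra.
assert (h1 := sqrt_sqrt _ (Rlt_le _ _ h)). assert (h2 := sqrt_lt_R0 _ h).
set (x := sqrt ((Cmod w + Re w) / 2)) in *.
assert (h3 := Cmod2_alt w).
destruct w as [a b]. simpl Re in *. simpl Im in *.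
apply injective_projections; simpl.
- assert (hb : b ^ 2 = (2 * (x * x) - a) ^ 2 - a ^ 2) by (rewrite h1; lra).
  replace (x * x - b / (2 * x) * (b / (2 * x))) with (x * x - b ^ 2 / (4 * (x * x))) by (field; lra).
  rewrite hb. field. lra.
- field. lra.
Qed.

Lemma csqrt_1 : csqrt 1 = RtoC 1.
Proof.
unfold csqrt. rewrite Cmod_1. simpl. replace ((1 + 1) / 2) with 1 by field.
rewrite sqrt_1. apply injective_projections; simpl; field.
Qed.

Lemma csqrt_Re (w : C) : 1/2 <= Re w -> 1/2 <= Re (csqrt w).
Proof.
intros hw. simpl. assert (h := re_le_Cmod w). generalize (Rle_abs (Re w)). intros.
replace (1/2) with (sqrt (1/2 * (1/2))) by (apply sqrt_square; lra).
apply sqrt_le_1_alt. lra.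
Qed.

(** Roots have real part at least 1/2, so the sum of two of them has modulus at least 1, and [z - w
    = (csqrt z - csqrt w) (csqrt z + csqrt w)] gives the Lipschitz constant 1. The first order
    remainder is exactly [- (csqrt z - csqrt w)^2 / (2 csqrt w)]. *)
Lemma C11_csqrt (B : R) : C11 (fun w => 1/2 <= Re w /\ Cmod w <= B) csqrt (fun w => / (2 * csqrt w))%C.
Proof.
set (S := fun w : C => 1/2 <= Re w /\ Cmod w <= B).
assert (hre : forall w, S w -> 1/2 <= Re (csqrt w)) by (intros w [h _]; now apply csqrt_Re).
assert (hsq : forall w, S w -> (csqrt w * csqrt w)%C = w).
{ intros w [h _]. apply csqrt_sqr. generalize (Cmod_ge_0 w). lra. }
assert (hmod : forall w, S w -> 1/2 <= Cmod (csqrt w)).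
{ intros w h. generalize (hre w h) (re_le_Cmod (csqrt w)) (Rle_abs (Re (csqrt w))). lra. }
assert (hne : forall w, S w -> csqrt w <> RtoC 0).
{ intros w h. apply Cmod_ge_neq_0 with (1/2); [lra|auto]. }
assert (h2 : Cmod (RtoC 2) = 2) by (rewrite Cmod_R, Rabs_pos_eq; lra).
assert (hinv : forall w, S w -> Cmod (/ (2 * csqrt w)) <= 1).
{ intros w h. rewrite Cmod_inv, Cmod_mult, h2.
  - rewrite <- Rinv_1. apply Rinv_le_contravar; [lra|]. generalize (hmod w h). lra.
  - apply Cmod_gt_0. rewrite Cmod_mult, h2. generalize (hmod w h). lra. }
assert (hlip : forall z w, S z -> S w -> Cmod (csqrt z - csqrt w) <= Cmod (z - w)).
{ intros z w hz hw. rewrite <- (hsq z hz) at 2. rewrite <- (hsq w hw) at 2.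
  replace (csqrt z * csqrt z - csqrt w * csqrt w)%C with ((csqrt z - csqrt w) * (csqrt z + csqrt w))%C by ring.
  rewrite Cmod_mult.
  assert (1 <= Cmod (csqrt z + csqrt w)).
  { generalize (re_le_Cmod (csqrt z + csqrt w)) (Rle_abs (Re (csqrt z + csqrt w))) (hre z hz) (hre w hw).
    change (Re (csqrt z + csqrt w)) with (Re (csqrt z) + Re (csqrt w)). lra. }
  generalize (Cmod_ge_0 (csqrt z - csqrt w)). nra. }
exists (Rabs B + 1). assert (hB := Rabs_pos B). split; [lra|split].
- intros z hz. split; [|generalize (hinv z hz); lra].
  assert (Cmod (csqrt z) * Cmod (csqrt z) <= B).
  { rewrite <- Cmod_mult, hsq by auto. apply hz. }
  generalize (Rle_abs B) (Cmod_ge_0 (csqrt z)). nra.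
- intros z w hz hw. assert (p := Cmod_ge_0 (z - w)). assert (hl := hlip z w hz hw).
  split; [nra|].
  assert (e : (csqrt z - csqrt w - / (2 * csqrt w) * (z - w))%C
    = (- (/ (2 * csqrt w) * ((csqrt z - csqrt w) * (csqrt z - csqrt w))))%C).
  { rewrite <- (hsq z hz) at 2. rewrite <- (hsq w hw) at 3. field. now apply hne. }
  rewrite e, Cmod_opp, Cmod_mult, Cmod_mult.
  assert (p' := Cmod_ge_0 (csqrt z - csqrt w)).
  assert (Cmod (csqrt z - csqrt w) * Cmod (csqrt z - csqrt w) <= Cmod (z - w) ^ 2) by nra.
  generalize (hinv w hw) (Cmod_ge_0 (/ (2 * csqrt w))). intros.
  assert (0 <= Cmod (csqrt z - csqrt w) * Cmod (csqrt z - csqrt w)) by nra.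
  generalize (pow2_ge_0 (Cmod (z - w))). nra.
Qed.

(* The square root is continued from the origin along radii: over a step of length [1/N] the ratio of consecutive values of [p] stays in the half plane where [csqrt] is holomorphic. *)
Lemma inverse_sqrt_exists (p p' : C -> C) (r m : R) : 0 <= r <= 1 -> 0 < m ->
  C11 (fun z => Cmod z <= r) p p' -> p (RtoC 0) = RtoC 1 ->
  (forall z, Cmod z <= r -> m <= Cmod (p z)) ->
  exists h h', C11 (fun z => Cmod z <= r) h h' /\ h (RtoC 0) = RtoC 1 /\
    forall z, Cmod z <= r -> (h z * h z * p z)%C = RtoC 1.
Proof.
intros hr hm hp hp0 hpm.
destruct hp as [M [hM hp]]. assert (hpC : C11 (fun z => Cmod z <= r) p p') by (exists M; auto).
destruct hp as [hb hl].
(* This choice of [N] keeps the ratio of consecutive values within 1/2 of 1, hence in the half plane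
   of [C11_csqrt]. *)
assert (hN : exists N, (0 < N)%nat /\ M / INR N <= m / 2).
{ destruct (nfloor_ex (2 * M / m)) as [N [_ hN]]; [apply Rdiv_le_0_compat; lra|].
  exists (S N). split; [lia|]. rewrite S_INR.
  assert (h0 := pos_INR N).
  apply Rmult_le_reg_r with (INR N + 1); [lra|]. unfold Rdiv at 1. rewrite Rmult_assoc, Rinv_l, Rmult_1_r by lra.
  apply (Rmult_lt_compat_r m) in hN; [|lra]. unfold Rdiv in hN.
  rewrite Rmult_assoc, Rinv_l, Rmult_1_r in hN by lra. lra. }
destruct hN as [N [hN0 hN]].
assert (hNp : 0 < INR N) by (apply lt_0_INR; lia).
set (s := fun j : nat => INR j / INR N).
assert (hs : forall j, (j <= N)%nat -> 0 <= s j <= 1).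
{ intros j hj. unfold s. split; [apply Rdiv_le_0_compat; [apply pos_INR|auto]|].
  apply Rmult_le_reg_r with (INR N); auto. unfold Rdiv. rewrite Rmult_assoc, Rinv_l by lra.
  assert (INR j <= INR N) by (apply le_INR; auto). lra. }
assert (hin : forall j z, (j <= N)%nat -> Cmod z <= r -> Cmod (RtoC (s j) * z) <= r).
{ intros j z hj hz. destruct (hs j hj). rewrite Cmod_mult, Cmod_R, Rabs_pos_eq by auto.
  generalize (Cmod_ge_0 z). nra. }
assert (hne : forall j z, (j <= N)%nat -> Cmod z <= r -> p (RtoC (s j) * z)%C <> RtoC 0).
{ intros j z hj hz. apply Cmod_ge_neq_0 with m; auto. }
assert (hpj : forall j, (j <= N)%nat -> C11 (fun z => Cmod z <= r) (fun z => p (RtoC (s j) * z)%C)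
   (fun z => p' (RtoC (s j) * z) * (RtoC (s j) * 1))%C).
{ intros j hj. apply (C11_comp _ (fun z => Cmod z <= r) (fun z => (RtoC (s j) * z)%C) (fun _ => (RtoC (s j) * 1)%C)); auto.
  apply C11_scal. apply C11_id with r. auto. }
(* At stage [j] the root belongs to [p] on the disk shrunk by the factor [s j]; at stage 0 it is the
   constant 1. *)
assert (hind : forall j, (j <= N)%nat -> exists h h', C11 (fun z => Cmod z <= r) h h' /\ h (RtoC 0) = RtoC 1 /\
    forall z, Cmod z <= r -> (h z * h z * p (RtoC (s j) * z))%C = RtoC 1).
{ induction j as [|j IH]; intros hj.
  - exists (fun _ => RtoC 1), (fun _ => RtoC 0). split; [apply C11_const|split; [reflexivity|]].
    intros z _. unfold s. simpl INR. replace (0 / INR N) with 0 by (field; lra).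
    replace (RtoC 0 * z)%C with (RtoC 0) by ring. rewrite hp0. ring.
  - destruct IH as [h [h' [h1 [h2 h3]]]]; [lia|].
    assert (hj0 : (j <= N)%nat) by lia.
    set (ratio := fun z => (p (RtoC (s j) * z) * / p (RtoC (s (S j)) * z))%C).
    assert (hratio : exists ratio', C11 (fun z => Cmod z <= r) ratio ratio').
    { eexists. apply C11_mult; [apply hpj; auto|]. apply C11_inv with m; [exact hm| |apply (hpj (S j)); auto]. auto. }
    destruct hratio as [ratio' hratio].
    set (T := fun w : C => 1/2 <= Re w /\ Cmod w <= M / m).
    assert (hT : forall z, Cmod z <= r -> T (ratio z)).
    { intros z hz. assert (hnS := hne (S j) z hj hz).
      assert (hmS := hpm _ (hin (S j) z hj hz)).
      split.
      - assert (hclose : Cmod (ratio z - 1) <= 1/2).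
        { unfold ratio.
          replace (p (RtoC (s j) * z) * / p (RtoC (s (S j)) * z) - 1)%C
            with ((p (RtoC (s j) * z) - p (RtoC (s (S j)) * z)) / p (RtoC (s (S j)) * z))%C by (field; auto).
          rewrite Cmod_div by auto.
          destruct (hl _ _ (hin j z hj0 hz) (hin (S j) z hj hz)) as [k _].
          replace (RtoC (s j) * z - RtoC (s (S j)) * z)%C with (RtoC (- / INR N) * z)%C in k.
          2:{ unfold s. rewrite S_INR. destruct z as [x y]. apply injective_projections; simpl; field; lra. }
          rewrite Cmod_mult, Cmod_R, Rabs_Ropp, Rabs_pos_eq in k by (left; now apply Rinv_0_lt_compat).
          apply Rmult_le_reg_r with (Cmod (p (RtoC (s (S j)) * z)%C)); [lra|].
          unfold Rdiv. rewrite Rmult_assoc, Rinv_l, Rmult_1_r by lra.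
          eapply Rle_trans; [exact k|]. apply Rle_trans with (M / INR N); [|lra].
          unfold Rdiv. apply Rmult_le_compat_l; auto.
          assert (0 < / INR N) by now apply Rinv_0_lt_compat.
          rewrite <- (Rmult_1_r (/ INR N)) at 2. apply Rmult_le_compat_l; lra. }
        assert (k := re_le_Cmod (ratio z - 1)). change (Re (ratio z - 1)) with (Re (ratio z) - 1) in k.
        assert (k' : Rabs (Re (ratio z) - 1) <= 1/2) by lra. apply Rabs_le_between in k'. lra.
      - unfold ratio. rewrite Cmod_mult, Cmod_inv by auto.
        unfold Rdiv. apply Rmult_le_compat; [apply Cmod_ge_0|left; apply Rinv_0_lt_compat; lra| |].
        + apply hb. auto.
        + apply Rinv_le_contravar; auto. }
    exists (fun z => h z * csqrt (ratio z))%C. eexists. split; [|split].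
    + apply C11_mult; [exact h1|]. eapply (C11_comp _ T ratio); [exact hT|exact hratio|]. apply C11_csqrt.
    + rewrite h2. unfold ratio. rewrite !Cmult_0_r, hp0.
      replace (1 * / 1)%C with (RtoC 1) by field. rewrite csqrt_1. ring.
    + intros z hz. assert (hq : (csqrt (ratio z) * csqrt (ratio z))%C = ratio z).
      { apply csqrt_sqr. destruct (hT z hz). generalize (Cmod_ge_0 (ratio z)). lra. }
      replace (h z * csqrt (ratio z) * (h z * csqrt (ratio z)) * p (RtoC (s (S j)) * z))%C
        with (h z * h z * (csqrt (ratio z) * csqrt (ratio z)) * p (RtoC (s (S j)) * z))%C by ring.
      rewrite hq, <- (h3 z hz). unfold ratio. field. apply hne; auto. }
destruct (hind N (le_n N)) as [h [h' [h1 [h2 h3]]]].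
exists h, h'. split; [auto|split; [auto|]]. intros z hz. rewrite <- (h3 z hz).
f_equal. f_equal. unfold s. replace (INR N / INR N) with 1 by (field; lra). ring.
Qed.

(** * The area theorem for the class S *)

(** For the polynomial [P] with coefficients 1, [c1], ..., [c4] the four equations say
    [P^2 p = 1 + O(u^5)], while [(h - P) (h + P) p = 1 - P^2 p]. Near the origin [h + P] is close to
    2 and can be divided out; elsewhere [|u|^5] is bounded below and a crude bound on [h - P]
    suffices. *)
Lemma inverse_sqrt_expands (r m : R) (h h' p : C -> C) (a2 a3 a4 a5 c1 c2 c3 c4 : C) :
  0 < r < 1 -> 0 < m -> C11 (fun u => Cmod u <= r) h h' -> h (RtoC 0) = RtoC 1 ->
  (forall u, Cmod u <= r -> m <= Cmod (p u)) ->
  (forall u, Cmod u <= r -> (h u * h u * p u)%C = RtoC 1) ->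
  expands r p 1 a2 a3 a4 a5 ->
  (2 * c1 + a2 = 0)%C ->
  (2 * c2 + c1 * c1 + 2 * c1 * a2 + a3 = 0)%C ->
  (2 * c3 + 2 * c1 * c2 + (2 * c2 + c1 * c1) * a2 + 2 * c1 * a3 + a4 = 0)%C ->
  (2 * c4 + 2 * c1 * c3 + c2 * c2 + (2 * c3 + 2 * c1 * c2) * a2 + (2 * c2 + c1 * c1) * a3
    + 2 * c1 * a4 + a5 = 0)%C ->
  expands r h 1 c1 c2 c3 c4.
Proof.
intros hr hm [M [hM [hb hl]]] h0 hpm hhp hp e1 e2 e3 e4.
set (P := fun u => (1 + c1 * u + c2 * (u * u) + c3 * (u * u * u) + c4 * (u * u * u * u))%C).
assert (hP := expands_poly r 1 c1 c2 c3 c4). fold P in hP.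
assert (hPP := expands_mult r P P _ _ _ _ _ _ _ _ _ _ ltac:(lra) hP hP).
assert (hPPp := expands_mult r _ p _ _ _ _ _ _ _ _ _ _ ltac:(lra) hPP hp).
destruct hPPp as [K [hK hQ]].
assert (hQ' : forall u, Cmod u <= r -> Cmod (P u * P u * p u - 1) <= K * Cmod u ^ 5).
{ intros u hu. specialize (hQ u hu).
  match type of hQ with Cmod (?x - ?y) <= _ => replace (P u * P u * p u - 1)%C with (x - y)%C; [exact hQ|] end.
  f_equal. f_equal.
  transitivity (1 + (2 * c1 + a2) * u + (2 * c2 + c1 * c1 + 2 * c1 * a2 + a3) * (u * u)
    + (2 * c3 + 2 * c1 * c2 + (2 * c2 + c1 * c1) * a2 + 2 * c1 * a3 + a4) * (u * u * u)
    + (2 * c4 + 2 * c1 * c3 + c2 * c2 + (2 * c3 + 2 * c1 * c2) * a2 + (2 * c2 + c1 * c1) * a3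
      + 2 * c1 * a4 + a5) * (u * u * u * u))%C; [ring|].
  rewrite e1, e2, e3, e4. ring. }
clear hQ hPP hP.
set (D := Cmod c1 + Cmod c2 + Cmod c3 + Cmod c4).
assert (hD : 0 <= D).
{ unfold D. generalize (Cmod_ge_0 c1) (Cmod_ge_0 c2) (Cmod_ge_0 c3) (Cmod_ge_0 c4). lra. }
assert (hP1 : forall u, Cmod u <= r -> Cmod (P u - 1) <= D * Cmod u).
{ intros u hu. unfold P.
  replace (1 + c1 * u + c2 * (u * u) + c3 * (u * u * u) + c4 * (u * u * u * u) - 1)%C
    with ((c1 + c2 * u + c3 * (u * u) + c4 * (u * u * u) + 0 * (u * u * u * u)) * u)%C by ring.
  rewrite Cmod_mult. apply Rmult_le_compat_r; [apply Cmod_ge_0|].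
  eapply Rle_trans; [apply (poly4_bound r); auto; lra|]. rewrite Cmod_0. unfold D. lra. }
assert (hh1 : forall u, Cmod u <= r -> Cmod (h u - 1) <= M * Cmod u).
{ intros u hu. destruct (hl u (RtoC 0) hu) as [k _]; [rewrite Cmod_0; lra|].
  rewrite h0 in k. replace (u - 0)%C with u in k by ring. exact k. }
(* For [|u| <= d] the distances of [h u] and [P u] from 1 add up to at most 1, so
   [|h u + P u| >= 1]. *)
set (d := / (M + D + 1)).
assert (hd : 0 < d) by (apply Rinv_0_lt_compat; lra).
assert (hd1 : d * (M + D + 1) = 1) by (unfold d; field; lra).
assert (hd5 : 0 < d ^ 5) by now apply pow_lt.
exists (K / m + (M + 1 + D) / d ^ 5).
assert (q1 : 0 <= K / m) by (apply Rdiv_le_0_compat; lra).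
assert (q2 : 0 <= (M + 1 + D) / d ^ 5) by (apply Rdiv_le_0_compat; lra).
split; [lra|]. intros u hu. change (Cmod (h u - P u) <= (K / m + (M + 1 + D) / d ^ 5) * Cmod u ^ 5).
assert (hu0 := Cmod_ge_0 u). assert (hu5 : 0 <= Cmod u ^ 5) by now apply pow_le.
destruct (Rle_dec (Cmod u) d) as [hud|hud].
- assert (hsum : 1 <= Cmod (h u + P u)).
  { replace (h u + P u)%C with (2 - ((1 - h u) + (1 - P u)))%C by ring.
    assert (k := Cmod_minus_ge 2 ((1 - h u) + (1 - P u))%C).
    assert (k1 := Cmod_triangle (1 - h u) (1 - P u)).
    rewrite (Cmod_minus_sym 1 (h u)), (Cmod_minus_sym 1 (P u)) in k1.
    rewrite Cmod_R, (Rabs_pos_eq 2) in k by lra.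
    generalize (hh1 u hu) (hP1 u hu). assert ((M + D) * Cmod u <= (M + D) * d) by (apply Rmult_le_compat_l; lra).
    nra. }
  apply Rle_trans with (K / m * Cmod u ^ 5); [|nra].
  assert (e : ((h u - P u) * (h u + P u) * p u)%C = (- (P u * P u * p u - 1))%C).
  { rewrite <- (hhp u hu). ring. }
  assert (k := hQ' u hu). rewrite <- Cmod_opp, <- e, !Cmod_mult in k.
  assert (hmu := hpm u hu).
  apply Rmult_le_reg_r with m; auto.
  replace (K / m * Cmod u ^ 5 * m) with (K * Cmod u ^ 5) by (field; lra).
  eapply Rle_trans; [|exact k].
  assert (p0 := Cmod_ge_0 (h u - P u)).
  apply Rmult_le_compat; auto; [lra|]. nra.
- apply Rle_trans with ((M + 1 + D) / d ^ 5 * Cmod u ^ 5); [|nra].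
  assert (k5 : d ^ 5 <= Cmod u ^ 5) by (apply pow_incr; lra).
  apply Rle_trans with (M + 1 + D).
  + replace (h u - P u)%C with (h u - 1 - (P u - 1))%C by ring.
    eapply Rle_trans; [apply Cmod_minus_le|]. generalize (hh1 u hu) (hP1 u hu). nra.
  + apply Rmult_le_reg_r with (d ^ 5); auto.
    replace ((M + 1 + D) / d ^ 5 * Cmod u ^ 5 * d ^ 5) with ((M + 1 + D) * Cmod u ^ 5) by (field; lra).
    apply Rmult_le_compat_l; lra.
Qed.

Lemma unit_square_root (w : C) : Cmod w = 1 -> exists s, (s * s)%C = w /\ Cmod s = 1.
Proof.
intros hw.
assert (hs : exists s, (s * s)%C = w).
{ destruct (Rlt_dec 0 (1 + Re w)) as [h|h].
  - exists (csqrt w). apply csqrt_sqr. lra.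
  (* Here [w = -1], the one unit number that [csqrt_sqr] excludes. *)
  - exists Ci. assert (k := Cmod2_alt w). rewrite hw in k. destruct w as [x y]. simpl in *.
    assert (x <= -1) by lra. assert (x * x + y * y = 1) by lra.
    assert (0 <= y * y) by nra. assert (x * x >= 1) by nra.
    assert (y * y = 0) by nra. assert (y = 0) by nra. assert (x = -1) by nra.
    subst. apply injective_projections; simpl; ring. }
destruct hs as [s hs]. exists s. split; auto.
assert (k := f_equal Cmod hs). rewrite Cmod_mult, hw in k.
generalize (Cmod_ge_0 s). nra.
Qed.

(** The rotation is a square because [u = z^2]: replacing [z] by [s z] in [F] multiplies [u] by
    [s^2]. The other coefficients change by unimodular factors. *)
Lemma rotate_to_real (c : C) : exists s, Cmod s = 1 /\ (c * (s * s))%C = RtoC (Cmod c).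
Proof.
destruct (Req_dec (Cmod c) 0) as [e|e].
- exists 1. rewrite Cmod_1. split; auto. rewrite e, (Cmod_eq_0 c e). ring.
- assert (hc : 0 < Cmod c) by (generalize (Cmod_ge_0 c); lra).
  destruct (unit_square_root (Cconj c / RtoC (Cmod c))%C) as [s [hs hs1]].
  + rewrite Cmod_div, Cmod_conj, Cmod_R, Rabs_pos_eq by (try lra; intros k; apply e; now injection k).
    field. lra.
  + exists s. split; auto. rewrite hs.
    replace (c * (Cconj c / Cmod c))%C with (c * Cconj c / Cmod c)%C by (field; intros k; apply e; now injection k).
    rewrite <- Cmod2_conj. rewrite RtoC_pow. simpl. field. intros k; apply e; now injection k.
Qed.

Lemma area_theorem (h h' : C -> C) (r : R) (c1 c2 c3 c4 : C) : 0 < r < 1 ->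
  C11 (fun u => Cmod u <= r) h h' -> expands r h 1 c1 c2 c3 c4 ->
  (forall z w, z <> RtoC 0 -> w <> RtoC 0 -> Cmod (z * z) <= r -> Cmod (w * w) <= r ->
     (h (z * z) / z = h (w * w) / w)%C -> z = w) ->
  Cmod c1 ^ 2 * r + 3 * Cmod c2 ^ 2 * r ^ 3 + 5 * Cmod c3 ^ 2 * r ^ 5 + 7 * Cmod c4 ^ 2 * r ^ 7 <= / r.
Proof.
intros hr hC [K [hK hE]] hinj.
destruct (rotate_to_real c1) as [s [hs1 hsc]].
set (w := (s * s)%C) in *.
assert (hw : Cmod w = 1) by (unfold w; rewrite Cmod_mult, hs1; ring).
assert (hwu : forall u, Cmod (w * u) = Cmod u) by (intros; rewrite Cmod_mult, hw; ring).
assert (hs0 : s <> RtoC 0) by (apply Cmod_ge_neq_0 with 1; lra).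
assert (hres := area_theorem_real (fun u => h (w * u)%C) (fun u => h' (w * u) * (w * 1))%C r (Cmod c1)
  (c2 * (w * w)) (c3 * (w * w * w)) (c4 * (w * w * w * w)) hr (Cmod_ge_0 c1)).
rewrite !Cmod_mult, hw, !Rmult_1_r in hres.
apply hres with K; auto.
- apply (C11_comp _ (fun u => Cmod u <= r) (fun u => w * u)%C (fun _ => w * 1)%C); auto.
  + intros u hu. now rewrite hwu.
  + apply C11_scal. apply C11_id with r. auto.
- intros u hu. assert (k := hE (w * u)%C). rewrite hwu in k. specialize (k hu).
  rewrite <- hsc.
  match type of k with Cmod (_ - ?x) <= _ => match goal with |- Cmod (_ - ?y) <= _ => replace y with x by ring end end.
  exact k.
- intros z z' hz hz' hzr hzr' e.
  assert (e' : (s * z)%C = (s * z')%C).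
  { apply hinj.
    - apply Cmult_neq_0; auto.
    - apply Cmult_neq_0; auto.
    - rewrite !Cmod_mult, hs1 in *. lra.
    - rewrite !Cmod_mult, hs1 in *. lra.
    - replace (s * z * (s * z))%C with (w * (z * z))%C by (unfold w; ring).
      replace (s * z' * (s * z'))%C with (w * (z' * z'))%C by (unfold w; ring).
      replace (h (w * (z * z)) / (s * z))%C with (h (w * (z * z)) / z / s)%C by (field; auto).
      rewrite e. field. auto. }
  replace z with (s * z / s)%C by (field; auto). rewrite e'. field. auto.
Qed.

(** The four equations are the coefficients of [u] to [u^4] in [h^2 p = 1]. Injectivity of [F] comes
    from [f (z^2) = 1 / F(z)^2]: equal values of [F] give [z^2 = w^2], and then
    [h (w^2) / z = h (w^2) / w] with [h] nonzero gives [z = w]. *)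
Lemma class_S_area (f : C -> C) (a : nat -> C) (c1 c2 c3 c4 : C) :
  class_S f -> taylor_coefficients f a ->
  (2 * c1 + a 2%nat = 0)%C ->
  (2 * c2 + c1 * c1 + 2 * c1 * a 2%nat + a 3%nat = 0)%C ->
  (2 * c3 + 2 * c1 * c2 + (2 * c2 + c1 * c1) * a 2%nat + 2 * c1 * a 3%nat + a 4%nat = 0)%C ->
  (2 * c4 + 2 * c1 * c3 + c2 * c2 + (2 * c3 + 2 * c1 * c2) * a 2%nat + (2 * c2 + c1 * c1) * a 3%nat
    + 2 * c1 * a 4%nat + a 5%nat = 0)%C ->
  Cmod c1 ^ 2 + 3 * Cmod c2 ^ 2 + 5 * Cmod c3 ^ 2 + 7 * Cmod c4 ^ 2 <= 1.
Proof.
intros hS ha e1 e2 e3 e4.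
destruct (taylor_normalized f a hS ha) as [a0 a1].
destruct hS as [_ [huniv [f0 _]]].
assert (hr : forall r, 0 < r < 1 ->
  Cmod c1 ^ 2 * r + 3 * Cmod c2 ^ 2 * r ^ 3 + 5 * Cmod c3 ^ 2 * r ^ 5 + 7 * Cmod c4 ^ 2 * r ^ 7 <= / r).
{ intros r hr.
  destruct (quotient_series f a r hr ha) as [p [p' [hC [hE hf]]]].
  rewrite a0 in hf. rewrite a1 in hE.
  assert (hp0 := expands_at_0 r _ _ _ _ _ _ ltac:(lra) hE).
  (* A zero of [p] is a zero of [f], hence the origin by univalence, but [p 0 = 1]. *)
  assert (hpne : forall z, Cmod z <= r -> p z <> RtoC 0).
  { intros z hz hpz.
    assert (z = RtoC 0).
    { apply huniv; unfold unit_disk; [lra|rewrite Cmod_0; lra|].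
      rewrite f0, hf by auto. rewrite hpz. ring. }
    subst z. rewrite hp0 in hpz. injection hpz. lra. }
  assert (hC' := hC). destruct hC' as [M [hM [_ hl]]].
  destruct (nonvanishing_lower_bound p M r hM ltac:(lra)) as [m [hm hpm]]; auto.
  { intros z w hz hw. apply hl; auto. }
  destruct (inverse_sqrt_exists p p' r m ltac:(lra) hm hC hp0 hpm) as [h [h' [hhC [hh0 hhp]]]].
  apply (area_theorem h h'); auto.
  - apply (inverse_sqrt_expands r m h h' p (a 2%nat) (a 3%nat) (a 4%nat) (a 5%nat)); auto.
  - intros z w hz hw hzr hwr e.
    assert (hhne : forall u, Cmod u <= r -> h u <> RtoC 0).
    { intros u hu hu0. assert (k := hhp u hu). rewrite hu0 in k.
      replace (0 * 0 * p u)%C with (RtoC 0) in k by ring. injection k. lra. }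
    assert (hzz : (z * z)%C <> RtoC 0) by now apply Cmult_neq_0.
    assert (hww : (w * w)%C <> RtoC 0) by now apply Cmult_neq_0.
    assert (hfz : forall v, v <> RtoC 0 -> Cmod (v * v) <= r ->
       f (v * v)%C = (/ ((h (v * v) / v) * (h (v * v) / v)))%C).
    { intros v hv hvr. rewrite hf by auto.
      assert (k := hhp _ hvr). assert (k' := hhne _ hvr).
      replace (p (v * v)%C) with (1 / (h (v * v) * h (v * v)))%C by (rewrite <- k; field; auto).
      field. auto. }
    assert (ezw : (z * z)%C = (w * w)%C).
    { apply huniv; unfold unit_disk; try lra. rewrite !hfz by auto. now rewrite e. }
    rewrite ezw in e. assert (k' := hhne _ hwr).
    replace z with (h (w * w) / (h (w * w) / z))%C by (field; auto).
    rewrite e. field. auto. }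
set (X := Cmod c1 ^ 2 + 3 * Cmod c2 ^ 2 + 5 * Cmod c3 ^ 2 + 7 * Cmod c4 ^ 2).
assert (p1 := pow2_ge_0 (Cmod c1)). assert (p2 := pow2_ge_0 (Cmod c2)).
assert (p3 := pow2_ge_0 (Cmod c3)). assert (p4 := pow2_ge_0 (Cmod c4)).
assert (hX : 0 <= X) by (unfold X; lra).
apply le_of_harmonic with (8 * X). intros n.
assert (hn : 0 < INR (S n)) by (apply lt_0_INR; lia).
assert (hn1 : 1 <= INR (S n)) by (rewrite S_INR; generalize (pos_INR n); lra).
set (t := / (INR (S n) + 1)).
assert (ht : 0 < t <= 1/2).
{ split; [apply Rinv_0_lt_compat; lra|]. unfold t. replace (1/2) with (/ 2) by field. apply Rinv_le_contravar; lra. }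
assert (htn : t <= / INR (S n)) by (apply Rinv_le_contravar; lra).
set (r := 1 - t).
assert (hrr : 0 < r < 1) by (unfold r; lra).
specialize (hr r hrr).
assert (hpw : forall j m, r ^ (j + m) <= r ^ j).
{ intros j m. rewrite pow_add. assert (0 < r ^ j) by (apply pow_lt; lra).
  assert (r ^ m <= 1) by (rewrite <- (pow1 m); apply pow_incr; lra). nra. }
(* Lowering all powers to [r ^ 7] gives [X * r ^ 8 <= 1], and [r ^ 8 >= 1 - 8 t] lets [t] tend to
   0. *)
assert (k1 := hpw 1%nat 6%nat). assert (k2 := hpw 3%nat 4%nat). assert (k3 := hpw 5%nat 2%nat).
change (1 + 6)%nat with 7%nat in k1. change (3 + 4)%nat with 7%nat in k2. change (5 + 2)%nat with 7%nat in k3.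
rewrite pow_1 in k1.
assert (h8 : X * r ^ 8 <= 1).
{ assert (X * r ^ 7 <= / r) by (unfold X; nra).
  replace (X * r ^ 8) with (X * r ^ 7 * r) by ring.
  replace 1 with (/ r * r) by (field; lra). apply Rmult_le_compat_r; lra. }
assert (hbern : 1 - 8 * t <= r ^ 8).
{ unfold r. assert (q1 : 1 - 2 * t <= (1 - t) ^ 2) by nra.
  destruct (Rle_dec (1 - 8 * t) 0) as [hz|hz]; [apply Rle_trans with 0; [auto|apply pow_le; lra]|].
  assert (q2 : 1 - 4 * t <= (1 - t) ^ 4).
  { replace ((1 - t) ^ 4) with ((1 - t) ^ 2 * (1 - t) ^ 2) by ring. nra. }
  replace ((1 - t) ^ 8) with ((1 - t) ^ 4 * (1 - t) ^ 4) by ring. nra. }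
assert (X * (1 - 8 * t) <= 1) by (eapply Rle_trans; [apply Rmult_le_compat_l; [auto|exact hbern]|auto]).
unfold Rdiv. assert (8 * X * t <= 8 * X * / INR (S n)) by (apply Rmult_le_compat_l; lra).
lra.
Qed.

(** * The coefficient estimates *)

(** [p] is even, so subtracting its expansions at [t] and [- t] leaves
    [2 t (a 2 + a 4 t^2) = O(t^5)]; letting [t] tend to 0 gives [a 2 = 0] and then [a 4 = 0]. *)
Lemma odd_even_coefficients (f : C -> C) (a : nat -> C) :
  class_S f -> taylor_coefficients f a -> odd_in_disk f ->
  a 2%nat = RtoC 0 /\ a 4%nat = RtoC 0.
Proof.
intros hS ha hodd.
destruct (taylor_normalized f a hS ha) as [a0 a1].
destruct (quotient_series f a (1/2) ltac:(lra) ha) as [p [p' [_ [[K [hK hE]] hf]]]].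
rewrite a0 in hf. rewrite a1 in hE.
assert (key : forall t, 0 < t <= 1/2 -> Cmod (a 2%nat + a 4%nat * RtoC (t ^ 2)) <= K * t ^ 4).
{ intros t ht.
  assert (hct : Cmod (RtoC t) = t) by (rewrite Cmod_R, Rabs_pos_eq; lra).
  assert (hct' : Cmod (- RtoC t) = t) by now rewrite Cmod_opp.
  assert (k1 := hE (RtoC t) ltac:(lra)). assert (k2 := hE (- RtoC t)%C ltac:(lra)).
  rewrite hct in k1. rewrite hct' in k2.
  assert (hne : RtoC t <> RtoC 0) by (apply Cmod_ge_neq_0 with t; lra).
  assert (heven : p (- RtoC t)%C = p (RtoC t)).
  { assert (k := hodd (RtoC t) ltac:(unfold unit_disk; lra)). rewrite !hf in k by lra.
    replace (p (- RtoC t)%C) with ((0 + - RtoC t * p (- RtoC t)) / (- RtoC t))%C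
      by (field; auto).
    rewrite k. field. auto. }
  rewrite heven in k2.
  match type of k1 with Cmod ?x <= _ => match type of k2 with Cmod ?y <= _ =>
    assert (k3 := Cmod_minus_le y x) end end.
  match type of k3 with Cmod ?x <= _ =>
    replace x with (RtoC (2 * t) * (a 2%nat + a 4%nat * RtoC (t ^ 2)))%C in k3 end.
  2:{ rewrite RtoC_mult, RtoC_pow. simpl. ring. }
  rewrite Cmod_mult, Cmod_R, Rabs_pos_eq in k3 by lra.
  apply Rmult_le_reg_l with (2 * t); [lra|].
  replace (2 * t * (K * t ^ 4)) with (K * t ^ 5 + K * t ^ 5) by ring. lra. }
assert (hseq : forall n, 0 < / (2 * INR (S n)) <= 1/2 /\ / (2 * INR (S n)) <= / INR (S n)).
{ intros n. assert (h1 : 1 <= INR (S n)) by (rewrite S_INR; generalize (pos_INR n); lra).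
  assert (k : 0 < / INR (S n) <= 1).
  { split; [apply Rinv_0_lt_compat; lra|]. rewrite <- Rinv_1. apply Rinv_le_contravar; lra. }
  rewrite Rinv_mult. lra. }
assert (zero : forall x : C, Cmod x <= 0 -> x = RtoC 0).
{ intros x hx. apply Cmod_eq_0. generalize (Cmod_ge_0 x). lra. }
assert (h2 : a 2%nat = RtoC 0).
{ apply zero. apply le_of_harmonic with (Cmod (a 4%nat) + K). intros n.
  destruct (hseq n) as [ht htn]. set (t := / (2 * INR (S n))) in *.
  assert (k := key t ht).
  replace (a 2%nat) with ((a 2%nat + a 4%nat * RtoC (t ^ 2)) - a 4%nat * RtoC (t ^ 2))%C by ring.
  eapply Rle_trans; [apply Cmod_minus_le|].
  rewrite (Cmod_mult (a 4%nat)), Cmod_R, (Rabs_pos_eq (t ^ 2)) by apply pow2_ge_0.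
  assert (hp := Cmod_ge_0 (a 4%nat)).
  assert (t ^ 2 <= t) by nra.
  assert (t ^ 4 <= t) by (replace (t ^ 4) with (t ^ 2 * t ^ 2) by ring; nra).
  assert (K * t ^ 4 <= K * t) by (apply Rmult_le_compat_l; lra).
  assert (Cmod (a 4%nat) * t ^ 2 <= Cmod (a 4%nat) * t) by (apply Rmult_le_compat_l; lra).
  assert ((Cmod (a 4%nat) + K) * t <= (Cmod (a 4%nat) + K) * / INR (S n)) by (apply Rmult_le_compat_l; lra).
  unfold Rdiv. lra. }
split; auto.
apply zero. apply le_of_harmonic with K. intros n.
destruct (hseq n) as [ht htn]. set (t := / (2 * INR (S n))) in *.
assert (k := key t ht). rewrite h2, Cplus_0_l, Cmod_mult, Cmod_R, (Rabs_pos_eq (t ^ 2)) in k by apply pow2_ge_0.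
assert (k2 : Cmod (a 4%nat) <= K * t ^ 2).
{ apply Rmult_le_reg_r with (t ^ 2); [apply pow_lt; lra|]. replace (K * t ^ 2 * t ^ 2) with (K * t ^ 4) by ring. exact k. }
assert (t ^ 2 <= t) by nra.
assert (K * t ^ 2 <= K * / INR (S n)) by (apply Rmult_le_compat_l; lra).
unfold Rdiv. lra.
Qed.

(** The objective of [c6] is this expression with [z] replaced by the largest value the constraint
    allows, [sqrt (1 - x^2 - 3 y^2) / sqrt 5]. *)
Lemma c6_objective_bound (x y z : R) : 0 <= x -> 0 <= y -> 0 <= z ->
  x ^ 2 + 3 * y ^ 2 + 5 * z ^ 2 <= 1 -> 2 * z + 4 * x * y + x ^ 3 <= c6.
Proof.
intros hx hy hz h.
destruct c6_is_max as [_ hmax].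
assert (h3 : sqrt 3 * sqrt 3 = 3) by (apply sqrt_sqrt; lra).
assert (p3 : 0 < sqrt 3) by (apply sqrt_lt_R0; lra).
assert (h5 : sqrt 5 * sqrt 5 = 5) by (apply sqrt_sqrt; lra).
assert (p5 : 0 < sqrt 5) by (apply sqrt_lt_R0; lra).
assert (hD : D1 x y).
{ split; [split; nra|split; auto].
  apply Rmult_le_reg_l with (sqrt 3); auto.
  replace (sqrt 3 * (1 / sqrt 3 * sqrt (1 - x ^ 2))) with (sqrt (1 - x ^ 2)) by (field; lra).
  rewrite <- (sqrt_square y) by auto. rewrite <- sqrt_mult by nra.
  apply sqrt_le_1_alt. nra. }
eapply Rle_trans; [|apply (hmax x y hD)]. unfold c6_objective.
assert (hz5 : sqrt 5 * z <= sqrt (1 - x ^ 2 - 3 * y ^ 2)).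
{ rewrite <- (sqrt_square z) by auto. rewrite <- sqrt_mult by nra. apply sqrt_le_1_alt. nra. }
assert (2 * z <= 2 / sqrt 5 * sqrt (1 - x ^ 2 - 3 * y ^ 2)); [|lra].
replace (2 * z) with (2 / sqrt 5 * (sqrt 5 * z)) by (field; lra).
apply Rmult_le_compat_l; auto. left. apply Rdiv_lt_0_compat; lra.
Qed.

Lemma c6_bounds : 175185 / 100000 <= c6 < 175186 / 100000.
Proof.
destruct c6_is_max as [[x [y [hD e]]] hmax]. split.
(* A decimal approximation of the maximizer of [c6_profile]; its value there is a lower bound for
   [c6]. *)
- set (t := 836343 / 1000000).
  destruct (c6_profile_attained t) as [y' [hD' e']]; [unfold t; lra|].
  eapply Rle_trans; [|apply (hmax t y' hD')]. rewrite e'. unfold c6_profile.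
  rewrite <- sqrt_mult by (unfold t; lra).
  assert (175185 / 100000 - t ^ 3 <= sqrt ((1 - t ^ 2) * (4 / 5 + 16 / 3 * t ^ 2))); [|lra].
  rewrite <- (sqrt_square (175185 / 100000 - t ^ 3)) by (unfold t; lra).
  apply sqrt_le_1_alt. unfold t. lra.
- rewrite <- e. eapply Rle_lt_trans; [now apply c6_objective_le_profile|].
  destruct hD as [hx _]. unfold c6_profile.
  assert (hx3 : x ^ 3 <= 1) by (rewrite <- (pow1 3); apply pow_incr; lra).
  rewrite <- sqrt_mult by nra.
  assert (sqrt ((1 - x ^ 2) * (4 / 5 + 16 / 3 * x ^ 2)) < 175186 / 100000 - x ^ 3); [|lra].
  (* Squaring turns the claim into the positivity of a polynomial of degree 6 that almost has a
     double zero at the maximizer. *)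
  rewrite <- (sqrt_square (175186 / 100000 - x ^ 3)) by lra.
  apply sqrt_lt_1_alt. split; [apply Rmult_le_pos; nra|].
  (* Division of the difference by [(x - t)^2], with [t] close to the maximizer of [c6_profile]. *)
  set (t := 836343 / 1000000).
  set (s0 := 5 * t ^ 4 + 16 * t ^ 2 - 4 * (175186 / 100000) * t - 68 / 15).
  set (s1 := 4 * t ^ 3 + 32 / 3 * t - 2 * (175186 / 100000)).
  set (s2 := 3 * t ^ 2 + 16 / 3).
  assert (k0 : 0 <= (x - t) ^ 2 * (x ^ 4 + 2 * t * x ^ 3 + s2 * x ^ 2 + s1 * x + s0)).
  { apply Rmult_le_pos; [apply pow2_ge_0|].
    assert (0 <= x ^ 2) by apply pow2_ge_0. assert (0 <= x ^ 3) by (apply pow_le; lra).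
    assert (0 <= x ^ 4) by (apply pow_le; lra).
    unfold s2, s1, s0, t. lra. }
  unfold s2, s1, s0, t in k0. lra.
Qed.

Theorem theorem6 (f : C -> C) (a : nat -> C)
  (hS : class_S f) (ha : taylor_coefficients f a) :
  (Cmod (a 4%nat) - Cmod (a 3%nat) <= c6 /\ 175185 / 100000 <= c6 < 175186 / 100000) /\
  (odd_in_disk f ->
     Cmod (a 5%nat) - Cmod (a 3%nat) <= 2 / sqrt 7 /\
     7559 / 10000 <= 2 / sqrt 7 < 7560 / 10000).
Proof.
(* The equations of [class_S_area] are triangular and are solved for [c1] to [c4] in turn. *)
set (c1 := (- a 2%nat / 2)%C).
set (c2 := (- (c1 * c1 + 2 * c1 * a 2%nat + a 3%nat) / 2)%C).
set (c3 := (- (2 * c1 * c2 + (2 * c2 + c1 * c1) * a 2%nat + 2 * c1 * a 3%nat + a 4%nat) / 2)%C).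
set (c4 := (- (2 * c1 * c3 + c2 * c2 + (2 * c3 + 2 * c1 * c2) * a 2%nat + (2 * c2 + c1 * c1) * a 3%nat
    + 2 * c1 * a 4%nat + a 5%nat) / 2)%C).
assert (h := class_S_area f a c1 c2 c3 c4 hS ha ltac:(unfold c1; field) ltac:(unfold c2; field)
  ltac:(unfold c3; field) ltac:(unfold c4; field)).
assert (p1 := Cmod_ge_0 c1). assert (p2 := Cmod_ge_0 c2). assert (p3 := Cmod_ge_0 c3). assert (p4 := Cmod_ge_0 c4).
assert (q1 := pow2_ge_0 (Cmod c1)). assert (q2 := pow2_ge_0 (Cmod c2)).
assert (q3 := pow2_ge_0 (Cmod c3)). assert (q4 := pow2_ge_0 (Cmod c4)).
split; [split; [|exact c6_bounds]|].
- (* Since [|c1| <= 1], adding [c1 * a 3] costs at most [|a 3|]. *)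
  assert (e : (a 4%nat + c1 * a 3%nat)%C = (- (2 * c3) + 4 * c1 * c2 - c1 * c1 * c1)%C)
    by (unfold c3, c2, c1; field).
  assert (k : Cmod (a 4%nat) <= Cmod (a 4%nat + c1 * a 3%nat) + Cmod c1 * Cmod (a 3%nat)).
  { rewrite <- Cmod_mult. replace (a 4%nat) with (a 4%nat + c1 * a 3%nat - c1 * a 3%nat)%C at 1 by ring.
    apply Cmod_minus_le. }
  assert (k2 : Cmod (a 4%nat + c1 * a 3%nat) <= 2 * Cmod c3 + 4 * Cmod c1 * Cmod c2 + Cmod c1 ^ 3).
  { rewrite e. eapply Rle_trans; [apply Cmod_minus_le|].
    eapply Rle_trans; [apply Rplus_le_compat_r; apply Cmod_triangle|].
    rewrite Cmod_opp, !Cmod_mult, !Cmod_R, !Rabs_pos_eq by lra. right. ring. }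
  assert (k3 := c6_objective_bound (Cmod c1) (Cmod c2) (Cmod c3) p1 p2 p3 ltac:(lra)).
  assert (Cmod c1 <= 1) by nra.
  generalize (Cmod_ge_0 (a 3%nat)). nra.
- intros hodd.
  destruct (odd_even_coefficients f a hS ha hodd) as [a2 a4].
  assert (e1 : c1 = RtoC 0) by (unfold c1; rewrite a2; field).
  assert (e3 : a 3%nat = (- (2 * c2))%C) by (unfold c2; rewrite e1; field).
  assert (e3' : c3 = RtoC 0) by (unfold c3; rewrite e1, a2, a4; field).
  assert (e5 : a 5%nat = (3 * (c2 * c2) - 2 * c4)%C).
  { unfold c4. rewrite e1, e3', a2, a4, e3. field. }
  assert (h7 : sqrt 7 * sqrt 7 = 7) by (apply sqrt_sqrt; lra).
  assert (p7 : 0 < sqrt 7) by (apply sqrt_lt_R0; lra).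
  split; [|split].
  + rewrite e3, e5, Cmod_opp.
    assert (k := Cmod_minus_le (3 * (c2 * c2)) (2 * c4)).
    rewrite !Cmod_mult, !Cmod_R, !Rabs_pos_eq in * by lra.
    rewrite e1, e3', Cmod_0 in h.
    (* Follows from [3 |c2|^2 <= 1] and makes [3 |c2|^2] at most [2 |c2| = |a 3|]. *)
    assert (Cmod c2 <= 2 / 3) by nra.
    assert (hs : sqrt 7 * Cmod c4 <= 1) by nra.
    assert (2 * Cmod c4 <= 2 / sqrt 7); [|nra].
    apply Rmult_le_reg_l with (sqrt 7); auto.
    replace (sqrt 7 * (2 / sqrt 7)) with 2 by (field; lra). lra.
  + apply Rmult_le_reg_r with (sqrt 7); auto.
    replace (2 / sqrt 7 * sqrt 7) with 2 by (field; lra). nra.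
  + apply Rmult_lt_reg_r with (sqrt 7); auto.
    replace (2 / sqrt 7 * sqrt 7) with 2 by (field; lra). nra.
Qed.
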